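(* Let $G$ be a locally convex Lie group with Lie algebra $\mathfrak g$ and a smooth exponential map. Let $\gamma:\mathbb R\to \mathrm{Aut}(G)$, $t\mapsto\gamma_t$, be a one-parameter group (group homomorphism) defining a continuous action of $\mathbb R$ on $G$, and let $\alpha:\mathbb R\to \mathrm{Aut}(\mathfrak g_{\mathbb C})$ be defined by $\alpha_t:=\mathbf L(\gamma_t)_{\mathbb C}$. Let $\pi^\#: G\rtimes_\gamma\mathbb R\to \mathrm U(\mathcal H)$, $(g,t)\mapsto \pi(g)U_t$, be a continuous unitary representation, and let $\mathcal H^\infty$ be the space of smooth vectors with respect to $\pi$. For $f\in L^1(\mathbb R)$ let $U_f=\int_{\mathbb R} f(t)U_t\,dt\in B(\mathcal H)$. Assume that at least one of the following conditions holds: (a) $\alpha$ is equicontinuous and $f\in L^1(\mathbb R)$; or (b) $\alpha$ is polynomially bounded and $f\in\mathcal S(\mathbb R)$. Then $U_f\mathcal H^\infty\subseteq\mathcal H^\infty$ and $$\mathrm d\pi(y_1)\cdots \mathrm d\pi(y_n)U_fv=\int_{\mathbb R} f(t)\,U_t\,\mathrm d\pi(\alpha_{-t}(y_1))\cdots \mathrm d\pi(\alpha_{-t}(y_n))v\,dt$$ for all $n\in\mathbb N$, $y_1,\ldots,y_n\in\mathfrak g_{\mathbb C}$ and $v\in\mathcal H^\infty$.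
   Context: Smoothness is in the sense of calculus in (Hausdorff, real) locally convex spaces: a map is $C^1$ if its directional derivatives exist and define a continuous map $\mathrm d f(x)(h)$ of $(x,h)$; $C^k$ and $C^\infty$ are defined iteratively. Lie groups may be infinite dimensional, modelled on locally convex spaces. The exponential map is written $e^x:=\exp_G(x)$, $x\in\mathfrak g$. $\mathrm{Aut}(G)$ is the group of smooth automorphisms of $G$; $\mathbf L(\gamma_t)$ is the induced automorphism of $\mathfrak g$ (derivative at the identity) and $\mathbf L(\gamma_t)_{\mathbb C}$ its complex linear extension to the complexification $\mathfrak g_{\mathbb C}$. $\mathrm{Aut}(\mathfrak g_{\mathbb C})$ is the group of continuous automorphisms. That $\gamma$ defines a continuous action of $\mathbb R$ on $G$ means that $\mathbb R\times G\to G$, $(t,g)\mapsto\gamma_t(g)$, is continuous; then $G\rtimes_\gamma\mathbb R$ is a topological group with product $(g,t)(g',t')=(g\gamma_t(g'),t+t')$. Continuous unitary representations are strongly continuous homomorphisms into the unitary group $\mathrm U(\mathcal H)$ of a complex Hilbert space $\mathcal H$. Here $\pi$ is a continuous unitary representation of $G$ and $(U_t)_{t\in\mathbb R}$ is a strongly continuous unitary one-parameter group with $U_t\pi(g)U_t^*=\pi(\gamma_t(g))$. A vector $v\in\mathcal H$ is smooth (for $\pi$) if $G\to\mathcal H$, $g\mapsto\pi(g)v$, is smooth; $\mathcal H^\infty$ is the space of smooth vectors. For $x\in\mathfrak g$, $v\in\mathcal H^\infty$, $\mathrm d\pi(x)v:=\frac{d}{dt}\big|_{t=0}\pi(e^{tx})v$;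 by complex linear extension this defines a representation $\mathrm d\pi:\mathfrak g_{\mathbb C}\to\mathrm{End}(\mathcal H^\infty)$. For a locally convex space $E$, a homomorphism $\alpha:\mathbb R\to \mathrm{GL}(E)$ (continuous linear automorphisms) is called equicontinuous if $\{\alpha_t:t\in\mathbb R\}$ is equicontinuous, i.e. for every continuous seminorm $p$ on $E$ there is a continuous seminorm $q$ on $E$ with $p(\alpha_t x)\le q(x)$ for all $t\in\mathbb R,x\in E$. It is called polynomially bounded if for every continuous seminorm $p$ on $E$ there is $N\in\mathbb N_0$ such that $\{(1+|t|^N)^{-1}\alpha_t:t\in\mathbb R\}$ is equicontinuous as a set of linear maps from $E$ to $(E,p)$ ($E$ with the topology defined by the single seminorm $p$), i.e. there is a continuous seminorm $q$ on $E$ with $p(\alpha_tx)\le(1+|t|^N)q(x)$ for all $t,x$. $\mathcal S(\mathbb R)$ is the space of complex-valued Schwartz functions. The $\mathcal H$-valued integrals are understood in the weak sense, i.e. after pairing with arbitrary $w\in\mathcal H$. *)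

(* Defs.v *)
From HB Require Import structures.
From mathcomp Require Import all_boot all_order all_algebra.
From mathcomp Require Import sesquilinear complex.
From mathcomp Require Import all_classical all_reals all_analysis.

Set Implicit Arguments.
Unset Strict Implicit.
Unset Printing Implicit Defensive.
Import Order.TTheory GRing.Theory Num.Theory.
Import numFieldNormedType.Exports.
Local Open Scope classical_set_scope.
Local Open Scope ring_scope.
Local Open Scope complex_scope.
Local Open Scope convex_scope.
Local Open Scope ring_scope.

Lemma normc_real (R : realType) (r : R) : `|r%:C| = (`|r|)%:C :> R[i].
Proof. by rewrite normc_def /= expr0n /= addr0 sqrtr_sqr. Qed.

Lemma real_complex_continuous (R : realType) :
  continuous (fun r : R^o => r%:C : R[i]^o).
Proof.
move=> x; apply/cvgrPdist_lt => e e0.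
have er : e = (complex.Re e)%:C by rewrite RRe_real // gtr0_real.
have Re0 : 0 < complex.Re e by rewrite er ltcR in e0.
near=> y; rewrite -raddfB /= normc_real er ltcR.
by near: y; apply: cvgr_dist_lt.
Unshelve. all: by end_near. Qed.

Lemma convex_setP (K : numFieldType) (E : lmodType K) (A : set E) :
  convex_set A <-> forall u v (a b : K), 0 <= a -> 0 <= b -> a + b = 1 ->
    A u -> A v -> A (a *: u + b *: v).
Proof.
split=> cA u v.
  move=> a b a0 b0 ab /mem_set Au /mem_set Av.
  have a1 : a <= 1 by rewrite -ab lerDl.
  have -> : b = 1 - a by rewrite -ab (addrC a) addrK.
  by apply/set_mem; exact: (cA u v (Itv01 a0 a1)).
move=> l /set_mem Au /set_mem Av; apply/mem_set.
by apply: cA => //; [rewrite subr_ge0|exact: subrKC].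
Qed.

(* A complex normed space seen as a real locally convex space. *)
Definition realify (R : realType) (H : normedModType R[i]) : Type := H.

Section realify.
Context (R : realType) (H : normedModType R[i]).
HB.instance Definition _ := TopologicalZmodule.copy (realify H) H.
HB.instance Definition _ := Uniform.copy (realify H) H.

Let scale (r : R) (v : realify H) : realify H := r%:C *: (v : H).
Let scaleA a b v : scale a (scale b v) = scale (a * b) v.
Proof. by rewrite /scale scalerA rmorphM. Qed.
Let scale1 : left_id 1 scale.
Proof. by move=> v; rewrite /scale rmorph1 scale1r. Qed.
Let scaleDr : right_distributive scale +%R.
Proof. by move=> a u v; rewrite /scale scalerDr. Qed.
Let scaleDl v : {morph scale^~ v : a b / a + b}.
Proof. by move=> a b; rewrite /scale rmorphD scalerDl. Qed.
HB.instance Definition _ := GRing.Zmodule_isLmodule.Build R (realify H)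
  scaleA scale1 scaleDr scaleDl.

Let scale_cont : continuous (fun z : R^o * realify H => z.1 *: z.2).
Proof.
move=> z.
have c1 : (fun z : R^o * realify H => z.1%:C : R[i]^o) @ z --> (z.1%:C : R[i]^o).
  apply: (@continuous_comp (R^o * realify H)%type R^o R[i]^o fst); first exact: cvg_fst.
  exact: real_complex_continuous.
have c2 : (fun z : R^o * realify H => z.2 : H) @ z --> (z.2 : H) by exact: cvg_snd.
exact: (@cvgZ R[i] H _ (nbhs z) _ (fun z : R^o * realify H => z.1%:C)
  (fun z : R^o * realify H => z.2 : H) _ _ c1 c2).
Qed.
HB.instance Definition _ :=
  TopologicalZmodule_isTopologicalLmodule.Build R (realify H) scale_cont.

Let lconvex : exists2 B : set_system (realify H),
  (forall b, b \in B -> convex_set b) & basis B.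
Proof.
exists [set B | exists x r, B = ball (x : H) r].
  move=> B /[!inE] -[x] [r] ->; apply/(convex_setP (E := realify H)) => u v a b.
  move=> a0 b0 ab; rewrite -!ball_normE /= => xu xv.
  rewrite [X in `|X|](_ : _ = a%:C *: (x - (u : H)) + b%:C *: (x - (v : H))); last first.
    by rewrite !scalerBr addrACA -scalerDl -rmorphD /= ab scale1r opprD.
  rewrite (le_lt_trans (ler_normD _ _))// !normrZ !normc_real !ger0_norm//.
  rewrite -[ltRHS]mul1r -(rmorph1 (real_complex R)) -ab rmorphD mulrDl.
  have [a_eq0|an0] := eqVneq a 0.
    have -> : b = 1 by rewrite -ab a_eq0 add0r.
    by rewrite a_eq0 rmorph0 !mul0r !add0r rmorph1 !mul1r.
  by rewrite ltr_leD // ?ltr_pM2l ?ltcR ?lt0r ?an0 // ler_wpM2l ?lecR // ltW.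
split; first by move=> B [x] [r] ->; exact: (@ball_open _ H).
move=> x B; rewrite -(@nbhs_ballE _ H) => -[r] r0 Bxr /=.
by exists (ball (x : H) r) => //=; split; [exists x, r|exact: ballxx].
Qed.
HB.instance Definition _ := Uniform_isTvs.Build R (realify H) lconvex.
End realify.

(* The pair (x, y) stands for x + i y. *)
Definition complexification (R : realType) (E : tvsType R) : Type := (E * E)%type.

Section complexification.
Context (R : realType) (E : tvsType R).
Notation EC := (complexification E).
HB.instance Definition _ := TopologicalZmodule.copy EC (E * E)%type.
HB.instance Definition _ := Uniform.copy EC (E * E)%type.

Let scale (c : R[i]) (z : EC) : EC :=
  (complex.Re c *: z.1 - complex.Im c *: z.2,
   complex.Re c *: z.2 + complex.Im c *: z.1).
Let scaleA a b z : scale a (scale b z) = scale (a * b) z.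
Proof.
case: a b => [a a'] [b b']; rewrite /scale /=.
rewrite !scalerDr !scalerN !scalerDl !scaleNr !scalerA.
congr pair; first rewrite !opprD; rewrite -!addrA; congr (_ + _);
  by rewrite addrA addrC.
Qed.
Let scale1 : left_id 1 scale.
Proof. by case=> x y; rewrite /scale /= !scale1r !scale0r subr0 addr0. Qed.
Let scaleDr : right_distributive scale +%R.
Proof.
move=> a [x y] [x' y']; rewrite /scale /=; congr pair => /=;
  by rewrite !scalerDr ?opprD addrACA.
Qed.
Let scaleDl z : {morph scale^~ z : a b / a + b}.
Proof.
move=> [a a'] [b b']; rewrite /scale /=; congr pair => /=;
  by rewrite !scalerDl ?opprD addrACA.
Qed.
HB.instance Definition _ := GRing.Zmodule_isLmodule.Build R[i] EC
  scaleA scale1 scaleDr scaleDl.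

Let Re_continuous : continuous (fun c : R[i]^o => complex.Re c : R^o).
Proof.
move=> x; apply/(@cvgrPdist_lt R R^o _ (nbhs (x : R[i]^o)) _
  (fun c => complex.Re c : R^o)) => e e0; near=> y.
rewrite -raddfB /= -ltcR; apply: (le_lt_trans (normc_ge_Re _)).
near: y; apply: (@cvgr_dist_lt R[i] R[i]^o _ (nbhs x) _ id x cvg_id).
by rewrite ltcR.
Unshelve. all: by end_near. Qed.

Let Im_continuous : continuous (fun c : R[i]^o => complex.Im c : R^o).
Proof.
move=> x; apply/(@cvgrPdist_lt R R^o _ (nbhs (x : R[i]^o)) _
  (fun c => complex.Im c : R^o)) => e e0; near=> y.
rewrite -raddfB /= -ltcR; apply: (@le_lt_trans _ _ `|x - y : R[i]|).
  by rewrite normc_def lecR -sqrtr_sqr ler_wsqrtr // lerDr sqr_ge0.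
near: y; apply: (@cvgr_dist_lt R[i] R[i]^o _ (nbhs x) _ id x cvg_id).
by rewrite ltcR.
Unshelve. all: by end_near. Qed.

Let cvgsc (T : Type) (F : set_system T) {FF : Filter F} (a : T -> R^o) (u : T -> E)
    (a0 : R^o) (u0 : E) : a @ F --> a0 -> u @ F --> u0 ->
  (fun t => a t *: u t) @ F --> a0 *: u0.
Proof.
move=> ha hu; apply: (@cvg_comp _ _ _ (fun t => (a t, u t)) (fun z : R^o * E => z.1 *: z.2)
  F (nbhs (a0, u0)) _ (cvg_pair ha hu)).
exact: (@scale_continuous R E (a0, u0)).
Qed.

Let cvgad (T : Type) (F : set_system T) {FF : Filter F} (u v : T -> E) (u0 v0 : E) :
  u @ F --> u0 -> v @ F --> v0 -> (fun t => u t + v t) @ F --> u0 + v0.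
Proof.
move=> hu hv; apply: (@cvg_comp _ _ _ (fun t => (u t, v t)) (fun z : E * E => z.1 + z.2)
  F (nbhs (u0, v0)) _ (cvg_pair hu hv)).
exact: (@add_continuous E (u0, v0)).
Qed.

Let scale_cont : continuous (fun z : R[i]^o * EC => z.1 *: z.2).
Proof.
move=> z.
have cRe : (fun z : R[i]^o * EC => complex.Re z.1 : R^o) @ z --> (complex.Re z.1 : R^o).
  by apply: (@continuous_comp _ R[i]^o R^o fst); [exact: cvg_fst|exact: Re_continuous].
have cIm : (fun z : R[i]^o * EC => complex.Im z.1 : R^o) @ z --> (complex.Im z.1 : R^o).
  by apply: (@continuous_comp _ R[i]^o R^o fst); [exact: cvg_fst|exact: Im_continuous].
have c2 : (fun z : R[i]^o * EC => z.2 : E * E) @ z --> (z.2 : E * E) by exact: cvg_snd.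
have c21 : (fun z : R[i]^o * EC => z.2.1 : E) @ z --> (z.2.1 : E).
  by apply: (@cvg_comp _ _ _ _ (fun w : E * E => w.1) _ _ _ c2); exact: cvg_fst.
have c22 : (fun z : R[i]^o * EC => z.2.2 : E) @ z --> (z.2.2 : E).
  by apply: (@cvg_comp _ _ _ _ (fun w : E * E => w.2) _ _ _ c2); exact: cvg_snd.
have cImN : (fun z : R[i]^o * EC => - (complex.Im z.1 *: z.2.2) : E) @ z
    --> (- (complex.Im z.1 *: z.2.2) : E).
  apply: (@cvg_comp _ _ _ _ (fun w : E => - w) _ _ _ (cvgsc cIm c22)).
  exact: opp_continuous.
exact: (cvg_pair (cvgad (cvgsc cRe c21) cImN) (cvgad (cvgsc cRe c22) (cvgsc cIm c21))).
Qed.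
HB.instance Definition _ :=
  TopologicalZmodule_isTopologicalLmodule.Build R[i] EC scale_cont.

Let lconvex : exists2 B : set_system EC,
  (forall b, b \in B -> convex_set b) & basis B.
Proof.
have [B cB bB] := @locally_convex R (E * E)%type.
exists B => // A /cB /(convex_setP (E := (E * E)%type)) cA.
apply/(convex_setP (E := EC)) => u v a b a0 b0 ab Au Av.
have aE : a = (complex.Re a)%:C by rewrite RRe_real // ger0_real.
have bE : b = (complex.Re b)%:C by rewrite RRe_real // ger0_real.
move: a0 b0 ab; rewrite aE bE !lecR -rmorphD /= => a0 b0 /complexI ab.
suff -> : (complex.Re a)%:C *: u + (complex.Re b)%:C *: v =
  complex.Re a *: (u : E * E) + complex.Re b *: (v : E * E) by exact: cA.
by congr pair; rewrite /= !scale0r ?subr0 ?addr0.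
Qed.
HB.instance Definition _ := Uniform_isTvs.Build R[i] EC lconvex.
End complexification.

Section calculus.
Context (R : realType).

Definition dquot (E F : tvsType R) (f : E -> F) (x h : E) (t : R) : F :=
  t^-1 *: (f (x + t *: h) - f x).

(* Directional derivative; 0 when the limit does not exist. *)
Definition ddiff (E F : tvsType R) (f : E -> F) (x h : E) : F :=
  xget 0 [set l | dquot f x h t @[t --> 0^'] --> l].

(* f is C^(k+1) on the open set U when it is C^1 and its differential
   (x, h) |-> df(x)(h) is C^k on U x E. *)
Fixpoint Ck (F : tvsType R) (k : nat) (E : tvsType R) (U : set E) (f : E -> F)
    {struct k} : Prop :=
  match k with
  | 0 => forall x, U x -> {for x, continuous f}
  | k'.+1 => [/\ forall x, U x -> {for x, continuous f},
      forall x h, U x -> exists l : F, dquot f x h t @[t --> 0^'] --> l &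
      Ck k' [set xh : E * E | U xh.1] (fun xh => ddiff f xh.1 xh.2)]
  end.

Definition smooth_on (E F : tvsType R) (U : set E) (f : E -> F) : Prop :=
  forall k, Ck k U f.

End calculus.

(* The map [cfun] is only meaningful on [cdom], and [cinv] on [cfun @` cdom]. *)
Record chart (R : realType) (M : topologicalType) (E : tvsType R) := Chart {
  cdom : set M ;
  cfun : M -> E ;
  cinv : E -> M }.

Section charts.
Context (R : realType).

Definition is_chart (M : topologicalType) (E : tvsType R) (c : chart M E) :=
  [/\ open (cdom c), open (cfun c @` cdom c),
      forall x, cdom c x -> cinv c (cfun c x) = x,
      forall x, cdom c x -> {for x, continuous (cfun c)} &
      forall y, (cfun c @` cdom c) y -> {for y, continuous (cinv c)}].

Definition id_chart (E : tvsType R) : chart E E := Chart setT id id.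

Definition prod_chart (M N : topologicalType) (E F : tvsType R)
    (c : chart M E) (d : chart N F) : chart (M * N)%type (E * F)%type :=
  Chart (cdom c `*` cdom d)
    (fun p => (cfun c p.1, cfun d p.2))
    (fun q => (cinv c q.1, cinv d q.2)).

Definition prod_atlas (M N : topologicalType) (E F : tvsType R)
    (A : set (chart M E)) (B : set (chart N F)) :
    set (chart (M * N)%type (E * F)%type) :=
  [set e | exists c d, [/\ A c, B d & e = prod_chart c d]].

Definition smooth_map (M N : topologicalType) (E F : tvsType R)
    (A : set (chart M E)) (B : set (chart N F)) (f : M -> N) : Prop :=
  continuous f /\
  forall c d, A c -> B d ->
    smooth_on (cfun c @` (cdom c `&` f @^-1` cdom d))
      (cfun d \o f \o cinv c).

End charts.

HB.mixin Record isManifold (R : realType) (E : tvsType R) M of Topological M := {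
  manifold_hausdorff : hausdorff_space M ;
  atlas : set (chart M E) ;
  atlas_chart : forall c, atlas c -> is_chart c ;
  atlas_cover : forall x, exists2 c, atlas c & cdom c x ;
  atlas_compat : forall c d, atlas c -> atlas d ->
    smooth_on (cfun c @` (cdom c `&` cdom d)) (cfun d \o cinv c)
}.

#[short(type="manifoldType")]
HB.structure Definition Manifold (R : realType) (E : tvsType R) :=
  {M of Topological M & isManifold R E M}.

(* The Lie algebra of G, i.e. its tangent space at 1, is identified with the
   model space E through the differential at 1 of the (arbitrary) chart
   [chart1] around 1. *)
HB.mixin Record isLieGroup (R : realType) (E : tvsType R) G
    of Manifold R E G & Group G := {
  mulg_smooth : smooth_map (prod_atlas (@atlas R E G) (@atlas R E G)) (@atlas R E G)
    (fun p : G * G => (p.1 * p.2)%g) ;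
  invg_smooth : smooth_map (@atlas R E G) (@atlas R E G) (fun x : G => x^-1%g) ;
  chart1 : chart G E ;
  chart1_atlas : (@atlas R E G) chart1 ;
  chart1_dom : cdom chart1 1%g
}.

#[short(type="lieGroupType")]
HB.structure Definition LieGroup (R : realType) (E : tvsType R) :=
  {G of Manifold R E G & Group G & isLieGroup R E G}.

Section lie_groups.
Context (R : realType) (E : tvsType R) (G : lieGroupType E).
Notation atlasG := (@atlas R E G).
Notation chart1G := (@chart1 R E G).

Definition lie_aut (phi : G -> G) : Prop :=
  [/\ {morph phi : x y / (x * y)%g}, smooth_map atlasG atlasG phi &
      exists psi, [/\ cancel phi psi, cancel psi phi & smooth_map atlasG atlasG psi]].

Definition lieL (phi : G -> G) (x : E) : E :=
  ddiff (cfun chart1G \o phi \o cinv chart1G) (cfun chart1G 1%g) x.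

(* Smoothness of e, together with: t |-> e (t x) is the one-parameter group
   with velocity x at 0, for every x in the Lie algebra. *)
Definition smooth_exp_map (e : E -> G) : Prop :=
  [/\ smooth_map [set id_chart E] atlasG e,
      forall x (s t : R), e ((s + t) *: x) = (e (s *: x) * e (t *: x))%g &
      forall x, dquot (fun t : R^o => cfun chart1G (e (t *: x))) 0 1 t @[t --> 0^'] --> x].

(* Product of the semidirect product of G and R along gamma. *)
Definition sdmul (gamma : R -> G -> G) (a b : G * R) : G * R :=
  ((a.1 * gamma a.2 b.1)%g, a.2 + b.2).

Definition lieLC (phi : G -> G) (z : complexification E) : complexification E :=
  (lieL phi z.1, lieL phi z.2).

End lie_groups.

Section one_parameter_groups.
Context (R : realType) (V : tvsType R[i]).

Definition cont_seminorm (p : V -> R) : Prop :=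
  [/\ continuous p, forall x, 0 <= p x, forall x y, p (x + y) <= p x + p y &
      forall (c : R[i]) x, (p (c *: x))%:C = `|c| * (p x)%:C].

Definition equicontinuous_group (alpha : R -> V -> V) : Prop :=
  forall p, cont_seminorm p -> exists2 q, cont_seminorm q &
    forall t x, p (alpha t x) <= q x.

Definition poly_bounded (alpha : R -> V -> V) : Prop :=
  forall p, cont_seminorm p -> exists N : nat, exists2 q, cont_seminorm q &
    forall t x, p (alpha t x) <= (1 + `|t| ^+ N) * q x.

End one_parameter_groups.

Section scalar_functions.
Context (R : realType).
Notation mu := (@lebesgue_measure R).

(* Integrable functions are taken with Borel measurable representatives. *)
Definition c_integrable (g : R -> R[i]) : Prop :=
  mu.-integrable setT (fun t => (complex.Re (g t))%:E) /\
  mu.-integrable setT (fun t => (complex.Im (g t))%:E).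

Definition c_integral (g : R -> R[i]) : R[i] :=
  (\int[mu]_(t in setT) complex.Re (g t)) +i*
  (\int[mu]_(t in setT) complex.Im (g t)).

Definition c_derive (k : nat) (f : R -> R[i]) (t : R) : R[i] :=
  derive1n k (fun s => complex.Re (f s)) t +i*
  derive1n k (fun s => complex.Im (f s)) t.

Definition schwartz (f : R -> R[i]) : Prop :=
  (forall k t, derivable (derive1n k (fun s => complex.Re (f s))) t 1 /\
               derivable (derive1n k (fun s => complex.Im (f s))) t 1) /\
  forall m k : nat, exists C : R, forall t : R,
    (`|t| ^+ m)%:C * `|c_derive k f t| <= C%:C.

End scalar_functions.

Section hilbert.
Context (R : realType) (H : completeNormedModType R[i]) (ip : {dot H for Num.conj}).

Definition unitary_op (u : H -> H) : Prop :=
  [/\ linear u, forall w, exists v, u v = w & forall v w, ip (u v) (u w) = ip v w].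

Definition cont_unitary_rep (T : topologicalType) (mul : T -> T -> T)
    (rho : T -> H -> H) : Prop :=
  [/\ forall a, unitary_op (rho a),
      forall a b v, rho (mul a b) v = rho a (rho b v) &
      forall v, continuous (fun a => rho a v)].

Definition is_weak_integral (F : R -> H) (u : H) : Prop :=
  forall w, c_integrable (fun t => ip (F t) w) /\
            ip u w = c_integral (fun t => ip (F t) w).

(* The weak integral is unique; 0 when it does not exist. *)
Definition weak_integral (F : R -> H) : H := xget 0 (is_weak_integral F).

Definition U_int (U : R -> H -> H) (f : R -> R[i]) (v : H) : H :=
  weak_integral (fun t => f t *: U t v).

End hilbert.

Section smooth_vectors.
Context (R : realType) (E : tvsType R) (G : lieGroupType E).
Context (H : completeNormedModType R[i]).
Context (e : E -> G) (pi : G -> H -> H).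

Definition smooth_vector (v : H) : Prop :=
  smooth_map (@atlas R E G) [set id_chart (realify H)]
    (fun g => pi g v : realify H).

(* Only meaningful on smooth vectors, as are dpi and dpi_seq. *)
Definition dpi_real (x : E) (v : H) : H :=
  ddiff (fun t : R^o => pi (e (t *: x)) v : realify H) 0 1.

Definition dpi (y : complexification E) (v : H) : H :=
  dpi_real y.1 v + 'i *: dpi_real y.2 v.

Definition dpi_seq (ys : seq (complexification E)) (v : H) : H :=
  foldr dpi v ys.

End smooth_vectors.

(* Main.v *)
Require Import Defs.
From HB Require Import structures.
From mathcomp Require Import all_boot all_order all_algebra.
From mathcomp Require Import sesquilinear complex.
From mathcomp Require Import all_classical all_reals all_analysis.
From mathcomp Require Import measurable_realfun ring lra.

Set Implicit Arguments.
Unset Strict Implicit.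
Unset Printing Implicit Defensive.
Import Order.TTheory GRing.Theory Num.Theory.
Import numFieldNormedType.Exports.
Local Open Scope classical_set_scope.
Local Open Scope ring_scope.

(** For a smooth vector v the vectors U_t v are smooth, with
    dpi(y) U_t v = U_t dpi(alpha_{-t} y) v by the chain rule at 1, so the integrand
    is f(t) dpi(y_1)...dpi(y_n) U_t v.  The map (y_1, .., y_n) |-> dpi(y_1)...dpi(y_n) v
    is continuous and multilinear, hence bounded by a product of seminorms, and the
    growth of alpha together with the decay of f turns this into an integrable bound
    C(t) q(y_1)...q(y_n); by the Riesz representation theorem the weak integrals
    J(y_1, .., y_n) exist and define continuous multilinear maps.  If psi is a smooth
    map into G with left logarithmic derivative kappa, then differentiation under the
    integral sign shows that pi(psi) J(y_1, .., y_n) has weak derivative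
    pi(psi) J(kappa, y_1, .., y_n); this being norm continuous, it is a strong
    derivative.  Taking psi(s) = exp(s x) gives dpi(x) J(y_1, .., y_n) = J(x, y_1, .., y_n),
    hence the formula, and iterating the derivative of
    pi(psi) J(theta_1, .., theta_n) shows that U_f v = J() is smooth. *)

(** * Calculus in locally convex spaces *)

(** In infinite dimensions the exponential map need not be locally surjective, so derivatives along
    the curves exp(s x) do not show that an orbit map is smooth. Derivatives are therefore taken
    along arbitrary smooth maps psi into G, and the direction that enters is the logarithmic
    derivative of psi, which is again smooth. Since gamma is merely continuous, t serves only as an
    integration variable and is never differentiated. All arities n have to be treated together,
    because differentiating pi(psi) J(y_1, .., y_n) produces J with n + 1 arguments. In case (b) the
    n operators cost a factor (1 + |t|^N)^n with n unbounded, which rapid decay of f outweighs; in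
    case (a) the cost is bounded in t and integrability of f is enough. The continuity of (y_1, ..,
    y_n) |-> dpi(y_1)...dpi(y_n) v comes from viewing dpi(x) w(p) as the partial derivative at s = 0
    of a smooth map of (x, p, s): smooth families of vectors stay smooth families, local boundedness
    at 0 follows, and homogeneity turns it into a seminorm bound. *)

Section tvs_limits.
Context (R : realType).

Lemma tvs_cvgD (E : tvsType R) (T : Type) (F : set_system T) {FF : Filter F}
    (u v : T -> E) (a b : E) :
  u @ F --> a -> v @ F --> b -> (fun t => u t + v t) @ F --> a + b.
Proof.
move=> hu hv; apply: (@cvg_comp _ _ _ (fun t => (u t, v t))
  (fun z : E * E => z.1 + z.2) F (nbhs (a, b)) _ (cvg_pair hu hv)).
exact: (@add_continuous E (a, b)).
Qed.

Lemma tvs_cvgZ (E : tvsType R) (T : Type) (F : set_system T) {FF : Filter F}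
    (a : T -> R) (u : T -> E) (a0 : R) (u0 : E) :
  a @ F --> a0 -> u @ F --> u0 -> (fun t => a t *: u t) @ F --> a0 *: u0.
Proof.
move=> ha hu; apply: (@cvg_comp _ _ _ (fun t => (a t, u t) : R^o * E)
  (fun z : R^o * E => z.1 *: z.2) F (nbhs ((a0 : R^o), u0)) _ (cvg_pair ha hu)).
exact: (@scale_continuous R E (a0, u0)).
Qed.

Lemma tvs_line (E : tvsType R) (x h : E) :
  x + t *: h @[t --> (0 : R)^'] --> x.
Proof.
rewrite -{2}[x]addr0 -(scale0r h); apply: tvs_cvgD; first exact: cvg_cst.
apply: tvs_cvgZ; last exact: cvg_cst.
by apply: cvg_within_filter; exact: cvg_id.
Qed.

Lemma tvs_convex_nbhs (E : tvsType R) (x : E) (A : set E) : nbhs x A ->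
  exists W, [/\ open W, convex_set W, W x & W `<=` A].
Proof.
have [B cB [oB bB]] := @locally_convex R E.
move=> /bB[W /= [BW Wx] WA]; exists W; split => //; first exact: oB.
by apply: cB; rewrite inE.
Qed.

End tvs_limits.

Section mean_value.
Context (R : realType) (E : tvsType R).

(** The slope over [0, b] is the mean of those over [0, a] and [a, b], weighted by the lengths of
    the two intervals. *)
Lemma slope_convex (W : set E) (c : R -> E) (a b : R) : convex_set W ->
  0 < a -> a < b -> W (a^-1 *: (c a - c 0)) ->
  W ((b - a)^-1 *: (c b - c a)) -> W (b^-1 *: (c b - c 0)).
Proof.
move=> /convex_setP cW a0 ab Wa Wb.
have b0 : 0 < b by exact: lt_trans ab.
have ba0 : 0 < b - a by rewrite subr_gt0.
rewrite [X in W X](_ : _ = (a / b) *: (a^-1 *: (c a - c 0)) +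
   ((b - a) / b) *: ((b - a)^-1 *: (c b - c a))); last first.
  rewrite !scalerA ![_ / b]mulrC !mulfK ?gt_eqF//.
  by rewrite -scalerDr [in RHS]addrC addrA subrK.
apply: cW => //; [exact/ltW/divr_gt0|exact/ltW/divr_gt0|].
by rewrite -mulrDl addrC subrK divff ?gt_eqF.
Qed.

(* Slopes over adjacent intervals that lie in the convex set W combine to a slope
   in W, so the supremum of the s with slope over [0, s] in W is 1. *)
Lemma mean_value (W : set E) (c c' : R -> E) : open W -> convex_set W ->
  (forall s, 0 <= s <= 1 -> r^-1 *: (c (s + r) - c s) @[r --> 0^'] --> c' s) ->
  (forall s, 0 <= s <= 1 -> W (c' s)) -> W (c 1 - c 0).
Proof.
move=> oW cW dc Wc'.
have loc s : 0 <= s <= 1 -> exists2 d : R, 0 < d &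
    forall r, r != 0 -> `|r| < d -> W (r^-1 *: (c (s + r) - c s)).
  move=> s01; have := dc _ s01 W (open_nbhs_nbhs (conj oW (Wc' _ s01))).
  rewrite nbhs_filterE /fmap /=.
  rewrite /dnbhs /within /= -nbhs_ballE /= => -[d /= d0 dW].
  exists d => // r r0 rd; apply: dW => //=.
  by rewrite -ball_normE /= sub0r normrN.
pose A := [set s : R | 0 < s <= 1 /\ W (s^-1 *: (c s - c 0))].
have [d0 d0_gt0 hd0] := loc 0 (introT andP (conj (lexx 0) ler01)).
pose s0 := Num.min (d0 / 2) 1.
have s0_gt0 : 0 < s0 by rewrite lt_min ltr01 divr_gt0.
have As0 : A s0.
  split; first by rewrite s0_gt0 ge_min lexx orbT.
  have := hd0 s0; rewrite add0r; apply; first by rewrite gt_eqF.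
  by rewrite gtr0_norm// gt_min; apply/orP; left; lra.
have hsA : has_sup A.
  by split; [exists s0|exists 1 => s [/andP[]]].
have As1 : sup A <= 1 by apply: ge_sup => [|s [/andP[]]]; first by exists s0.
have s_gt0 : 0 < sup A by apply: lt_le_trans s0_gt0 _; apply: ub_le_sup => //; case: hsA.
have [d d_gt0 hd] := loc (sup A) (introT andP (conj (ltW s_gt0) As1)).
have AsA : A (sup A).
  have [a Aa sda] := sup_adherent d_gt0 hsA.
  have ale : a <= sup A by apply: ub_le_sup => //; case: hsA.
  move: ale; rewrite le_eqVlt => /orP[/eqP <- //|alt].
  case: Aa => /andP[a0 a1] Wa.
  split; first by rewrite s_gt0.
  apply: (slope_convex cW a0 alt Wa).
  (* The derivative at [sup A] is two-sided: the negative step [a - sup A] gives the slope over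
     [a, sup A]. So the supremum is attained. *)
  have := hd (a - sup A); rewrite subrKC => H.
  rewrite -[sup A - a]opprB invrN -[c (sup A) - _]opprB scalerN scaleNr opprK.
  apply: H; first by rewrite subr_eq0 lt_eqF.
  by rewrite ltr0_norm ?subr_lt0//; lra.
move: As1; rewrite le_eqVlt => /orP[/eqP s1|s_lt1].
  by move: AsA; rewrite s1 => -[_]; rewrite invr1 scale1r.
(* If [sup A < 1], a positive step from [sup A] contradicts maximality. *)
pose r := Num.min (d / 2) (1 - sup A).
have r_gt0 : 0 < r by rewrite lt_min divr_gt0//= subr_gt0.
suff : A (sup A + r).
  move=> /(ub_le_sup (proj2 hsA)) /=; lra.
split; first by rewrite addr_gt0//= -lerBrDl ge_min lexx orbT.
case: AsA => _ Ws; apply: (slope_convex cW s_gt0 _ Ws); first by rewrite ltrDl.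
rewrite [_ - sup A]addrC addKr; apply: hd; first by rewrite gt_eqF.
by rewrite gtr0_norm// gt_min; apply/orP; left; lra.
Qed.

End mean_value.

Section differential.
Context (R : realType).

Lemma ddiff_cvg (E F : tvsType R) (f : E -> F) (x h : E) :
  (exists l : F, dquot f x h t @[t --> 0^'] --> l) ->
  dquot f x h t @[t --> 0^'] --> ddiff f x h.
Proof. by move=> [l hl]; rewrite /ddiff; case: xgetP => [y -> //|/(_ l)/(_ hl)]. Qed.

Lemma ddiff_eq (E F : tvsType R) (hF : hausdorff_space F) (f : E -> F)
    (x h : E) (l : F) : dquot f x h t @[t --> 0^'] --> l -> ddiff f x h = l.
Proof.
by move=> hl; apply: (cvg_unique hF _ hl); apply: ddiff_cvg; exists l.
Qed.

Lemma cvg_mulr_dnbhs0 (a : R) : a != 0 -> r * a @[r --> 0^'] --> (0 : R)^'.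
Proof.
move=> a0 A; rewrite /dnbhs /within /= -!nbhs_ballE /= => -[d /= d0 dA].
exists (d / `|a|) => /=; first by rewrite divr_gt0 // normr_gt0.
move=> r /=; rewrite -ball_normE /= sub0r normrN => rd r0.
apply: dA; last by rewrite mulf_neq0.
by rewrite -ball_normE /= sub0r normrN normrM -ltr_pdivlMr // normr_gt0.
Qed.

(* A C^1 map is strictly differentiable: base point and direction may move. *)
Lemma dquot_cvg (E F : tvsType R) (U : set E) (f : E -> F) (x0 h0 : E)
    (T : Type) (G : set_system T) {FG : Filter G} (x h : T -> E) (tau : T -> R) :
  open U -> Ck 1 U f -> U x0 -> x @ G --> x0 -> h @ G --> h0 ->
  tau @ G --> (0 : R) -> (\forall t \near G, tau t != 0) ->
  (fun t => dquot f (x t) (h t) (tau t)) @ G --> ddiff f x0 h0.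
Proof.
move=> oU [_ dU cd] Ux0 hx hh ht tn0 N /tvs_convex_nbhs[W [oW cW Wl WN]].
have /= := cd (x0, h0) Ux0 W (open_nbhs_nbhs (conj oW Wl)).
move=> [[A B] /= [nA nB] AB].
have nAU : nbhs (x0 + (0 : R) *: h0) (A `&` U).
  by rewrite scale0r addr0; apply: filterI => //; apply: open_nbhs_nbhs.
have H : (fun z : (E * E) * R^o => z.1.1 + z.2 *: z.1.2) @ ((x0, h0), (0 : R^o))
    --> x0 + (0 : R) *: h0.
  apply: tvs_cvgD; first by exact: (@cvg_comp _ _ _ (@fst (E * E) R^o) (@fst E E)
    (nbhs ((x0, h0), (0 : R^o))) (nbhs (x0, h0)) (nbhs x0) cvg_fst cvg_fst).
  apply: tvs_cvgZ; first exact: cvg_snd.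
  exact: (@cvg_comp _ _ _ (@fst (E * E) R^o) (@snd E E)
    (nbhs ((x0, h0), (0 : R^o))) (nbhs (x0, h0)) (nbhs h0) cvg_fst cvg_snd).
have [[AB1 D] /= [[[A1 B1] /= [nA1 nB1] sAB1] nD] AB1D] := H _ nAU.
move: nD; rewrite -nbhs_ballE /= => -[d /= d0 dD].
have key : \forall t \near G, [/\ A1 (x t), (B `&` B1) (h t), `|tau t| < d & tau t != 0].
  near=> t; split; near: t => //.
  - exact: hx.
  - by apply: hh; apply: filterI.
  - apply: (@filterS _ _ FG (tau @^-1` ball 0 d)) => [t /=|]; last first.
      exact: (ht (ball 0 d) (nbhsx_ballx _ _ d0)).
    by rewrite -ball_normE /= sub0r normrN.
apply: filterS key => t [A1x [Bh B1h] td t0]; apply: WN.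
have inA s : 0 <= s <= 1 -> (A `&` U) (x t + (s * tau t) *: h t).
  move=> /andP[s0 s1]; apply: (AB1D ((x t, h t), s * tau t)); split => /=.
    exact: (sAB1 (x t, h t)).
  apply: dD; rewrite -ball_normE /= sub0r normrN normrM ger0_norm //.
  by apply: le_lt_trans td; rewrite ler_piMl.
(* The increment of [c] over [0, 1] is the difference quotient, and c'(s) is the differential at a
   point of the segment, which lies in [W] by joint continuity of df. *)
pose c s := (tau t)^-1 *: f (x t + (s * tau t) *: h t).
rewrite [X in W X](_ : _ = c 1 - c 0); last first.
  by rewrite /c /dquot mul1r mul0r scale0r addr0 scalerBr.
apply: (mean_value (c' := fun s => ddiff f (x t + (s * tau t) *: h t) (h t))) => //.
  move=> s s01; have [_ Us] := inA _ s01.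
  have := cvg_comp _ _ (cvg_mulr_dnbhs0 t0) (ddiff_cvg (dU _ (h t) Us)).
  apply: cvg_trans; apply: near_eq_cvg; near=> r; rewrite /= /dquot /c.
  by rewrite -scalerBr scalerA invfM -addrA -scalerDl -mulrDl.
move=> s s01; apply: (AB (_, _)); split => //=; exact: (inA _ s01).1.
Unshelve. all: by end_near. Qed.

(** For t nonzero, f(x + t h) = f(x) + t [dquot f x h t]: the inner quotient serves as a moving
    direction for the strictly differentiable [g]. *)
Lemma dquot_comp (E F K : tvsType R) (V : set F) (f : E -> F) (g : F -> K)
    (x h : E) (l : F) : open V -> Ck 1 V g -> V (f x) ->
  dquot f x h t @[t --> 0^'] --> l ->
  dquot (g \o f) x h t @[t --> 0^'] --> ddiff g (f x) l.
Proof.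
move=> oV cg Vfx hl.
have := dquot_cvg (x := fun=> f x) (h := dquot f x h) (tau := id) oV cg Vfx.
move=> /(_ _ (0^') _ (cvg_cst _) hl).
have c0 : id @ (0 : R)^' --> (0 : R) by apply: cvg_within_filter; exact: cvg_id.
move=> /(_ c0) H.
have n0 : \forall t \near (0 : R)^', t != 0 by exact: nbhs_dnbhs_neq.
have := H n0; apply: cvg_trans; apply: near_eq_cvg.
apply: filterS n0 => t t0 /=; rewrite /dquot /= scalerA divff// scale1r.
by rewrite subrKC.
Qed.

(** The quotient for h1 + h2 is the quotient for h1 at the moving base point x + t h2 plus the
    quotient for h2 at x. *)
Lemma ddiffD (E F : tvsType R) (hF : hausdorff_space F) (U : set E) (f : E -> F)
    (x h1 h2 : E) : open U -> Ck 1 U f -> U x ->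
  ddiff f x (h1 + h2) = ddiff f x h1 + ddiff f x h2.
Proof.
move=> oU cf Ux; apply: ddiff_eq => //.
have c0 : id @ (0 : R)^' --> (0 : R) by apply: cvg_within_filter; exact: cvg_id.
have n0 : \forall t \near (0 : R)^', t != 0 by exact: nbhs_dnbhs_neq.
have H1 : dquot f (x + t *: h2) h1 t @[t --> 0^'] --> ddiff f x h1.
  by apply: (dquot_cvg oU cf Ux _ (cvg_cst h1) c0 n0); exact: tvs_line.
have H2 : dquot f x h2 t @[t --> 0^'] --> ddiff f x h2.
  exact: (dquot_cvg oU cf Ux (cvg_cst x) (cvg_cst h2) c0 n0).
apply: cvg_trans; last exact: (tvs_cvgD H1 H2).
apply: near_eq_cvg; near=> t.
rewrite /dquot -scalerDr addrA subrK [t *: (h1 + h2)]scalerDr.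
by rewrite [t *: h1 + _]addrC addrA.
Unshelve. all: by end_near. Qed.

Lemma ddiffZ (E F : tvsType R) (hF : hausdorff_space F) (f : E -> F)
    (a : R) (x h : E) : (exists l : F, dquot f x h t @[t --> 0^'] --> l) ->
  ddiff f x (a *: h) = a *: ddiff f x h.
Proof.
move=> dh; apply: ddiff_eq => //; have [->|a0] := eqVneq a 0.
  rewrite !scale0r; have c00 : (fun=> 0 : F) @ (0 : R)^' --> (0 : F) by exact: cvg_cst.
  apply: cvg_trans; last exact: c00.
  apply: near_eq_cvg; near=> t; by rewrite /dquot scaler0 addr0 subrr scaler0.
apply: cvg_trans; last exact: (tvs_cvgZ (cvg_cst a)
  (cvg_comp _ _ (cvg_mulr_dnbhs0 a0) (ddiff_cvg dh))).
apply: near_eq_cvg; near=> t.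
by rewrite /dquot /= !scalerA invfM mulrCA divff// mulr1.
Unshelve. all: by end_near. Qed.

Lemma dquot_near (E F : tvsType R) (U : set E) (f g : E -> F) (x h : E) :
  open U -> U x -> (forall y, U y -> f y = g y) ->
  \forall t \near (0 : R)^', dquot f x h t = dquot g x h t.
Proof.
move=> oU Ux fg.
have H : \forall t \near (0 : R)^', U (x + t *: h).
  exact: (@tvs_line _ _ x h U (open_nbhs_nbhs (conj oU Ux))).
by near=> t; rewrite /dquot !fg//; near: t.
Unshelve. all: by end_near. Qed.

Lemma dquot_eq_cvg (E F : tvsType R) (U : set E) (f g : E -> F) (x h : E) (l : F) :
  open U -> U x -> (forall y, U y -> f y = g y) ->
  dquot f x h t @[t --> 0^'] --> l -> dquot g x h t @[t --> 0^'] --> l.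
Proof.
move=> oU Ux fg; apply: cvg_trans; apply: near_eq_cvg.
exact: (dquot_near h oU Ux fg).
Qed.

End differential.

Lemma hausdorff_prod (X Y : topologicalType) :
  hausdorff_space X -> hausdorff_space Y -> hausdorff_space (X * Y)%type.
Proof.
move=> hX hY [x y] [x' y'] xy; congr pair.
  apply: hX => A B nA nB.
  have [||[a b] [[/= Aa _] [/= Ba _]]] := xy (A `*` setT) (B `*` setT); last by exists a.
    by exists (A, setT) => //=; split => //; exact: filterT.
  by exists (B, setT) => //=; split => //; exact: filterT.
apply: hY => A B nA nB.
have [||[a b] [[/= _ Aa] [/= _ Ba]]] := xy (setT `*` A) (setT `*` B); last by exists b.
  by exists (setT, A) => //=; split => //; exact: filterT.
by exists (setT, B) => //=; split => //; exact: filterT.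
Qed.

(** * Closure properties of C^k maps *)

Section Ck_theory.
Context (R : realType).

Lemma open_fstset (E F : tvsType R) (U : set E) : open U -> open [set xh : E * F | U xh.1].
Proof. by move=> oU; apply: (@open_comp _ _ fst U) => // x _; exact: cvg_fst. Qed.

Lemma Ck_sub (F : tvsType R) k (E : tvsType R) (U V : set E) (f : E -> F) :
  V `<=` U -> Ck k U f -> Ck k V f.
Proof.
elim: k E U V f => [|k IH] E U V f VU /=; first by move=> cf x /VU /cf.
move=> [cf df ddf]; split => [x /VU /cf //|x h /VU /df //|].
by apply: IH ddf => -[x h] /= /VU.
Qed.

(** Every clause of [Ck] is a condition at single points of the set, with limits taken in the whole
    space. *)
Lemma Ck_cover (F : tvsType R) k (E : tvsType R) (U : set E) (f : E -> F) :
  (forall x, U x -> exists2 V, V x & Ck k V f) -> Ck k U f.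
Proof.
elim: k E U f => [|k IH] E U f H /=; first by move=> x /H[V Vx]; apply.
split => [x /H[V Vx [cf _ _]]|x h /H[V Vx [_ df _]]|]; [exact: cf|exact: df|].
apply: IH => -[x h] /= /H[V Vx [_ _ ddf]].
by exists [set xh | V xh.1].
Qed.

(** From a point of the open set U the difference quotients eventually see only values on U, so the
    differentials agree there as well and the induction continues. *)
Lemma Ck_eq (F : tvsType R) k (E : tvsType R) (U : set E) (f g : E -> F) :
  open U -> (forall x, U x -> f x = g x) -> Ck k U f -> Ck k U g.
Proof.
have near_eq (E' : tvsType R) (V : set E') (u v : E' -> F) x : open V ->
    (forall x, V x -> u x = v x) -> V x -> {for x, continuous u} ->
    {for x, continuous v}.
  move=> oV uv Vx; rewrite /prop_for /continuous_at -(uv _ Vx); apply: cvg_trans.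
  apply: near_eq_cvg; have nV : nbhs x V by exact: open_nbhs_nbhs.
  by near=> y; apply: uv; near: y.
elim: k E U f g => [|k IH] E U f g oU fg /=.
  by move=> cf x Ux; apply: (near_eq _ U f) => //; exact: cf.
move=> [cf df ddf]; split.
- by move=> x Ux; apply: (near_eq _ U f) => //; exact: cf.
- by move=> x h Ux; have [l hl] := df x h Ux; exists l; exact: (dquot_eq_cvg oU Ux fg).
- apply: IH ddf; first exact: open_fstset.
  move=> [x h] /= Ux; rewrite /ddiff; congr (xget _ _).
  apply/seteqP; split => l /=; apply: (dquot_eq_cvg oU Ux) => // y Uy.
  by rewrite fg.
Unshelve. all: by end_near. Qed.

Lemma CkS (F : tvsType R) k (E : tvsType R) (U : set E) (f : E -> F) :
  Ck k.+1 U f -> Ck k U f.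
Proof.
elim: k E U f => [|k IH] E U f /=; first by case.
by move=> [cf df ddf]; split => //; exact: IH.
Qed.

Lemma Ck_C1 (F : tvsType R) k (E : tvsType R) (U : set E) (f : E -> F) :
  Ck k.+1 U f -> Ck 1 U f.
Proof. by elim: k => // k IH /CkS. Qed.

Lemma Ck_cst (F : tvsType R) (hF : hausdorff_space F) k (E : tvsType R) (U : set E) (a : F) :
  Ck k U (fun=> a).
Proof.
have dq (E' : tvsType R) (b : F) (x h : E') :
    dquot (fun=> b) x h t @[t --> 0^'] --> (0 : F).
  rewrite [X in X @ _ --> _](_ : _ = (fun=> 0)); first exact: cvg_cst.
  by apply/funext => t; rewrite /dquot subrr scaler0.
elim: k E U a => [|k IH] E U a /=; first by move=> x _; exact: cvg_cst.
split; [by move=> x _; exact: cvg_cst|by move=> x h _; exists 0; exact: dq|].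
rewrite [X in Ck _ _ X](_ : _ = fun=> 0); first exact: IH.
by apply/funext => xh; apply: ddiff_eq => //; exact: dq.
Qed.

Lemma Ck_lin (F : tvsType R) (hF : hausdorff_space F) k (E : tvsType R) (U : set E) (L : E -> F) :
  linear L -> continuous L -> Ck k U L.
Proof.
have dq (E' : tvsType R) (M : E' -> F) (x h : E') : linear M ->
    dquot M x h t @[t --> 0^'] --> M h.
  move=> lM; have cM : (fun=> M h) @ (0 : R)^' --> M h by exact: cvg_cst.
  apply: cvg_trans cM; apply: near_eq_cvg; have n0 : \forall t \near (0 : R)^', t != 0 by exact: nbhs_dnbhs_neq.
  near=> t; have t0 : t != 0 by near: t.
  by rewrite /dquot [x + _]addrC lM addrK scalerA mulVf// scale1r.
elim: k E U L => [|k IH] E U L lL cL /=; first by move=> x _; exact: cL.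
split; [by move=> x _; exact: cL|by move=> x h _; exists (L h); exact: dq|].
(* The differential (x, h) |-> L h is again linear and continuous, so the induction closes over all
   spaces at once. *)
rewrite [X in Ck _ _ X](_ : _ = L \o snd).
  apply: IH; first by move=> a x y; rewrite /= lL.
  by move=> x; apply: continuous_comp; [exact: cvg_snd|exact: cL].
by apply/funext => xh; apply: ddiff_eq => //; exact: dq.
Unshelve. all: by end_near. Qed.

Lemma Ck_fst (F K : tvsType R) (hF : hausdorff_space F) k (U : set (F * K)) :
  Ck k U (fst : F * K -> F).
Proof. by apply: Ck_lin => // x; exact: cvg_fst. Qed.

Lemma Ck_snd (F K : tvsType R) (hF : hausdorff_space K) k (U : set (F * K)) :
  Ck k U (snd : F * K -> K).
Proof. by apply: Ck_lin => // x; exact: cvg_snd. Qed.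

Lemma Ck_id (F : tvsType R) (hF : hausdorff_space F) k (U : set F) : Ck k U id.
Proof. by apply: Ck_lin => // x; exact: cvg_id. Qed.

Lemma Ck_pair (F K : tvsType R) (hF : hausdorff_space F) (hK : hausdorff_space K)
    k (E : tvsType R) (U : set E) (f : E -> F) (g : E -> K) :
  open U -> Ck k U f -> Ck k U g -> Ck k U (fun x => (f x, g x)).
Proof.
have dq (E' : tvsType R) (u : E' -> F) (v : E' -> K) x h (a : F) (b : K) :
  dquot u x h t @[t --> 0^'] --> a -> dquot v x h t @[t --> 0^'] --> b ->
  dquot (fun x => (u x, v x)) x h t @[t --> 0^'] --> (a, b).
  by move=> ha hb; exact: (cvg_pair ha hb).
elim: k E U f g => [|k IH] E U f g oU.
  by move=> cf cg x Ux; exact: (cvg_pair (cf _ Ux) (cg _ Ux)).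
move=> /= [cf df ddf] [cg dg ddg]; split.
- by move=> x Ux; exact: (cvg_pair (cf _ Ux) (cg _ Ux)).
- move=> x h Ux; have [a ha] := df x h Ux; have [b hb] := dg x h Ux.
  by exists (a, b); exact: dq.
- apply: (Ck_eq (f := fun xh => (ddiff f xh.1 xh.2, ddiff g xh.1 xh.2))).
  + exact: open_fstset.
  + move=> [x h] /= Ux; apply/esym/ddiff_eq; first exact: hausdorff_prod.
    by apply: dq; apply: ddiff_cvg; [exact: df|exact: dg].
  + by apply: IH => //; exact: open_fstset.
Qed.

Lemma ddiff_comp (E F K : tvsType R) (hF : hausdorff_space F) (hK : hausdorff_space K)
    (V : set F) (f : E -> F) (g : F -> K) (x h : E) :
  open V -> Ck 1 V g -> V (f x) ->
  (exists l : F, dquot f x h t @[t --> 0^'] --> l) ->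
  ddiff (g \o f) x h = ddiff g (f x) (ddiff f x h).
Proof.
move=> oV cg Vfx df; apply: ddiff_eq => //.
by apply: (dquot_comp oV) => //; exact: ddiff_cvg.
Qed.

(** d(g o f)(x, h) = dg(f(x), df(x)(h)) is again a composite, now over product spaces; hence the
    induction on k with all spaces and sets generalized. *)
Lemma Ck_comp (F K : tvsType R) (hF : hausdorff_space F) (hK : hausdorff_space K)
    k (E : tvsType R) (hE : hausdorff_space E)
    (U : set E) (V : set F) (f : E -> F) (g : F -> K) :
  open U -> open V -> (forall x, U x -> V (f x)) ->
  Ck k U f -> Ck k V g -> Ck k U (g \o f).
Proof.
elim: k E hE F hF K hK U V f g => [|k IH] E hE F hF K hK U V f g oU oV UV.
  by move=> cf cg x Ux; apply: continuous_comp; [exact: cf|exact: cg (UV _ Ux)].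
move=> cf1 cg1; have cg11 := Ck_C1 cg1.
have cf0 := CkS cf1.
case: (cf1) => cf df ddf; case: (cg1) => cg dg ddg.
split.
- by move=> x Ux; apply: continuous_comp; [exact: cf|exact: cg (UV _ Ux)].
- move=> x h Ux; exists (ddiff g (f x) (ddiff f x h)).
  by apply: (dquot_comp oV) => //; [exact: UV|exact: ddiff_cvg (df _ _ _)].
apply: (Ck_eq (f := (fun yh => ddiff g yh.1 yh.2) \o
   (fun xh => (f xh.1, ddiff f xh.1 xh.2)))).
- exact: open_fstset.
- move=> [x h] /= Ux; apply/esym/(ddiff_comp _ _ oV) => //; first exact: UV.
  exact: df.
- apply: (IH _ _ (F * F)%type _ K) ddg => //; try exact: hausdorff_prod.
  + exact: open_fstset.
  + exact: open_fstset.
  + by move=> [x h] /= /UV.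
  + apply: Ck_pair => //; first exact: open_fstset.
    (* The first component f(x) is a composite with the projection, so the induction hypothesis is
       used a second time, on [f] at the lower order [cf0]. *)
    apply: (IH (E * E)%type (hausdorff_prod hE hE) E hE F hF [set xh | U xh.1] U fst f) => //.
      exact: open_fstset.
    exact: Ck_fst.
Qed.

Lemma CkD (F : tvsType R) (hF : hausdorff_space F) k (E : tvsType R)
    (hE : hausdorff_space E) (U : set E) (f g : E -> F) :
  open U -> Ck k U f -> Ck k U g -> Ck k U (fun x => f x + g x).
Proof.
move=> oU cf cg.
apply: (@Ck_comp (F * F)%type F _ _ k E hE U setT (fun x => (f x, g x))
  (fun z => z.1 + z.2)) => //; [exact: hausdorff_prod|exact: openT|exact: Ck_pair|].
apply: Ck_lin => //; last by move=> x; exact: add_continuous.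
by move=> a x y /=; rewrite scalerDr addrACA.
Qed.

Lemma Ck_comp_lin (F K : tvsType R) (hF : hausdorff_space F) (hK : hausdorff_space K)
    k (E : tvsType R) (hE : hausdorff_space E)
    (U : set E) (f : E -> F) (L : F -> K) :
  open U -> linear L -> continuous L -> Ck k U f -> Ck k U (fun x => L (f x)).
Proof.
move=> oU lL cL cf; apply: (@Ck_comp F K hF hK k E hE U setT f L) => //.
  exact: openT.
exact: Ck_lin.
Qed.

Lemma dquot_scale (F : tvsType R) (a a' : R) (u u' : F) :
  dquot (fun z : R^o * F => z.1 *: z.2) (a, u) (a', u') t @[t --> 0^'] -->
  a' *: u + a *: u'.
Proof.
have n0 : \forall t \near (0 : R)^', t != 0 by exact: nbhs_dnbhs_neq.
have c0 : id @ (0 : R)^' --> (0 : R) by apply: cvg_within_filter; exact: cvg_id.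
have H : (fun t : R => (a' *: u + a *: u') + t *: (a' *: u')) @ (0 : R)^' -->
    (a' *: u + a *: u') + (0 : R) *: (a' *: u').
  by apply: tvs_cvgD; [exact: cvg_cst|apply: tvs_cvgZ => //; exact: cvg_cst].
rewrite scale0r addr0 in H; apply: cvg_trans H; apply: near_eq_cvg.
apply: filterS n0 => t t0; rewrite /dquot /=.
have -> : (a + t *: (a' : R^o)) *: (u + t *: u') - a *: u =
   t *: (a' *: u + a *: u' + t *: (a' *: u')).
  rewrite scalerDl !scalerDr !scalerA addrAC [a *: u + _]addrC addrK.
  by rewrite addrCA addrA [t * a]mulrC [t *: (a' : R^o)]/(t * a') [t * a' * t]mulrAC.
by rewrite [t^-1 *: _]scalerA mulVf// scale1r.
Qed.

(** The differential a' u + a u' is a sum of two scalar multiplications composed with linear maps,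
    to which the induction hypothesis applies. *)
Lemma Ck_scale2 (F : tvsType R) (hF : hausdorff_space F) k (U : set (R^o * F)) :
  open U -> Ck k U (fun z : R^o * F => z.1 *: z.2).
Proof.
have hR : hausdorff_space R^o by exact: norm_hausdorff.
have hRF := hausdorff_prod hR hF.
elim: k U => [|k IH] U oU; first by move=> x _; exact: scale_continuous.
split; first by move=> x _; exact: scale_continuous.
  by move=> [a u] [a' u'] _; eexists; exact: dquot_scale.
apply: (Ck_eq (f := fun zh : (R^o * F) * (R^o * F) =>
   zh.2.1 *: zh.1.2 + zh.1.1 *: zh.2.2)); first exact: open_fstset.
  by move=> [[a u] [a' u']] _ /=; apply/esym/ddiff_eq => //; exact: dquot_scale.
have c11 : continuous (fun z : (R^o * F) * (R^o * F) => z.1.1 : R^o).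
  by move=> z; apply: (@continuous_comp _ _ _ fst fst); exact: cvg_fst.
have c12 : continuous (fun z : (R^o * F) * (R^o * F) => z.1.2 : F).
  by move=> z; apply: (@continuous_comp _ _ _ fst snd); [exact: cvg_fst|exact: cvg_snd].
have c21 : continuous (fun z : (R^o * F) * (R^o * F) => z.2.1 : R^o).
  by move=> z; apply: (@continuous_comp _ _ _ snd fst); [exact: cvg_snd|exact: cvg_fst].
have c22 : continuous (fun z : (R^o * F) * (R^o * F) => z.2.2 : F).
  by move=> z; apply: (@continuous_comp _ _ _ snd snd); exact: cvg_snd.
have oU1 : open [set xh : (R^o * F) * (R^o * F) | U xh.1] by exact: open_fstset.
apply: CkD => //; first exact: hausdorff_prod.
  apply: (@Ck_comp (R^o * F)%type F _ _ k _ _ _ setT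
    (fun z : (R^o * F) * (R^o * F) => (z.2.1, z.1.2)) (fun z => z.1 *: z.2)) => //.
  + exact: hausdorff_prod.
  + exact: openT.
  + by apply: Ck_pair => //; apply: Ck_lin => //.
  + by apply: IH; exact: openT.
apply: (@Ck_comp (R^o * F)%type F _ _ k _ _ _ setT
    (fun z : (R^o * F) * (R^o * F) => (z.1.1, z.2.2)) (fun z => z.1 *: z.2)) => //.
+ exact: hausdorff_prod.
+ exact: openT.
+ by apply: Ck_pair => //; apply: Ck_lin => //.
+ by apply: IH; exact: openT.
Qed.

Lemma CkZ (F : tvsType R) (hF : hausdorff_space F) k (E : tvsType R)
    (hE : hausdorff_space E) (U : set E) (a : E -> R^o) (f : E -> F) :
  open U -> Ck k U a -> Ck k U f -> Ck k U (fun x => a x *: f x).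
Proof.
have hR : hausdorff_space R^o by exact: norm_hausdorff.
move=> oU ca cf.
apply: (@Ck_comp (R^o * F)%type F _ _ k E hE U setT (fun x => (a x, f x))
  (fun z => z.1 *: z.2)) => //; [exact: hausdorff_prod|exact: openT|exact: Ck_pair|].
by apply: Ck_scale2 => //; exact: openT.
Qed.

End Ck_theory.

Lemma open_preimage_on (X Y : topologicalType) (O : set X) (f : X -> Y) (V : set Y) :
  open O -> (forall x, O x -> {for x, continuous f}) -> open V ->
  open (O `&` f @^-1` V).
Proof.
move=> oO cf oV; rewrite openE => x [Ox Vfx]; apply: filterI.
  exact: open_nbhs_nbhs.
by apply: cf => //; exact: open_nbhs_nbhs.
Qed.

(** * Smooth maps from open sets into manifolds and Lie groups *)

Section smooth_into_manifold.
Context (R : realType).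

(** The source is an open subset of a vector space: inverse charts, curves and parametrized families
    of group elements are all of this kind, and [Ck] applies to them directly. *)
Definition smooth_into (M : topologicalType) (F P : tvsType R) (A : set (chart M F))
    (O : set P) (psi : P -> M) : Prop :=
  (forall p, O p -> {for p, continuous psi}) /\
  forall c, A c -> smooth_on (O `&` psi @^-1` cdom c) (cfun c \o psi).

Lemma open_chart_image (M : topologicalType) (F : tvsType R) (c : chart M F)
    (V : set M) : is_chart c -> open V -> open (cfun c @` (cdom c `&` V)).
Proof.
move=> [oc oic ck cc cic] oV.
have -> : cfun c @` (cdom c `&` V) = (cfun c @` cdom c) `&` cinv c @^-1` V.
  apply/seteqP; split => y.
    by move=> [x [cx Vx] <-]; split; [exists x|rewrite /= ck].
  by move=> [[x cx <-]] /=; rewrite ck // => Vx; exists x.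
exact: open_preimage_on.
Qed.

Lemma is_chart_id (F : tvsType R) : is_chart (id_chart F).
Proof.
split => //=; first exact: openT.
- by rewrite image_id; exact: openT.
- by move=> x _; exact: cvg_id.
- by move=> x _; exact: cvg_id.
Qed.

Lemma is_chart_prod (M N : topologicalType) (E F : tvsType R)
  (c : chart M E) (d : chart N F) : is_chart c -> is_chart d ->
  is_chart (prod_chart c d).
Proof.
move=> [oc oic ck cc cic] [od oid dk dd did].
have oX (X Y : topologicalType) (A : set X) (B : set Y) : open A -> open B -> open (A `*` B).
  by move=> oA oB; rewrite openE => -[x y] [Ax By]; exists (A, B) => //; split; exact: open_nbhs_nbhs.
have imE : cfun (prod_chart c d) @` cdom (prod_chart c d) =
    (cfun c @` cdom c) `*` (cfun d @` cdom d).
  apply/seteqP; split => -[x y] /=.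
    by move=> [[a b] [/= ca db] [<- <-]]; split; [exists a|exists b].
  by move=> [[a ca <-] [b db <-]]; exists (a, b).
split.
- exact: oX.
- by rewrite imE; exact: oX.
- by move=> [x y] [/= cx dy]; rewrite ck // dk.
- move=> [x y] [/= cx dy].
  have h1 : {for (x, y), continuous (cfun c \o fst)}.
    by apply: continuous_comp; [exact: cvg_fst|exact: cc].
  have h2 : {for (x, y), continuous (cfun d \o snd)}.
    by apply: continuous_comp; [exact: cvg_snd|exact: dd].
  exact: (cvg_pair h1 h2).
- rewrite imE => -[x y] [/= cx dy].
  have h1 : {for (x, y), continuous (cinv c \o fst)}.
    by apply: continuous_comp; [exact: cvg_fst|exact: cic].
  have h2 : {for (x, y), continuous (cinv d \o snd)}.
    by apply: continuous_comp; [exact: cvg_snd|exact: did].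
  exact: (cvg_pair h1 h2).
Qed.

(** Smoothness is local: near p the composite factors through a chart of [M] around [psi p], and
    [Ck_cover] glues the pieces. *)
Lemma smooth_into_comp (M N : topologicalType) (F K P : tvsType R)
    (hF : hausdorff_space F) (hK : hausdorff_space K) (hP : hausdorff_space P)
    (A : set (chart M F)) (B : set (chart N K)) (O : set P) (f : M -> N) (psi : P -> M) :
  (forall c, A c -> is_chart c) -> (forall x, exists2 c, A c & cdom c x) ->
  (forall d, B d -> is_chart d) -> open O ->
  smooth_map A B f -> smooth_into A O psi -> smooth_into B O (f \o psi).
Proof.
move=> Ac Acov Bc oO [cf sf] [cpsi spsi]; split.
  by move=> p Op; apply: continuous_comp; [exact: cpsi|exact: cf].
move=> d Bd k; apply: Ck_cover => p [Op dp].
have [c Acc cp] := Acov (psi p).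
have [oc _ ck _ _] := Ac _ Acc; have [od _ _ _ _] := Bc _ Bd.
have ofd : open (f @^-1` cdom d) by apply: open_comp => // x _; exact: cf.
exists (O `&` psi @^-1` (cdom c `&` f @^-1` cdom d)) => //.
have oV : open (O `&` psi @^-1` (cdom c `&` f @^-1` cdom d)).
  by apply: open_preimage_on => //; exact: openI.
apply: (Ck_eq (f := (cfun d \o f \o cinv c) \o (cfun c \o psi))) => //.
  by move=> q [Oq [cq dq]] /=; rewrite ck.
apply: (Ck_comp hF hK hP (V := cfun c @` (cdom c `&` f @^-1` cdom d))) => //.
- by apply: open_chart_image => //; exact: Ac.
- by move=> q [Oq cq]; exists (psi q).
- by apply: Ck_sub (spsi c Acc k) => q [Oq [cq _]].
- exact: sf.
Qed.

Lemma smooth_into_pair (M N : topologicalType) (F K P : tvsType R)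
    (hF : hausdorff_space F) (hK : hausdorff_space K)
    (A : set (chart M F)) (B : set (chart N K)) (O : set P)
    (psi : P -> M) (phi : P -> N) :
  (forall c, A c -> is_chart c) -> (forall d, B d -> is_chart d) -> open O ->
  smooth_into A O psi -> smooth_into B O phi -> smooth_into (prod_atlas A B) O (fun p => (psi p, phi p)).
Proof.
move=> Ac Bc oO [cpsi spsi] [cphi sphi]; split.
  by move=> p Op; exact: (cvg_pair (cpsi _ Op) (cphi _ Op)).
move=> e [c [d [Acc Bd ->]]] k.
have [oc _ _ _ _] := Ac _ Acc; have [od _ _ _ _] := Bc _ Bd.
rewrite (_ : O `&` _ = (O `&` psi @^-1` cdom c) `&` (O `&` phi @^-1` cdom d)); last first.
  by apply/seteqP; split => p /=; [move=> [? []]|move=> [[? ?] [? ?]]].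
apply: Ck_pair => //.
- by apply: openI; apply: open_preimage_on.
- by apply: Ck_sub (spsi c Acc k) => p [].
- by apply: Ck_sub (sphi d Bd k) => p [].
Qed.

Lemma smooth_into_precomp (M : topologicalType) (F P Q : tvsType R)
    (hF : hausdorff_space F) (hP : hausdorff_space P) (hQ : hausdorff_space Q)
    (A : set (chart M F)) (O : set P) (O' : set Q) (psi : P -> M) (theta : Q -> P) :
  (forall c, A c -> is_chart c) -> open O -> open O' -> (forall q, O' q -> O (theta q)) ->
  smooth_into A O psi -> smooth_on O' theta -> smooth_into A O' (psi \o theta).
Proof.
move=> Ac oO oO' OO' [cpsi spsi] st.
have ct q : O' q -> {for q, continuous theta} by exact: (st 0%N).
split; first by move=> q O'q; apply: continuous_comp; [exact: ct|apply: cpsi; exact: OO'].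
move=> c Acc k; have [oc _ _ _ _] := Ac _ Acc.
have oOc : open (O `&` psi @^-1` cdom c) by exact: open_preimage_on.
rewrite (_ : O' `&` _ = O' `&` theta @^-1` (O `&` psi @^-1` cdom c)); last first.
  by apply/seteqP; split => q /=; [move=> [? ?]; split => //; split => //; exact: OO'|move=> [? []]].
apply: (Ck_comp hP hF hQ (V := O `&` psi @^-1` cdom c) (g := cfun c \o psi)) => //.
- exact: open_preimage_on.
- by move=> q [].
- by apply: Ck_sub (st k) => q [].
- exact: spsi.
Qed.

Lemma smooth_into_id (F P : tvsType R) (O : set P) (psi : P -> F) :
  smooth_into [set id_chart F] O psi <-> smooth_on O psi.
Proof.
have OI : O `&` psi @^-1` cdom (id_chart F) = O by rewrite /= preimage_setT setIT.
split => [[_ /(_ _ erefl)]|s]; first by rewrite OI.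
split; first exact: (s 0%N).
by move=> _ -> k; rewrite OI; exact: s.
Qed.

End smooth_into_manifold.

Section smooth_into_lie_group.
Context (R : realType) (E : tvsType R) (hE : hausdorff_space E) (G : lieGroupType E).
Notation atlasG := (@atlas R E G).
Notation c1 := (@chart1 R E G).

Lemma smooth_into_mul (P : tvsType R) (hP : hausdorff_space P) (O : set P) (psi phi : P -> G) :
  open O -> smooth_into atlasG O psi -> smooth_into atlasG O phi ->
  smooth_into atlasG O (fun p => (psi p * phi p)%g).
Proof.
move=> oO spsi sphi.
have Ac := @atlas_chart R E G.
apply: (smooth_into_comp (hausdorff_prod hE hE) hE hP (A := prod_atlas atlasG atlasG) (f := fun p : G * G => (p.1 * p.2)%g)
  (psi := fun p => (psi p, phi p))) => //.
- by move=> _ [c [d [/Ac hc /Ac hd ->]]]; exact: is_chart_prod.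
- move=> [x y]; have [c Acc cx] := @atlas_cover R E G x.
  have [d Ad dy] := @atlas_cover R E G y.
  by exists (prod_chart c d) => //; exists c, d.
- exact: mulg_smooth.
- exact: smooth_into_pair.
Qed.

Lemma smooth_into_inv (P : tvsType R) (hP : hausdorff_space P) (O : set P) (psi : P -> G) :
  open O -> smooth_into atlasG O psi -> smooth_into atlasG O (fun p => (psi p)^-1%g).
Proof.
move=> oO spsi.
have Ac := @atlas_chart R E G; have Av := @atlas_cover R E G.
exact: (smooth_into_comp hE hE hP Ac Av Ac oO (@invg_smooth R E G) spsi).
Qed.

Lemma smooth_into_cinv (c : chart G E) : atlasG c -> smooth_into atlasG (cfun c @` cdom c) (cinv c).
Proof.
move=> Ac; have [oc oic ck cc cic] := @atlas_chart R E G _ Ac.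
split => [p|d Ad]; first exact: cic.
rewrite [X in smooth_on X _](_ : _ = cfun c @` (cdom c `&` cdom d)); first exact: atlas_compat.
apply/seteqP; split => y /=.
  by move=> [[x cx <-]]; rewrite ck // => dx; exists x.
by move=> [x [cx dx] <-]; split; [exists x|rewrite ck].
Qed.

Lemma smooth_into_exp (e : E -> G) (P : tvsType R) (hP : hausdorff_space P) (O : set P) (theta : P -> E) :
  smooth_exp_map e -> open O -> smooth_on O theta -> smooth_into atlasG O (e \o theta).
Proof.
move=> [se _ _] oO st.
have Ac := @atlas_chart R E G.
apply: (smooth_into_comp hE hE hP _ _ Ac oO se); last by apply/smooth_into_id.
- by move=> _ ->; exact: is_chart_id.
- by move=> x; exists (id_chart E).
Qed.

(* The left logarithmic derivative of psi, read in chart1. *)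
Definition dlog (P : tvsType R) (psi : P -> G) (pq : P * P) : E :=
  ddiff (fun p => cfun c1 ((psi pq.1)^-1 * psi p)%g) pq.1 pq.2.

(** The two-point quotient psi(p)^-1 psi(p') is close to 1 for p' close to p, so [chart1] reads it
    near the diagonal. It makes the logarithmic derivative, whose base point moves, a derivative of
    one fixed map. *)
Lemma smooth_lquot (P : tvsType R) (hP : hausdorff_space P) (O : set P) (psi : P -> G) :
  open O -> smooth_into atlasG O psi ->
  let O2 := [set pp : P * P | [/\ O pp.1, O pp.2 & cdom c1 ((psi pp.1)^-1 * psi pp.2)%g]] in
  open O2 /\ smooth_on O2 (fun pp => cfun c1 ((psi pp.1)^-1 * psi pp.2)%g).
Proof.
move=> oO spsi O2; have Ac := @atlas_chart R E G.
have hPP := hausdorff_prod hP hP.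
pose OO := [set pp : P * P | O pp.1] `&` [set pp : P * P | O pp.2].
have o1 : open [set pp : P * P | O pp.1] by exact: open_fstset.
have o2 : open [set pp : P * P | O pp.2].
  by apply: (@open_comp _ _ snd O) => // x _; exact: cvg_snd.
have oOO : open OO by exact: openI.
have s : smooth_into atlasG OO (fun pp : P * P => ((psi pp.1)^-1 * psi pp.2)%g).
  apply: smooth_into_mul => //.
    apply: (smooth_into_inv hPP (psi := psi \o fst)) => //.
    apply: (smooth_into_precomp hE hP hPP Ac oO) => //; first by move=> q [].
    by move=> k; exact: Ck_fst.
  apply: (smooth_into_precomp hE hP hPP Ac oO (psi := psi) (theta := snd)) => //; first by move=> q [].
  by move=> k; exact: Ck_snd.
have O2E : O2 = OO `&` (fun pp : P * P => ((psi pp.1)^-1 * psi pp.2)%g) @^-1` cdom c1.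
  by apply/seteqP; split => pp /=; [move=> []|move=> [[]]].
have [oc _ _ _ _] := Ac _ (@chart1_atlas R E G).
split; first by rewrite O2E; apply: open_preimage_on => //; exact: s.1.
rewrite O2E; exact: (s.2 _ (@chart1_atlas R E G)).
Qed.

Lemma dlog_derive (P : tvsType R) (hP : hausdorff_space P) (O : set P) (psi : P -> G) p q :
  open O -> smooth_into atlasG O psi -> O p ->
  dquot (fun p' => cfun c1 ((psi p)^-1 * psi p')%g) p q t @[t --> 0^'] --> dlog psi (p, q).
Proof.
move=> oO spsi Op.
have [oO2 s2] := smooth_lquot hP oO spsi.
have Opp : O p /\ O p /\ cdom c1 ((psi p)^-1 * psi p)%g.
  by rewrite mulVg; split => //; split => //; exact: chart1_dom.
apply: ddiff_cvg; have [_ /(_ (p, p) (0, q)) d _] := s2 1%N.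
have [|l hl] := d; first by case: Opp => ? [].
exists l; apply: cvg_trans hl; apply: near_eq_cvg; near=> t.
by rewrite /dquot /= scaler0 addr0.
Unshelve. all: by end_near. Qed.

(** [dlog psi (p, q)] is the differential of the two-point quotient at (p, p) in the direction (0,
    q), so C^k regularity uses order k + 1 of the quotient. *)
Lemma smooth_dlog (P : tvsType R) (hP : hausdorff_space P) (O : set P) (psi : P -> G) :
  open O -> smooth_into atlasG O psi -> smooth_on [set pq : P * P | O pq.1] (dlog psi).
Proof.
move=> oO spsi k; have hPP := hausdorff_prod hP hP.
have [oO2 s2] := smooth_lquot hP oO spsi.
have oO1 : open [set pq : P * P | O pq.1] by exact: open_fstset.
pose mm (pp : P * P) := cfun c1 ((psi pp.1)^-1 * psi pp.2)%g.
set O2 := (O2 in open O2) in oO2 s2.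
have [c2 d2 dd2] := s2 k.+1.
apply: (Ck_eq (f := (fun zh => ddiff mm zh.1 zh.2) \o
  (fun pq : P * P => ((pq.1, pq.1), ((0 : P), pq.2))))) => //.
  move=> [p q] /= Op; apply: ddiff_eq => //.
  apply: cvg_trans (dlog_derive (q := q) hP oO spsi Op).
  apply: near_eq_cvg; near=> t.
  by rewrite /dquot /mm /= scaler0 addr0.
apply: (Ck_comp (hausdorff_prod hPP hPP) hE hPP (V := [set zh : (P * P) * (P * P) | O2 zh.1])) dd2 => //.
- exact: open_fstset.
- by move=> [p q] /= Op; rewrite /O2 /= mulVg; split => //; exact: chart1_dom.
- apply: Ck_pair => //.
    by apply: Ck_pair => //; exact: Ck_fst.
  by apply: Ck_pair => //; [exact: Ck_cst|exact: Ck_snd].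
Unshelve. all: by end_near. Qed.

End smooth_into_lie_group.

(** * Seminorms and multilinear maps *)

Section seminorms.
Local Open Scope complex_scope.
Local Open Scope ring_scope.
Context (R : realType).

Lemma normC_realE (c : R[i]) : `|c| = (complex.Re `|c|)%:C.
Proof. by rewrite RRe_real // normr_real. Qed.

Lemma normH_realE (H : normedModType R[i]) (v : H) : `|v| = (complex.Re `|v|)%:C.
Proof. by rewrite RRe_real // realE normr_ge0. Qed.

Section gauge.
Context (V : tvsType R[i]).

(* The Minkowski functional of the balanced core of a convex neighbourhood of 0. *)
Lemma cont_seminorm_nbhs (W : set V) : nbhs (0 : V) W ->
  exists2 p, cont_seminorm p & forall x, p x < 1 -> W x.
Proof.
have [Bs cBs [oBs bBs]] := @locally_convex R[i] V.
move=> /bBs[B /= [BsB B0] BW]; have oB := oBs _ BsB.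
have /convex_setP cB : convex_set B by apply: cBs; rewrite inE.
pose D : set V := [set z | forall c : R[i], `|c| <= 1 -> B (c *: z)].
have balD c z : `|c| <= 1 -> D z -> D (c *: z).
  by move=> c1 Dz d d1; rewrite scalerA; apply: Dz; rewrite normrM mulr_ile1.
have cD a b u v : 0 <= a -> 0 <= b -> a + b = 1 -> D u -> D v -> D (a *: u + b *: v).
  move=> a0 b0 ab Du Dv c c1; rewrite scalerDr !scalerA ![c * _]mulrC -!scalerA.
  by apply: cB => //; [exact: Du|exact: Dv].
have nD : nbhs (0 : V) D.
  have := @scale_continuous R[i] V (0, 0) B; rewrite scale0r => H.
  have [[A M] /= [nA nM] AM] := H (open_nbhs_nbhs (conj oB B0)).
  move: nA; rewrite -nbhs_ballE /= => -[d /= d0 dA].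
  have d20 : d / 2 != 0 by rewrite gt_eqF // divr_gt0.
  apply: filterS (nbhs0Z d20 nM) => _ [m Mm <-] c c1.
  rewrite scalerA; apply: (AM (_, _)); split => //=; apply: dA.
  rewrite -ball_normE /= sub0r normrN normrM (@gtr0_norm _ (d / 2)) ?divr_gt0 //.
  apply: le_lt_trans (_ : d / 2 < d); first by rewrite ler_piMl // ltW // divr_gt0.
  by rewrite ltr_pdivrMr // mulr_natr mulr2n ltrDl.
have D0 : D 0 by exact: nbhs_singleton.
pose S z : set R := [set r | 0 < r /\ D ((r^-1)%:C *: z)].
have Sup z r r' : S z r -> r <= r' -> S z r'.
  move=> [r0 Dr] rr'; have r'0 : 0 < r' by exact: lt_le_trans rr'.
  split => //; rewrite (_ : _ *: z = (r / r')%:C *: ((r^-1)%:C *: z)).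
    apply: balD => //; rewrite normc_real ger0_norm; last exact/ltW/divr_gt0.
    by rewrite -(rmorph1 (real_complex R)) lecR ler_pdivrMr ?mul1r.
  by rewrite scalerA -rmorphM /= mulrC mulKf // gt_eqF.
have S0 z : S z !=set0.
  have := @scale_continuous R[i] V (0, z) D; rewrite scale0r => /(_ nD).
  move=> [[A M] /= [nA nM] AM].
  move: nA; rewrite -nbhs_ballE /= => -[d /= d0 dA].
  have dR : d = (complex.Re d)%:C by rewrite RRe_real // gtr0_real.
  have dR0 : 0 < complex.Re d by move: d0; rewrite {1}dR ltcR.
  (* The inverse of this scale is half the radius, hence strictly inside the ball. *)
  exists (2 / complex.Re d); split; first by rewrite divr_gt0.
  apply: (AM (_, _)); split => /=; last exact: nbhs_singleton.
  apply: dA; rewrite -ball_normE /= sub0r normrN normc_real dR ltcR.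
  by rewrite invf_div ger0_norm ?divr_ge0 ?ltW //; lra.
have lbS z : lbound (S z) 0 by move=> r [/ltW].
have hiS z : has_inf (S z) by split; [exact: S0|exists 0; exact: lbS].
pose p z := inf (S z).
have p_lt z r : p z < r -> S z r.
  move=> pr; have rdot : 0 < r - p z by rewrite subr_gt0.
  have [s Ss sr] := inf_adherent rdot (hiS z).
  by apply: Sup Ss _; move: sr; rewrite -/(p z); lra.
have p_le z r : S z r -> p z <= r by move=> Sr; apply: ge_inf => //; case: (hiS z).
have p_ge0 z : 0 <= p z by apply: lb_le_inf; [exact: S0|exact: lbS].
have p_tri x y : p (x + y) <= p x + p y.
  apply/ler_addgt0Pr => eps eps0.
  have [r0 Dr] := p_lt x (p x + eps / 2) ltac:(lra).
  have [s0 Ds] := p_lt y (p y + eps / 2) ltac:(lra).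
  set r := p x + _ in r0 Dr; set s := p y + _ in s0 Ds.
  rewrite (_ : _ + eps = r + s); last by rewrite /r /s; lra.
  have rs0 : 0 < r + s by lra.
  apply: p_le; split => //.
  rewrite (_ : _ *: (x + y) = (r / (r + s))%:C *: ((r^-1)%:C *: x) +
     (s / (r + s))%:C *: ((s^-1)%:C *: y)).
    apply: cD => //; rewrite ?lecR ?divr_ge0 ?ltW //.
    by rewrite -rmorphD -mulrDl /= divff ?gt_eqF.
  by rewrite !scalerA -!rmorphM /= scalerDr ![_ / (r + s)]mulrC !mulfK ?gt_eqF.
have p_0 : p 0 = 0.
  apply/eqP; rewrite eq_le p_ge0 andbT; apply/ler_addgt0Pr => eps eps0.
  by rewrite add0r; apply: p_le; split => //; rewrite scaler0.
have p_homle c x : c != 0 -> p (c *: x) <= complex.Re `|c| * p x.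
  move=> c0; have m0 : 0 < complex.Re `|c| by rewrite -ltcR -normC_realE normr_gt0.
  set m := complex.Re _ in m0 *.
  rewrite -ler_pdivrMl //; apply/ler_addgt0Pr => eps eps0.
  have [r0 Dr] := p_lt x (p x + eps) ltac:(lra).
  rewrite ler_pdivrMl //; apply: p_le; split; first exact: mulr_gt0.
  rewrite (_ : _ *: _ = (c * (m^-1)%:C) *: (((p x + eps)^-1)%:C *: x)).
    apply: balD => //; rewrite normrM normc_real (@ger0_norm _ m^-1) ?invr_ge0 ?(ltW m0) //.
    have -> : `|c| * (m^-1)%:C = 1; last exact: lexx.
    by rewrite normC_realE -/m -(rmorphM (real_complex R)) mulfV ?rmorph1 ?gt_eqF.
  by rewrite !scalerA invfM rmorphM /= [in LHS]mulrC mulrA.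
have p_hom c x : (p (c *: x))%:C = `|c| * (p x)%:C.
  have [->|c0] := eqVneq c 0; first by rewrite scale0r p_0 normr0 mul0r rmorph0.
  rewrite normC_realE -rmorphM /=; congr (_%:C); apply/eqP.
  rewrite eq_le p_homle //= -ler_pdivlMl; last by rewrite -ltcR -normC_realE normr_gt0.
  (* The reverse inequality is the first one for 1/c and the vector c x. *)
  have := p_homle c^-1 (c *: x); rewrite scalerA mulVf // scale1r invr_eq0 => /(_ c0).
  by rewrite normfV {1}normC_realE -fmorphV.
have p_opp x : p (- x) = p x.
  by apply: complexI; rewrite -scaleN1r p_hom normrN normr1 mul1r.
exists p; last first.
  move=> x /p_lt[_]; rewrite invr1 rmorph1 scale1r => Dx.
  by apply: BW; have := Dx 1; rewrite normr1 scale1r; exact.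
split => // x; apply/cvgrPdist_lt => eps eps0.
have nE : nbhs x [set y | D ((((eps / 2))^-1)%:C *: (x - y))].
  have h : (fun y => ((eps / 2)^-1)%:C *: (x - y)) @ x --> (0 : V).
    pose a := ((eps / 2)^-1)%:C.
    have c1 : (fun y => x - y) @ x --> (0 : V).
      rewrite -(subrr x); apply: (@cvg_comp _ _ _ (fun y => (x, y)) (fun z : V * V => z.1 - z.2)
        _ (nbhs (x, x))); last exact: (@sub_continuous V (x, x)).
      exact: (cvg_pair (cvg_cst x) cvg_id).
    have c2 : (fun _ : V => a : R[i]^o) @ x --> (a : R[i]^o) by exact: cvg_cst.
    rewrite -(scaler0 V a).
    apply: (@cvg_comp _ _ _ (fun y => (a, x - y) : R[i]^o * V)
      (fun z : R[i]^o * V => z.1 *: z.2) _ (nbhs ((a : R[i]^o), (0 : V))) _ (cvg_pair c2 c1)).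
    exact: (@scale_continuous R[i] V (a, 0)).
  exact: h nD.
apply: filterS nE => y Dy.
have pxy : p (x - y) <= eps / 2 by apply: p_le; split => //; lra.
have h1 := p_tri (x - y) y; rewrite subrK in h1.
have h2 := p_tri (y - x) x; rewrite subrK -(opprB x y) p_opp in h2.
by rewrite ltr_norml; apply/andP; split; lra.
Qed.

End gauge.

Section multilinear.
Context (V : tvsType R[i]) (H : normedModType R[i]).

(** A single [J] on lists carries maps of all arities, since differentiation lengthens the list.
    Real scalars are those of the rescaling arguments and of the real difference quotients. *)
Definition multilin (J : seq V -> H) := forall pre post (a : R) y z,
  J (pre ++ (a%:C *: y + z) :: post) = a%:C *: J (pre ++ y :: post) + J (pre ++ z :: post).

Lemma multilinZ J pre post a y : multilin J ->
  J (pre ++ (a%:C *: y) :: post) = a%:C *: J (pre ++ y :: post).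
Proof.
move=> mJ.
have J0 : J (pre ++ 0 :: post) = 0.
  by have := mJ pre post (-1) 0 0; rewrite scaler0 addr0 rmorphN1 scaleN1r addNr.
by rewrite -[a%:C *: y]addr0 mJ J0 addr0.
Qed.

(** Dividing an entry z by a number larger than p(z) brings it into W. This is done one entry at a
    time, [post] holding the entries already in the open unit ball of [p]. *)
Lemma multilin_bound (J : seq V -> H) n (W : set V) (C : R) : multilin J ->
  nbhs (0 : V) W ->
  (forall zs, size zs = n -> (forall z, z \in zs -> W z) -> `|J zs| <= C%:C) ->
  exists2 p, cont_seminorm p &
    forall zs, size zs = n -> `|J zs| <= (`|C| * \prod_(z <- zs) p z)%:C.
Proof.
move=> mJ /cont_seminorm_nbhs[p sp pW] JC; exists p => // zs szs.
have [_ p0 _ ph] := sp.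
suff key pre post : (size pre + size post)%N = n -> (forall z, z \in post -> p z < 1) ->
    `|J (pre ++ post)| <= (`|C| * \prod_(z <- pre) p z)%:C.
  by have := key zs [::]; rewrite cats0 addn0; exact.
elim/last_ind: pre post => [|pre z IH] post.
  move=> /= sn pp; rewrite big_nil mulr1.
  apply: le_trans (JC post sn _) _; first by move=> z /pp /pW.
  by rewrite lecR ler_norm.
rewrite size_rcons -cats1 -catA big_cat big_seq1 /= => sn pp.
set K := `|C| * \prod_(y <- pre) p y.
have K0 : 0 <= K by rewrite mulr_ge0 // prodr_ge0.
have g y : p y < 1 -> `|J (pre ++ y :: post)| <= K%:C.
  move=> y1; apply: IH; first by rewrite -sn /= addSnnS.
  by move=> x; rewrite inE => /orP[/eqP ->|/pp].
rewrite mulrA -/K normH_realE lecR; apply/ler_addgt0Pr => eps eps0.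
(* The positive excess also covers p(z) = 0; K times it is at most [eps]. *)
pose r := p z + eps / (K + 1).
have K10 : 0 < K + 1 by lra.
have ee : 0 < eps / (K + 1) by exact: divr_gt0.
have r0 : 0 < r by rewrite /r; have := p0 z; lra.
have := g ((r^-1)%:C *: z) _.
rewrite multilinZ // normrZ normc_real gtr0_norm ?invr_gt0 // normH_realE -rmorphM /= lecR.
rewrite ler_pdivrMl //; move=> h; apply: le_trans (h _) _.
  rewrite -ltcR ph normc_real gtr0_norm ?invr_gt0 // -rmorphM ltcR /= ltr_pdivrMl // mulr1.
  by rewrite /r ltrDl.
rewrite /r mulrDl [K * _]mulrC lerD2l -mulrA mulrC.
by rewrite ler_piMl ?(ltW eps0) // ler_pdivrMl //; lra.
Qed.

End multilinear.
End seminorms.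

(** * Hilbert spaces and weak integrals *)

Section hilbert_space.
Local Open Scope complex_scope.
Local Open Scope ring_scope.
Context (R : realType) (H : completeNormedModType R[i]) (ip : {dot H for Num.conj}).
Context (hip : forall v, `|v| ^+ 2 = ip v v).

Definition rnorm (v : H) : R := complex.Re `|v|.
(** The inner product of the underlying real Hilbert space; [Im_ip] recovers the imaginary part by
    rotating the second argument by i. *)
Definition rdot (u v : H) : R := complex.Re (ip u v).

Lemma rnormE v : `|v| = (rnorm v)%:C.
Proof. exact: normH_realE. Qed.

Lemma rnorm_ge0 v : 0 <= rnorm v.
Proof. by rewrite -ler0c -rnormE normr_ge0. Qed.

Lemma rnorm_le v (k : R) : (`|v| <= k%:C) = (rnorm v <= k).
Proof. by rewrite rnormE lecR. Qed.

Lemma rnorm_lt v (k : R) : (`|v| < k%:C) = (rnorm v < k).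
Proof. by rewrite rnormE ltcR. Qed.

Lemma rnormZ (a : R[i]) v : rnorm (a *: v) = complex.Re `|a| * rnorm v.
Proof. by apply: complexI; rewrite rmorphM /= -!rnormE -normC_realE normrZ. Qed.

Lemma rnormZr (a : R) v : rnorm (a%:C *: v) = `|a| * rnorm v.
Proof. by rewrite rnormZ normc_real. Qed.

Lemma rnorm0 : rnorm 0 = 0.
Proof. by rewrite /rnorm normr0. Qed.

Lemma rnormN v : rnorm (- v) = rnorm v.
Proof. by rewrite /rnorm normrN. Qed.

Lemma rnorm_eq0 v : rnorm v = 0 -> v = 0.
Proof. by move=> v0; apply/eqP; rewrite -normr_eq0 rnormE v0. Qed.

Lemma rdotC u v : rdot u v = rdot v u.
Proof. by rewrite /rdot hermC /= mul1r; case: (ip v u). Qed.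

Lemma rdotDl u v w : rdot (u + v) w = rdot u w + rdot v w.
Proof. by rewrite /rdot linearDl /= raddfD. Qed.

Lemma rdotZl (a : R) u w : rdot (a%:C *: u) w = a * rdot u w.
Proof. by rewrite /rdot linearZl_LR /=; case: (ip u w) => x y /=; rewrite mul0r subr0. Qed.

Lemma rdotDr u v w : rdot u (v + w) = rdot u v + rdot u w.
Proof. by rewrite rdotC rdotDl ![rdot _ u]rdotC. Qed.

Lemma rdotZr (a : R) u w : rdot u (a%:C *: w) = a * rdot u w.
Proof. by rewrite rdotC rdotZl rdotC. Qed.

Lemma rdotNl u w : rdot (- u) w = - rdot u w.
Proof. by rewrite -scaleN1r -(rmorphN1 (real_complex R)) rdotZl mulN1r. Qed.

Lemma rdotNr u w : rdot u (- w) = - rdot u w.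
Proof. by rewrite rdotC rdotNl rdotC. Qed.

Lemma rdotBl u v w : rdot (u - v) w = rdot u w - rdot v w.
Proof. by rewrite rdotDl rdotNl. Qed.

Lemma rnorm2 v : rnorm v ^+ 2 = rdot v v.
Proof. by apply: complexI; rewrite rmorphXn /= -rnormE hip /rdot -hip rnormE -rmorphXn. Qed.

Lemma rnormD2 u v : rnorm (u + v) ^+ 2 = rnorm u ^+ 2 + rdot u v *+ 2 + rnorm v ^+ 2.
Proof. by rewrite !rnorm2 !rdotDl !rdotDr [rdot v u]rdotC; ring. Qed.

Lemma quad_discr (a x k : R) : 0 <= k ->
  (forall s, 0 <= a + s * x *+ 2 + s ^+ 2 * k) -> x ^+ 2 <= a * k.
Proof.
move=> k0 h; have a0 : 0 <= a by have := h 0; rewrite !mul0r expr0n /= mul0r; lra.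
move: k0; rewrite le_eqVlt => /orP[/eqP k0|k0].
  rewrite -k0 mulr0; have [->|x0] := eqVneq x 0; first by rewrite expr0n.
  (* For k = 0 the polynomial is affine in s and takes the value -1 here. *)
  have := h (- (a + 1) / (2 * x)); rewrite -k0 mulr0 addr0.
  have -> : - (a + 1) / (2 * x) * x *+ 2 = - (a + 1) by field.
  lra.
(* The minimizer of the quadratic, where its value is (a k - x^2) / k. *)
have := h (- x / k).
have -> : a + - x / k * x *+ 2 + (- x / k) ^+ 2 * k = (a * k - x ^+ 2) / k.
  by field; rewrite gt_eqF.
by rewrite pmulr_lge0 ?invr_gt0 // subr_ge0.
Qed.

Lemma rdot_CS u v : rdot u v ^+ 2 <= rnorm u ^+ 2 * rnorm v ^+ 2.
Proof.
apply: quad_discr => [|s]; first exact: sqr_ge0.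
have := sqr_ge0 (rnorm (u + s%:C *: v)).
by rewrite rnormD2 rdotZr rnormZr exprMn (real_normK (num_real _)).
Qed.

Lemma rdot_le u v : `|rdot u v| <= rnorm u * rnorm v.
Proof.
rewrite -(@ler_pXn2r _ 2) ?nnegrE ?mulr_ge0 ?rnorm_ge0 //.
by rewrite (real_normK (num_real _)) exprMn rdot_CS.
Qed.

Lemma rnorm_cvgP (T : Type) (F : set_system T) {FF : Filter F} (u : T -> H) (l : H) :
  u @ F --> l <-> forall e : R, 0 < e -> \forall t \near F, rnorm (l - u t) < e.
Proof.
split => [ul e e0|h].
  have e0C : 0 < e%:C by rewrite ltcR.
  by apply: filterS (@cvgr_dist_lt _ H _ F _ u l ul _ e0C) => t; rewrite rnorm_lt.
apply: (@cvgrPdist_lt _ H _ F _ u l).2 => eps eps0.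
have er : eps = (complex.Re eps)%:C by rewrite RRe_real // gtr0_real.
have h0 : 0 < complex.Re eps by move: eps0; rewrite {1}er ltcR.
by apply: filterS (h _ h0) => t; rewrite er rnorm_lt.
Qed.

(* The minimizing filter of w |-> |w|^2 - 2 L w is Cauchy by the parallelogram law,
   and its limit represents L. *)
Lemma riesz (L : H -> R) (M : R) : (forall u v, L (u + v) = L u + L v) ->
  (forall (a : R) u, L (a%:C *: u) = a * L u) -> (forall u, `|L u| <= M * rnorm u) ->
  exists u, forall w, rdot u w = L w.
Proof.
move=> LD LZ LM.
pose J w := rnorm w ^+ 2 - L w *+ 2.
(* Completing the square in |w|^2 - 2 M |w| gives -M^2. *)
have Jlb : lbound (range J) (- M ^+ 2).
  move=> _ [w _ <-]; have := LM w; rewrite ler_norml => /andP[_ h].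
  have := sqr_ge0 (rnorm w - M); rewrite /J; nra.
have hJ : has_inf (range J) by split; [exists (J 0); exists 0|exists (- M ^+ 2)].
pose m := inf (range J).
have mJ w : m <= J w by apply: ge_inf; [case: hJ|exists w].
pose F := filter_from [set eps : R | 0 < eps] (fun eps => [set w | J w < m + eps]).
have Fnear eps : 0 < eps -> F [set w | J w < m + eps] by exists eps.
have FF : ProperFilter F.
  apply: filter_from_proper; first apply: filter_from_filter.
  - by exists 1 => /=.
  - move=> i j /= i0 j0; exists (Num.min i j); first by rewrite /= lt_min i0.
    move=> w /= h; split; apply: lt_le_trans h _; rewrite lerD2l ge_min lexx ?orbT //.
  - move=> i /= i0; have [_ [w _ <-] wi] := inf_adherent i0 hJ.
    by exists w.
(* J at the midpoint is at least [m], so the parallelogram law gives |a - b|^2 / 2 <= J a + J b - 2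
   m. *)
have Jclose a b eps : J a < m + eps -> J b < m + eps -> rnorm (a - b) ^+ 2 < eps *+ 4.
  move=> Ja Jb; have := mJ ((2^-1 : R)%:C *: (a + b)).
  have h1 := rnormD2 a b; have h2 := rnormD2 a (- b); rewrite rnormN rdotNr in h2.
  rewrite /J rnormZr LZ LD exprMn (real_normK (num_real _)) h1 h2.
  by move: Ja Jb; rewrite /J; lra.
have cF : cvg F.
  apply: cauchy_cvg; apply: (@cauchy_exP _ H) => eps eps0.
  have er : eps = (complex.Re eps)%:C by rewrite RRe_real // gtr0_real.
  have d0 : 0 < complex.Re eps by move: eps0; rewrite {1}er ltcR.
  set d := complex.Re eps in er d0.
  have d20 : 0 < d ^+ 2 / 4 by rewrite divr_gt0 // exprn_gt0.
  have [_ [a _ <-] aJ] := inf_adherent d20 hJ.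
  exists a; exists (d ^+ 2 / 4) => // w /= wJ.
  rewrite -ball_normE /= er rnorm_lt.
  rewrite -(@ltr_pXn2r _ 2) ?nnegrE ?rnorm_ge0 ?ltW //.
  by have := Jclose _ _ _ aJ wJ; lra.
(* J(w + s h) >= m for all s bounds a discriminant: an almost minimizing w represents L up to an
   explicit error, and only the pairing of w with h has to pass to the limit. *)
have Jvar w h : (rdot w h - L h) ^+ 2 <= (J w - m) * rnorm h ^+ 2.
  apply: quad_discr => [|s]; first exact: sqr_ge0.
  have := mJ (w + s%:C *: h); rewrite /J rnormD2 rdotZr rnormZr exprMn (real_normK (num_real _)) LD LZ.
  by rewrite !mulrnDl mulrBr; lra.
exists (lim F) => h; apply/eqP; rewrite -subr_eq0 -normr_le0; apply/ler_addgt0Pr => eps eps0.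
have K0 : 0 < rnorm h + 1 by have := rnorm_ge0 h; lra.
(* The two errors below are at most d |h| each, together at most [eps]. *)
pose d := eps / (2 * (rnorm h + 1)).
have d0 : 0 < d by rewrite divr_gt0 // mulr_gt0.
have d20 : 0 < d ^+ 2 by rewrite exprn_gt0.
have Fd : F [set w | rnorm (lim F - w) < d].
  have idF : id @ F --> lim F by exact: cF.
  exact: ((rnorm_cvgP id (lim F)).1 idF _ d0).
have [w [/= wd wJ]] := filter_ex (filterI Fd (Fnear _ d20)).
have h1 : `|rdot w h - L h| <= d * rnorm h.
  have dh : 0 <= d * rnorm h by apply: mulr_ge0; [exact: ltW|exact: rnorm_ge0].
  rewrite -(@ler_pXn2r _ 2) ?nnegrE //.
  rewrite (real_normK (num_real _)) exprMn; apply: le_trans (Jvar w h) _.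
  by apply: ler_wpM2r; [exact: sqr_ge0|rewrite lerBlDl ltW].
have h2 : `|rdot (lim F) h - rdot w h| <= d * rnorm h.
  rewrite -rdotBl; apply: le_trans (rdot_le _ _) _.
  by apply: ler_wpM2r; [exact: rnorm_ge0|exact: ltW].
rewrite add0r -(subrKA (rdot w h)); apply: le_trans (ler_normD _ _) _.
apply: le_trans (lerD h2 h1) _.
have -> : eps = d * (rnorm h + 1) + d * (rnorm h + 1).
  by rewrite /d; field; rewrite gt_eqF.
by rewrite lerD // ler_pM2l // lerDl.
Qed.

Lemma Im_ip v w : complex.Im (ip v w) = rdot v ('i%C *: w).
Proof.
rewrite /rdot linearZr_LR /=; case: (ip v w) => x y /=.
by rewrite mul0r sub0r mulN1r opprK.
Qed.

Lemma rdotZC (c : R[i]) v w :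
  rdot (c *: v) w = complex.Re c * rdot v w - complex.Im c * rdot v ('i%C *: w).
Proof. by rewrite -Im_ip /rdot linearZl_LR /=; case: c (ip v w) => a b [x y]. Qed.

Lemma rdot_inj u v : (forall w, rdot u w = rdot v w) -> u = v.
Proof.
move=> uv; apply/eqP; rewrite -subr_eq0; apply/eqP.
by apply: rnorm_eq0; apply/eqP; rewrite -sqrf_eq0 rnorm2 rdotBl uv subrr.
Qed.

Lemma rdot_cvg (T : Type) (F : set_system T) {FF : Filter F} (u : T -> H) (l w : H) :
  u @ F --> l -> (fun t => rdot (u t) w) @ F --> rdot l w.
Proof.
move=> /rnorm_cvgP ul; apply/cvgrPdist_lt => eps eps0.
have K0 : 0 < rnorm w + 1 by have := rnorm_ge0 w; lra.
apply: filterS (ul (eps / (rnorm w + 1)) (divr_gt0 eps0 K0)) => t h.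
rewrite -rdotBl; apply: le_lt_trans (rdot_le _ _) _.
apply: le_lt_trans (_ : rnorm (l - u t) * (rnorm w + 1) < eps).
  by apply: ler_wpM2l; [exact: rnorm_ge0|lra].
by rewrite -ltr_pdivlMr.
Qed.

(* A curve with a weak derivative that is norm continuous at 0 has a strong
   derivative at 0: test the mean value theorem against the error term. *)
Lemma weak_derivative_strong (A B : R -> H) (d : R) : 0 < d ->
  (forall s w, `|s| < d ->
    h^-1 *: (rdot (A (s + h)) w - rdot (A s) w) @[h --> (0 : R)^'] --> rdot (B s) w) ->
  B @ (0 : R) --> B 0 ->
  dquot (fun s : R^o => A s : realify H) 0 1 t @[t --> 0^'] --> (B 0 : realify H).
Proof.
move=> d0 dA cB; apply/(rnorm_cvgP (F := (0 : R)^')) => eps eps0.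
have /rnorm_cvgP/(_ _ eps0) := cB; rewrite -nbhs_ballE /= => -[d' /= d'0 hB].
have n0 : \forall t \near (0 : R)^', t != 0 by exact: nbhs_dnbhs_neq.
have nd : \forall t \near (0 : R)^', `|t| < Num.min d d'.
  apply: cvg_within; rewrite /= -nbhs_ballE; exists (Num.min d d') => /=.
    by rewrite lt_min d0.
  by move=> t; rewrite -ball_normE /= sub0r normrN.
near=> t; have t0 : t != 0 by near: t.
have : `|t| < Num.min d d' by near: t.
rewrite lt_min => /andP[td td'].
(* The error is its own test vector: the increment of [c] over [0, 1] is |w|^2, while c' has
   absolute value below eps |w|. *)
pose w := t^-1%:C *: (A t - A 0) - B 0.
have -> : dquot (fun s : R^o => A s : realify H) 0 1 t = t^-1%:C *: (A t - A 0) :> H.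
  by rewrite /dquot add0r [t *: (1 : R^o)]mulr1.
rewrite -rnormN opprB -/w.
have [->|w0] := eqVneq w 0; first by rewrite rnorm0.
have nw0 : 0 < rnorm w by rewrite -ltcR -rnormE normr_gt0.
pose W : set R^o := [set x | `|x| < eps * rnorm w].
pose c (s : R) : R^o := t^-1 * rdot (A (s * t)) w - s * rdot (B 0) w.
have bnd s : 0 <= s <= 1 -> `|s * t| <= `|t|.
  by move=> /andP[s0 s1]; rewrite normrM ger0_norm // ler_piMl.
have : W (c 1 - c 0).
  apply: (mean_value (c' := fun s => rdot (B (s * t) - B 0) w : R^o)).
  - rewrite (_ : W = ball (0 : R^o) (eps * rnorm w)); first exact: ball_open.
    by apply/seteqP; split => x; rewrite -ball_normE /W /= sub0r normrN.
  - apply/(convex_setP (E := R^o)) => x y a b a0 b0 ab; rewrite /W /= => Wx Wy.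
    apply: le_lt_trans (ler_normD _ _) _; rewrite !normrM (ger0_norm a0) (ger0_norm b0).
    have [a0'|an0] := eqVneq a 0.
      by move: ab; rewrite a0' add0r => ->; rewrite mul0r add0r mul1r.
    have h1 : a * `|x| < a * (eps * rnorm w) by rewrite ltr_pM2l // lt0r an0.
    have h2 : b * `|y| <= b * (eps * rnorm w) by rewrite ler_wpM2l // ltW.
    by apply: lt_le_trans (ltr_leD h1 h2) _; rewrite -mulrDl ab mul1r.
  - move=> s s01; have st := le_lt_trans (bnd s s01) td.
    have h1 := cvg_comp _ _ (cvg_mulr_dnbhs0 t0) (dA _ w st).
    rewrite rdotBl.
    have h2 : (fun=> rdot (B 0) w) @ (0 : R)^' --> rdot (B 0) w by exact: cvg_cst.
    pose D r := (r * t)^-1 * (rdot (A (s * t + r * t)) w - rdot (A (s * t)) w) - rdot (B 0) w.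
    apply: (@cvg_trans _ (D @ (0 : R)^')); last exact: (cvgB h1 h2).
    apply: near_eq_cvg; near=> r; have r0 : r != 0 by near: r; exact: nbhs_dnbhs_neq.
    rewrite /D /c /= mulrDl /GRing.scale /=; field.
    by rewrite ?r0 ?t0.
  - move=> s s01; have st := le_lt_trans (bnd s s01) td'.
    rewrite /W /=; apply: le_lt_trans (rdot_le _ _) _; rewrite ltr_pM2r //.
    rewrite -rnormN opprB; apply: hB; rewrite -ball_normE /= sub0r normrN //.
rewrite /W /= /c !mul1r !mul0r subr0.
have -> : t^-1 * rdot (A t) w - rdot (B 0) w - t^-1 * rdot (A 0) w = rnorm w ^+ 2.
  rewrite rnorm2 (_ : rdot w w = rdot (t^-1%:C *: (A t - A 0) - B 0) w) //.
  by rewrite rdotBl rdotZl rdotBl mulrBr addrAC.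
by rewrite ger0_norm ?sqr_ge0 // expr2 ltr_pM2r.
Unshelve. all: by end_near. Qed.

Notation mu := (@lebesgue_measure R).

(** Testing against i w turns imaginary parts into real parts, so the real scalar products determine
    the complex weak integral. *)
Lemma weak_integralP (F : R -> H) (u : H) : is_weak_integral ip F u <->
  forall w, mu.-integrable setT (fun t => (rdot (F t) w)%:E) /\
    rdot u w = \int[mu]_(t in setT) rdot (F t) w.
Proof.
split => [h w|h w].
  by have [[h1 _] h2] := h w; split => //; rewrite /rdot h2.
have [h1 h2] := h w; have [h3 h4] := h ('i%C *: w).
split; first by split => //; under eq_fun do rewrite Im_ip.
rewrite /c_integral; under [X in _ +i* X]eq_Rintegral do rewrite Im_ip.
rewrite -h4 -h2 -Im_ip /rdot; by case: (ip u w).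
Qed.

Lemma weak_integral_ub (F : R -> H) (k : R -> R) :
  (forall w, measurable_fun setT (fun t => rdot (F t) w)) ->
  mu.-integrable setT (EFin \o k) -> (forall t, rnorm (F t) <= k t) ->
  exists2 u, is_weak_integral ip F u & rnorm u <= \int[mu]_(t in setT) k t.
Proof.
move=> mF ik Fk.
have k0 t : 0 <= k t by apply: le_trans (Fk t); exact: rnorm_ge0.
have iF w : mu.-integrable setT (EFin \o (fun t => rdot (F t) w)).
  apply: (@le_integrable _ _ _ mu setT measurableT _ (fun t => ((rnorm w)%:E * (k t)%:E)%E)).
  - by apply/measurable_EFinP; exact: mF.
  - move=> t _ /=; rewrite lee_fin (@ger0_norm _ (rnorm w * k t)) ?mulr_ge0 ?rnorm_ge0 //.
    apply: le_trans (rdot_le _ _) _; rewrite mulrC.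
    by apply: ler_wpM2l; [exact: rnorm_ge0|exact: Fk].
  - exact: integrableZl.
pose L w := \int[mu]_(t in setT) rdot (F t) w.
have LD u v : L (u + v) = L u + L v.
  rewrite /L -RintegralD //; apply: eq_Rintegral => t _; exact: rdotDr.
have LZ (a : R) u : L (a%:C *: u) = a * L u.
  rewrite /L -RintegralZl //; apply: eq_Rintegral => t _; exact: rdotZr.
have LM u : `|L u| <= (\int[mu]_(t in setT) k t) * rnorm u.
  apply: le_trans (le_normr_Rintegral _ (iF u)) _ => //.
  rewrite mulrC -RintegralZl //; apply: le_Rintegral => //.
  - exact: (integrable_abse (iF u)).
  - exact: (integrableZl measurableT (rnorm u) ik).
  - move=> t _ /=; apply: le_trans (rdot_le _ _) _; rewrite mulrC.
    by apply: ler_wpM2l; [exact: rnorm_ge0|exact: Fk].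
have [u hu] := riesz LD LZ LM; exists u; first by apply/weak_integralP => w; split; [exact: iF|exact: hu].
(* Testing against [u] itself gives |u|^2 <= (integral of k) |u|; the case u = 0 is separate. *)
have := LM u; rewrite -hu -rnorm2 ger0_norm ?sqr_ge0 // expr2.
have := rnorm_ge0 u; rewrite le_eqVlt => /orP[/eqP <- _|u0]; last by rewrite ler_pM2r.
exact: Rintegral_ge0.
Qed.

Lemma weak_integral_unique (F : R -> H) u v :
  is_weak_integral ip F u -> is_weak_integral ip F v -> u = v.
Proof.
move=> /weak_integralP hu /weak_integralP hv; apply: rdot_inj => w.
by have [_ ->] := hu w; have [_ ->] := hv w.
Qed.

Lemma weak_integralE (F : R -> H) u : is_weak_integral ip F u -> weak_integral ip F = u.
Proof.
move=> hu; rewrite /weak_integral; case: xgetP => [y -> hy|/(_ u)/(_ hu) //].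
exact: weak_integral_unique hy hu.
Qed.

End hilbert_space.

(** * Bounded multilinear maps along convergent and differentiable curves *)

Section multilinear_calculus.
Local Open Scope complex_scope.
Local Open Scope ring_scope.
Context (R : realType) (V : tvsType R[i]) (H : completeNormedModType R[i]).

Definition bmultilin (n : nat) (J : seq V -> H) := multilin J /\
  exists2 q, cont_seminorm q & exists2 C : R, 0 <= C &
    forall zs, size zs = n -> rnorm (J zs) <= C * \prod_(z <- zs) q z.

Lemma bmultilin_cons n J x : bmultilin n.+1 J -> bmultilin n (fun zs => J (x :: zs)).
Proof.
move=> [mJ [q sq [C C0 CJ]]]; split.
  by move=> pre post a y z; exact: (mJ (x :: pre) post a y z).
exists q => //; exists (C * q x); first by case: sq => _ q0 _ _; rewrite mulr_ge0.
by move=> zs szs; rewrite -mulrA; have := CJ (x :: zs); rewrite big_cons /= szs; exact.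
Qed.

Lemma multilinB (J : seq V -> H) pre post y z : multilin J ->
  J (pre ++ (y - z) :: post) = J (pre ++ y :: post) - J (pre ++ z :: post).
Proof.
move=> mJ; rewrite addrC -scaleN1r -(rmorphN1 (real_complex R)) mJ.
by rewrite rmorphN1 scaleN1r addrC.
Qed.

Fixpoint cvg_seq (T : Type) (F : set_system T) (cs : seq (T -> V)) (ls : seq V) : Prop :=
  match cs, ls with
  | c :: cs', l :: ls' => c @ F --> l /\ cvg_seq F cs' ls'
  | [::], [::] => True
  | _, _ => False
  end.

Lemma cont_seminorm_cvg (q : V -> R) (T : Type) (F : set_system T) {FF : Filter F}
    (c : T -> V) (l : V) : cont_seminorm q -> c @ F --> l -> (fun t => q (c t)) @ F --> q l.
Proof. by move=> [cq _ _ _] cl; exact: (cvg_comp _ _ cl (cq l)). Qed.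

Lemma cont_seminorm0 (q : V -> R) : cont_seminorm q -> q 0 = 0.
Proof.
move=> [_ _ _ qh]; apply: complexI.
by rewrite -(scale0r (0 : V)) qh normr0 mul0r.
Qed.

Lemma cvg_seq_prod (q : V -> R) (T : Type) (F : set_system T) {FF : Filter F}
    (cs : seq (T -> V)) (ls : seq V) : cont_seminorm q -> cvg_seq F cs ls ->
  (fun t => \prod_(z <- [seq c t | c <- cs]) q z) @ F --> \prod_(z <- ls) q z.
Proof.
move=> sq; elim: cs ls => [|c cs IH] [|l ls] //=.
  by move=> _; rewrite big_nil; exact: cvg_cst.
move=> [cl cls]; rewrite big_cons; under eq_fun do rewrite big_cons.
by apply: cvgM; [exact: cont_seminorm_cvg|exact: IH].
Qed.

Lemma tvsC_cvgB (T : Type) (F : set_system T) {FF : Filter F}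
    (u v : T -> V) (a b : V) :
  u @ F --> a -> v @ F --> b -> (fun t => u t - v t) @ F --> a - b.
Proof.
move=> hu hv; apply: (@cvg_comp _ _ _ (fun t => (u t, v t))
  (fun z : V * V => z.1 - z.2) F (nbhs (a, b)) _ (cvg_pair hu hv)).
exact: (@sub_continuous V (a, b)).
Qed.

(** Changing the first entry by c(t) - l costs at most C q(c(t) - l) times a convergent product, and
    freezing it at [l] lowers the arity. *)
Lemma bmultilin_cvg n J (T : Type) (F : set_system T) {FF : Filter F}
    (cs : seq (T -> V)) (ls : seq V) : bmultilin n J -> size cs = n -> cvg_seq F cs ls ->
  (fun t => J [seq c t | c <- cs]) @ F --> J ls.
Proof.
elim: n J cs ls => [|n IH] J [|c cs] [|l ls] //=; first by move=> *; exact: cvg_cst.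
move=> bJ [scs] [cl cls].
have J2 := IH _ cs ls (bmultilin_cons l bJ) scs cls.
have JE t : J (c t :: [seq c t | c <- cs]) =
    J ((c t - l) :: [seq c t | c <- cs]) + J (l :: [seq c t | c <- cs]).
  by rewrite (@multilinB J [::] _ _ _ bJ.1) /= subrK.
under eq_fun do rewrite JE.
rewrite -[J (l :: ls)]add0r; apply: (@cvgD _ H) => //.
have [mJ [q sq [C C0 CJ]]] := bJ.
have lim0 : (fun t => C * (q (c t - l) * \prod_(z <- [seq c t | c <- cs]) q z)) @ F --> (0 : R).
  have -> : (0 : R) = C * (q (l - l) * \prod_(z <- ls) q z).
    by rewrite subrr (cont_seminorm0 sq) mul0r mulr0.
  apply: cvgM; first exact: cvg_cst.
  apply: cvgM; last exact: cvg_seq_prod.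
  apply: cont_seminorm_cvg => //; apply: tvsC_cvgB => //; exact: cvg_cst.
apply/rnorm_cvgP => eps eps0.
have h := @cvgr0_norm_lt _ _ _ F FF _ lim0 _ eps0.
apply: filterS h => t h; rewrite sub0r rnormN.
apply: le_lt_trans (le_lt_trans (ler_norm _) h).
by have := CJ (c t - l :: [seq c t | c <- cs]); rewrite big_cons /= size_map scs; exact.
Qed.

(** The Leibniz sum, that is, the differential of the multilinear map [J] at [xs] in the direction
    [ks]. *)
Fixpoint dmul (J : seq V -> H) (xs ks : seq V) : H :=
  match xs, ks with
  | x :: xs', k :: ks' => J (k :: xs') + dmul (fun zs => J (x :: zs)) xs' ks'
  | _, _ => 0
  end.

(** Linearity moves the difference quotient of the first entry inside [J], where [bmultilin_cvg]
    applies although the other entries still move; what remains has a frozen first entry. *)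
Lemma bmultilin_derive n J (cs : seq (R -> V)) (xs ks : seq V) :
  bmultilin n J -> size cs = n -> cvg_seq ((0 : R)^') cs xs ->
  cvg_seq ((0 : R)^') [seq (fun t : R => (t^-1)%:C *: (cx.1 t - cx.2)) | cx <- zip cs xs] ks ->
  (fun t => (t^-1)%:C *: (J [seq c t | c <- cs] - J xs)) @ (0 : R)^' --> dmul J xs ks.
Proof.
elim: n J cs xs ks => [|n IH] J [|c cs] [|x xs] [|k ks] //=.
  by move=> _ _ _ _; under eq_fun do rewrite subrr scaler0; exact: cvg_cst.
move=> bJ [scs] [cx cxs] [ck cks].
have J2 := IH _ cs xs ks (bmultilin_cons x bJ) scs cxs cks.
have mJ := bJ.1.
have JE t : (t^-1)%:C *: (J (c t :: [seq c t | c <- cs]) - J (x :: xs)) =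
    J ((t^-1)%:C *: (c t - x) :: [seq c t | c <- cs]) +
    (t^-1)%:C *: (J (x :: [seq c t | c <- cs]) - J (x :: xs)).
  rewrite (@multilinZ _ _ _ J [::]) // (@multilinB J [::]) //= -scalerDr.
  by rewrite addrA subrK.
under eq_fun do rewrite JE.
apply: (@cvgD _ H) => //.
exact: (@bmultilin_cvg n.+1 J R ((0 : R)^') _
  ((fun t : R => (t^-1)%:C *: (c t - x)) :: cs) (k :: xs) bJ (congr1 S scs) (conj ck cxs)).
Qed.

End multilinear_calculus.

(** * Domination of the integrand *)

Section domination.
Local Open Scope complex_scope.
Local Open Scope ring_scope.
Context (R : realType) (V : tvsType R[i]).
Notation mu := (@lebesgue_measure R).

Lemma normc_le_ReIm (z : R[i]) :
  complex.Re `|z| <= `|complex.Re z| + `|complex.Im z|.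
Proof.
case: z => x y; rewrite normc_def /= -[leRHS]ger0_norm ?addr_ge0 // -sqrtr_sqr.
apply: ler_wsqrtr; rewrite sqrrD !real_normK ?num_real // addrAC lerDl.
by rewrite mulrn_wge0 // mulr_ge0.
Qed.

Lemma prod_seminorm_le (p q : V -> R) (g : V -> V) (c : R) zs : 0 <= c ->
  (forall z, 0 <= p z) -> (forall z, 0 <= q z) -> (forall z, p (g z) <= c * q z) ->
  \prod_(z <- zs) p (g z) <= c ^+ size zs * \prod_(z <- zs) q z.
Proof.
move=> c0 p0 q0 pq; elim: zs => [|z zs IH]; first by rewrite !big_nil expr0 mulr1.
rewrite !big_cons exprS mulrACA; apply: ler_pM => //.
by rewrite prodr_ge0.
Qed.

Lemma equicontinuous_domination (alpha : R -> V -> V) (f : R -> R[i]) :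
  equicontinuous_group alpha -> c_integrable f ->
  forall n p, cont_seminorm p -> exists (k : R -> R) (q : V -> R),
    [/\ cont_seminorm q, mu.-integrable setT (EFin \o k),
      forall t, 0 <= k t & forall zs t, size zs = n ->
        complex.Re `|f t| * \prod_(z <- zs) p (alpha (- t) z) <=
        k t * \prod_(z <- zs) q z].
Proof.
move=> ea [iR iI] n p sp; have [q sq pq] := ea p sp.
have [_ p0 _ _] := sp; have [_ q0 _ _] := sq.
exists (fun t => `|complex.Re (f t)| + `|complex.Im (f t)|), q; split => //.
- exact: (integrableD measurableT (integrable_abse iR) (integrable_abse iI)).
move=> zs t _; apply: ler_pM.
- by rewrite -ler0c -normC_realE normr_ge0.
- by rewrite prodr_ge0.
- exact: normc_le_ReIm.
have := @prod_seminorm_le p q (alpha (- t)) 1 zs ler01 p0 q0.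
by rewrite expr1n mul1r; apply => z; rewrite mul1r.
Qed.

(** The weight 1 / (1 + t^2) is the integrable majorant of case (b); by evenness its integral
    reduces to the half-line. *)
Lemma integrable_oneDsqrV : mu.-integrable setT (EFin \o (fun t : R => (oneDsqr t)^-1)).
Proof.
apply/integrableP; split.
  by apply/measurable_EFinP; apply: continuous_measurable_fun; exact: continuous_oneDsqrV.
have abs (t : R) : (`|(EFin \o (fun t : R => (oneDsqr t)^-1%R)) t| = ((oneDsqr t)^-1%R)%:E)%E.
  by rewrite /= ger0_norm // invr_ge0 (le_trans ler01) // oneDsqr_ge1.
under eq_integral do rewrite abs.
rewrite ge0_symfun_integralT.
- by rewrite -set_itvcy integral0y_oneDsqr -EFinM ltry.
- by move=> t; rewrite invr_ge0 (le_trans ler01) // oneDsqr_ge1.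
- exact: continuous_oneDsqrV.
- by move=> t /=; rewrite /oneDsqr sqrrN.
Qed.

(** 1 + x^N is at most 2 for x <= 1 and at most 2 x^N otherwise. *)
Lemma poly_pow_bound (x : R) (N n : nat) : 0 <= x ->
  (1 + x ^+ N) ^+ n <= 2 ^+ n * (1 + x ^+ (N * n)).
Proof.
move=> x0; have xN : 0 <= x ^+ N by rewrite exprn_ge0.
have [x1|x1] := leP x 1.
  have xN1 : x ^+ N <= 1 by rewrite exprn_ile1.
  apply: le_trans (_ : 2 ^+ n <= _).
    by apply: lerXn2r; rewrite ?nnegrE //; lra.
  by rewrite ler_peMr ?exprn_ge0 // lerDl exprn_ge0.
have xN1 : 1 <= x ^+ N by rewrite exprn_ege1 // ltW.
rewrite exprM; apply: le_trans (_ : (2 * x ^+ N) ^+ n <= _).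
  by apply: lerXn2r; rewrite ?nnegrE ?mulr_ge0 //; lra.
by rewrite exprMn ler_wpM2l ?exprn_ge0 // lerDr.
Qed.

Lemma schwartz_decay (f : R -> R[i]) (M : nat) : schwartz f ->
  exists2 C : R, 0 <= C & forall t,
    complex.Re `|f t| * (1 + `|t| ^+ M) <= C * (oneDsqr t)^-1.
Proof.
move=> [_ df].
have bd m : exists C : R, forall t, `|t| ^+ m * complex.Re `|f t| <= C.
  have [C hC] := df m 0%N; exists C => t; have := hC t.
  have -> : c_derive 0 f t = f t by rewrite /c_derive /=; case: (f t).
  by rewrite [`|f t|]normC_realE -rmorphM lecR.
(* The four exponents come from expanding (1 + |t|^M)(1 + t^2). *)
have [C0 h0] := bd 0%N; have [C2 h2] := bd 2%N.
have [C3 h3] := bd M; have [C4 h4] := bd M.+2.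
have key t : complex.Re `|f t| * (1 + `|t| ^+ M) * oneDsqr t <= C0 + C2 + C3 + C4.
  have := h0 t; have := h2 t; have := h3 t; have := h4 t.
  rewrite expr0 mul1r -(addn2 M) exprD real_normK ?num_real // /oneDsqr.
  set a := complex.Re _; set b := `|t| ^+ M; set c := t ^+ 2.
  have -> : a * (1 + b) * (1 + c) = a + c * a + b * a + b * c * a by ring.
  lra.
have n0 t : 0 <= complex.Re `|f t| by rewrite -ler0c -normC_realE normr_ge0.
exists (C0 + C2 + C3 + C4).
  apply: le_trans (key 0); apply: mulr_ge0; last first.
    by rewrite (le_trans ler01) // oneDsqr_ge1.
  by apply: mulr_ge0; rewrite ?n0 ?addr_ge0 ?exprn_ge0.
by move=> t; rewrite ler_pdivlMr ?key // (lt_le_trans ltr01) // oneDsqr_ge1.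
Qed.

Lemma poly_bounded_domination (alpha : R -> V -> V) (f : R -> R[i]) :
  poly_bounded alpha -> schwartz f ->
  forall n p, cont_seminorm p -> exists (k : R -> R) (q : V -> R),
    [/\ cont_seminorm q, mu.-integrable setT (EFin \o k),
      forall t, 0 <= k t & forall zs t, size zs = n ->
        complex.Re `|f t| * \prod_(z <- zs) p (alpha (- t) z) <=
        k t * \prod_(z <- zs) q z].
Proof.
move=> pa sf n p sp; have [N [q sq pq]] := pa p sp.
have [_ p0 _ _] := sp; have [_ q0 _ _] := sq.
(* Each of the n arguments contributes a factor 1 + |t|^N, so the decay has to beat degree N n. *)
have [C C0 hC] := schwartz_decay (N * n) sf.
have o0 (t : R) : 0 <= (oneDsqr t)^-1 by rewrite invr_ge0 (le_trans ler01) // oneDsqr_ge1.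
have c20 : 0 <= 2 ^+ n * C :> R by rewrite mulr_ge0 // exprn_ge0.
exists (fun t => (2 ^+ n * C) * (oneDsqr t)^-1), q; split => //.
- exact: (integrableZl measurableT (2 ^+ n * C) integrable_oneDsqrV).
- by move=> t; rewrite mulr_ge0.
move=> zs t szs.
have t0 : 0 <= 1 + `|t| ^+ N by rewrite addr_ge0 // exprn_ge0.
have n0 : 0 <= complex.Re `|f t| by rewrite -ler0c -normC_realE normr_ge0.
have Q0 : 0 <= \prod_(z <- zs) q z by rewrite prodr_ge0.
have h1 := @prod_seminorm_le p q (alpha (- t)) (1 + `|t| ^+ N) zs t0 p0 q0.
apply: le_trans (ler_wpM2l n0 (h1 _)) _; first by move=> z; rewrite -(normrN t); exact: pq.
rewrite mulrA szs; apply: ler_wpM2r => //.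
apply: le_trans (ler_wpM2l n0 (poly_pow_bound N n (normr_ge0 t))) _.
rewrite mulrCA -[leRHS]mulrA; apply: ler_wpM2l; first by rewrite exprn_ge0.
exact: hC.
Qed.

Lemma schwartz_measurable (f : R -> R[i]) : schwartz f ->
  measurable_fun setT (fun t => complex.Re (f t)) /\
  measurable_fun setT (fun t => complex.Im (f t)).
Proof.
move=> [df _]; split; apply: continuous_measurable_fun => t.
  have [d _] := df 0%N t; apply: differentiable_continuous.
  by apply/derivable1_diffP.
have [_ d] := df 0%N t; apply: differentiable_continuous.
by apply/derivable1_diffP.
Qed.

Lemma c_integrable_measurable (f : R -> R[i]) : c_integrable f ->
  measurable_fun setT (fun t => complex.Re (f t)) /\
  measurable_fun setT (fun t => complex.Im (f t)).
Proof.
by move=> [/integrableP[/measurable_EFinP ? _] /integrableP[/measurable_EFinP ? _]].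
Qed.

End domination.

(** * Smooth vectors *)

Section realify_facts.
Local Open Scope complex_scope.
Local Open Scope ring_scope.
Context (R : realType) (H : normedModType R[i]).

Lemma realify_hausdorff : hausdorff_space (realify H).
Proof. exact: (@norm_hausdorff _ H). Qed.

Lemma scale_realify (r : R) (v : realify H) : r *: v = r%:C *: (v : H) :> H.
Proof. by []. Qed.

Lemma cvg_realify_norm (T : Type) (F : set_system T) {FF : Filter F}
    (u : T -> H) (l : H) : (forall e : R, 0 < e -> \forall t \near F, `|l - u t| < e%:C) ->
  (u : T -> realify H) @ F --> (l : realify H).
Proof.
move=> h; apply: (@cvgrPdist_lt _ H _ F _ u l).2 => eps eps0.
have er : eps = (complex.Re eps)%:C by rewrite RRe_real // gtr0_real.
rewrite er; apply: h; by move: eps0; rewrite {1}er ltcR.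
Qed.

End realify_facts.

Section representation.
Local Open Scope complex_scope.
Local Open Scope ring_scope.
Context (R : realType) (E : tvsType R) (hE : hausdorff_space E) (G : lieGroupType E).
Context (e : E -> G) (he : smooth_exp_map e).
Context (H : completeNormedModType R[i]) (ip : {dot H for Num.conj}).
Context (hip : forall v, `|v| ^+ 2 = ip v v).
Context (pi : G -> H -> H).
Context (hpi : cont_unitary_rep ip (fun g h : G => (g * h)%g) pi).
Notation atlasG := (@atlas R E G).
Notation c1 := (@chart1 R E G).
Let hH := @realify_hausdorff R H.

Lemma unitary_isom (u : H -> H) : unitary_op ip u -> forall v, `|u v| = `|v|.
Proof.
move=> [_ _ iu] v; apply/eqP; rewrite -(@eqrXn2 _ 2)//; apply/eqP.
by rewrite !hip iu.
Qed.

(** [cont_unitary_rep] states multiplicativity alone: the neutral element acts as an idempotent, and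
    a surjective idempotent is the identity. *)
Lemma unitary_idem (u : H -> H) : unitary_op ip u -> (forall v, u (u v) = u v) ->
  forall v, u v = v.
Proof. by move=> [_ su _] uu v; have [w <-] := su v; rewrite uu. Qed.

Lemma rep_isom g v : `|pi g v| = `|v|.
Proof. by case: hpi => hu _ _; exact: unitary_isom. Qed.

Lemma rep_lin g : linear (pi g).
Proof. by case: hpi => /(_ g) []. Qed.

Lemma rep_D g u v : pi g (u + v) = pi g u + pi g v.
Proof. by have := rep_lin g 1 u v; rewrite !scale1r. Qed.

Lemma rep_0 g : pi g 0 = 0.
Proof. by apply: (@addrI _ (pi g 0)); rewrite -rep_D !addr0. Qed.

Lemma rep_Z g c v : pi g (c *: v) = c *: pi g v.
Proof. by have := rep_lin g c v 0; rewrite !addr0 rep_0 addr0. Qed.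

Lemma rep_B g u v : pi g (u - v) = pi g u - pi g v.
Proof. by rewrite rep_D -scaleN1r rep_Z scaleN1r. Qed.

Lemma rep_M g h v : pi (g * h)%g v = pi g (pi h v).
Proof. by case: hpi. Qed.

Lemma rep_1 v : pi 1%g v = v.
Proof.
case: hpi => hu hm _; apply: unitary_idem => // w.
by rewrite -rep_M mul1g.
Qed.

(** Joint continuity from strong continuity: pi(g)(z - z0) has the norm of z - z0, uniformly in
    g. *)
Lemma rep_cvg (T : Type) (F : set_system T) {FF : Filter F} (g : T -> G) (z : T -> H) g0 z0 :
  g @ F --> g0 -> z @ F --> z0 -> (fun t => pi (g t) (z t)) @ F --> pi g0 z0.
Proof.
move=> hg hz; rewrite -[pi g0 z0]add0r.
have -> : (fun t => pi (g t) (z t)) = (fun t => pi (g t) (z t - z0) + pi (g t) z0).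
  by apply/funext => t; rewrite -rep_D subrK.
apply: (@cvgD _ H).
  apply/norm_cvg0P; under eq_fun do rewrite rep_isom; apply/norm_cvg0P.
  by rewrite -(subrr z0); apply: (@cvgB _ H) => //; exact: cvg_cst.
apply: (@cvg_comp _ _ _ g (fun g => pi g z0) F _ _ hg).
by case: hpi => _ _; apply.
Qed.

Lemma rep_realify g : linear (pi g : realify H -> realify H) /\
  continuous (pi g : realify H -> realify H).
Proof.
split; first by move=> r u v; exact: rep_lin.
move=> v; apply: (@rep_cvg _ (nbhs v) _ (fun=> g) id g v); first exact: cvg_cst.
exact: cvg_id.
Qed.

Lemma rep_realifyZ g (r : R) (v : realify H) :
  pi g (r *: v) = r *: (pi g v : realify H) :> realify H.
Proof. exact: rep_Z. Qed.

Lemma smooth_into_cst (P : tvsType R) (O : set P) (g : G) : smooth_into atlasG O (fun=> g).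
Proof. by split => [p _|c Ac k]; [exact: cvg_cst|exact: Ck_cst]. Qed.

(* Smooth families of smooth vectors, tested against arbitrary smooth maps into G
   so that the notion is stable under differentiation of the representation. *)
Definition smooth_family (P : tvsType R) (w : P -> H) :=
  forall (Q : tvsType R) (O : set Q) (psi : Q -> G) (rho : Q -> P),
    hausdorff_space Q -> open O -> smooth_into atlasG O psi -> smooth_on O rho ->
    smooth_on O (fun q => pi (psi q) (w (rho q)) : realify H).

Lemma smooth_family_cst (P : tvsType R) (v : H) : smooth_vector pi v ->
  smooth_family (fun _ : P => v).
Proof.
move=> sv Q O psi rho hQ oO spsi _.
apply/smooth_into_id; apply: (smooth_into_comp hE hH hQ _ _ _ oO sv spsi).
- exact: atlas_chart.
- exact: atlas_cover.
- by move=> _ ->; exact: is_chart_id.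
Qed.

Lemma smooth_family_vector (P : tvsType R) (hP : hausdorff_space P) (w : P -> H) p :
  smooth_family w -> smooth_vector pi (w p).
Proof.
move=> sw; split; first by case: hpi => _ _; exact.
move=> c _ Ac ->; rewrite /= preimage_setT setIT.
have [oc oic _ _ _] := @atlas_chart R E G _ Ac.
apply: (sw E _ (cinv c) (fun=> p)) => //; first exact: smooth_into_cinv.
by move=> k; exact: Ck_cst.
Qed.

Lemma smooth_family_continuous (P : tvsType R) (hP : hausdorff_space P) (w : P -> H) :
  smooth_family w -> continuous w.
Proof.
move=> sw p.
have := sw P setT (fun=> 1%g) id hP openT (smooth_into_cst _ _) _ 0%N p I.
rewrite (_ : (fun q => _) = w :> (P -> H)); last by apply/funext => q; rewrite rep_1.
by apply => k; exact: Ck_id.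
Qed.

Lemma smooth_family_comp (P P' : tvsType R) (hP : hausdorff_space P)
    (hP' : hausdorff_space P') (theta : P' -> P) (w : P -> H) :
  smooth_on setT theta -> smooth_family w -> smooth_family (w \o theta).
Proof.
move=> st sw Q O psi rho hQ oO spsi srho; apply: (sw Q O psi (theta \o rho)) => // k.
by apply: (Ck_comp hP' hP hQ (V := setT)) => //; exact: openT.
Qed.

Lemma smooth_family_lin (P : tvsType R) (w1 w2 : P -> H) (c : R[i]) :
  smooth_family w1 -> smooth_family w2 -> smooth_family (fun p => w1 p + c *: w2 p).
Proof.
move=> s1 s2 Q O psi rho hQ oO spsi srho k.
rewrite [X in Ck _ _ X](_ : _ = fun q : Q => (pi (psi q) (w1 (rho q)) : realify H) +
   (c *: (pi (psi q) (w2 (rho q))) : H) : realify H); last first.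
  by apply/funext => q; rewrite rep_D rep_Z.
apply: CkD => //; first exact: s1.
apply: (Ck_comp_lin hH hH hQ (f := fun q => pi (psi q) (w2 (rho q)) : realify H)
  (L := fun v : realify H => (c *: (v : H)) : realify H)) => //.
- by move=> a u v /=; rewrite !scale_realify scalerDr !scalerA mulrC.
- move=> v; exact: (@cvgZ R[i] H _ (nbhs (v : H)) _ (fun=> c) id _ _ (cvg_cst _) cvg_id).
- exact: s2.
Qed.

Lemma smooth_vectorD u v c : smooth_vector pi u -> smooth_vector pi v ->
  smooth_vector pi (u + c *: v).
Proof.
move=> su sv; apply: (@smooth_family_vector E hE (fun=> u + c *: v) 0).
by apply: (@smooth_family_lin E (fun=> u) (fun=> v)); exact: smooth_family_cst.
Qed.

(** [ddiff] is 0 where no limit exists, so the limit is first obtained from the smoothness of [v]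
    along t |-> g exp(t x). The factor g is kept because derivatives are later taken at arbitrary
    points of G. *)
Lemma dpi_realP g x v : smooth_vector pi v ->
  dquot (fun t : R^o => pi (g * e (t *: x))%g v : realify H) 0 1 t @[t --> 0^'] -->
    (pi g (dpi_real e pi x v) : realify H).
Proof.
move=> sv; have hR : hausdorff_space R^o by exact: norm_hausdorff.
have lim g' : exists l : realify H,
   dquot (fun t : R^o => pi (g' * e (t *: x))%g v : realify H) 0 1 t @[t --> 0^'] --> l.
  have S : smooth_on setT (fun t : R^o => pi (g' * e (t *: x))%g v : realify H).
    apply: (@smooth_family_cst E v sv R^o setT _ (fun=> 0) hR openT).
      apply: smooth_into_mul => //; [exact: openT|exact: smooth_into_cst|].
      apply: (smooth_into_exp hE hR (theta := fun t : R^o => t *: x) he openT) => k.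
      by apply: CkZ => //; [exact: openT|exact: Ck_id|exact: Ck_cst].
    by move=> k; exact: Ck_cst.
  by have [_ d _] := S 1%N; apply: d.
have := lim 1%g => /ddiff_cvg h1.
have [_ cg] := rep_realify g.
apply: cvg_trans; last apply: (@cvg_comp _ _ _ _ (pi g : realify H -> realify H) _ _ _ h1).
  apply: near_eq_cvg; near=> t.
  rewrite /dquot /= rep_realifyZ rep_B -!rep_M !mul1g.
  by [].
rewrite (_ : dpi_real e pi x v = ddiff (fun t : R^o => pi (1 * e (t *: x))%g v : realify H) 0 1).
  exact: cg.
have -> // : (fun t : R^o => pi (1 * e (t *: x))%g v) = (fun t => pi (e (t *: x)) v).
by apply/funext => t; rewrite mul1g.
Unshelve. all: by end_near. Qed.

Lemma smooth_vector_chart1 (u : H) : smooth_vector pi u ->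
  smooth_on (cfun c1 @` cdom c1) (fun y => pi (cinv c1 y) u : realify H).
Proof.
move=> su; have Ac1 := @chart1_atlas R E G.
have [oc oic ck cc cic] := @atlas_chart R E G _ Ac1.
apply: (@smooth_family_cst E u su E _ (cinv c1) (fun=> 0)) => //; first exact: smooth_into_cinv.
by move=> k; exact: Ck_cst.
Qed.

Lemma exp_0 : e 0 = 1%g.
Proof.
case: he => _ /(_ 0 0 0) + _; rewrite addr0 scale0r => e00.
by apply: (@mulgI G (e 0)); rewrite mulg1 -e00.
Qed.

Lemma mulg_cvg (T : Type) (F : set_system T) {FF : Filter F} (f g : T -> G) (a b : G) :
  f @ F --> a -> g @ F --> b -> (fun t => (f t * g t)%g) @ F --> (a * b)%g.
Proof.
move=> fa gb; apply: (@cvg_comp _ _ _ (fun t => (f t, g t))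
  (fun z : G * G => (z.1 * z.2)%g) F (nbhs (a, b)) _ (cvg_pair fa gb)).
by case: (@mulg_smooth R E G) => /(_ (a, b)).
Qed.

(** Reading the orbit map in [chart1] leaves only the velocity of [f] at [s1], so exp(s x) can be
    exchanged for any curve with the same velocity. *)
Lemma rep_derive_chart1 (u : H) (f : R -> G) (s1 : R) (y : E) :
  smooth_vector pi u -> {for s1, continuous f} -> f s1 = 1%g ->
  dquot (fun s : R^o => cfun c1 (f s)) s1 1 t @[t --> 0^'] --> y ->
  dquot (fun s : R^o => pi (f s) u : realify H) s1 1 t @[t --> 0^'] -->
    ddiff (fun y => pi (cinv c1 y) u : realify H) (cfun c1 1%g) y.
Proof.
move=> su cf f1 hy.
have Ac1 := @chart1_atlas R E G; have [oc oic ck _ _] := @atlas_chart R E G _ Ac1.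
have c11 := @chart1_dom R E G.
have imc : (cfun c1 @` cdom c1) (cfun c1 (f s1)) by rewrite f1; exists 1%g.
have := dquot_comp oic (smooth_vector_chart1 su 1%N) imc hy; rewrite f1.
apply: cvg_trans; apply: near_eq_cvg.
have nf : \forall t \near (0 : R)^', cdom c1 (f (s1 + t *: (1 : R^o))).
  have := @tvs_line R R^o s1 1 (f @^-1` cdom c1).
  apply; apply: cf; rewrite f1; exact: open_nbhs_nbhs.
near=> t; rewrite /dquot /= ck; last by near: t.
by rewrite ck // f1.
Unshelve. all: by end_near. Qed.

(** Defined through one-parameter groups, dpi(x) shows no linearity in x; as the differential of the
    orbit map at 1 it is linear. *)
Lemma dpi_realE (x : E) (u : H) : smooth_vector pi u ->
  dpi_real e pi x u = ddiff (fun y => pi (cinv c1 y) u : realify H) (cfun c1 1%g) x.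
Proof.
move=> su; case: (he) => [[ce _] _ ve].
rewrite /dpi_real; apply: (@ddiff_eq R R^o (realify H) hH).
apply: rep_derive_chart1 => //.
  apply: continuous_comp; last exact: ce.
  by apply: (@tvs_cvgZ R E _ (nbhs (0 : R)) _ id (fun=> x)); [exact: cvg_id|exact: cvg_cst].
by rewrite scale0r exp_0.
Qed.

(** Translation by g0^-1 moves the base point to 1, and pi(g0) translates the derivative back. *)
Lemma rep_derive (u : H) (g0 : G) (psi : R -> G) (s0 : R) (x : E) :
  smooth_vector pi u -> {for s0, continuous psi} -> psi s0 = g0 ->
  dquot (fun s : R^o => cfun c1 (g0^-1 * psi s)%g) s0 1 t @[t --> 0^'] --> x ->
  dquot (fun s : R^o => pi (psi s) u : realify H) s0 1 t @[t --> 0^'] -->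
    (pi g0 (dpi_real e pi x u) : realify H).
Proof.
move=> su cpsi psi0 hx; have [_ cg] := rep_realify g0.
have H1 : dquot (fun s : R^o => pi (g0^-1 * psi s)%g u : realify H) s0 1 t @[t --> 0^'] -->
    ddiff (fun y => pi (cinv c1 y) u : realify H) (cfun c1 1%g) x.
  apply: rep_derive_chart1 => //; last by rewrite psi0 mulVg.
  by apply: mulg_cvg => //; exact: cvg_cst.
rewrite dpi_realE //; apply: cvg_trans; last apply: (@cvg_comp _ _ _ _ (pi g0 : realify H -> realify H) _ _ _ H1).
  apply: near_eq_cvg; near=> t.
  by rewrite /dquot /= rep_realifyZ rep_B -!rep_M !mulgA !mulgV !mul1g.
exact: cg.
Unshelve. all: by end_near. Qed.

Lemma rep_derive_line (P : tvsType R) (hP : hausdorff_space P) (O : set P) (psi : P -> G)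
    p q u : open O -> smooth_into atlasG O psi -> O p -> smooth_vector pi u ->
  dquot (fun p' => pi (psi p') u : realify H) p q t @[t --> 0^'] -->
    (pi (psi p) (dpi_real e pi (dlog psi (p, q)) u) : realify H).
Proof.
move=> oO spsi Op su.
have dqE (F : tvsType R) (f : P -> F) (t : R) :
    dquot (fun s : R^o => f (p + s *: q)) 0 1 t = dquot f p q t.
  by rewrite /dquot scale0r addr0 add0r [t *: (1 : R^o)]mulr1.
have cl : {for (0 : R), continuous (fun s : R => psi (p + s *: q))}.
  apply: continuous_comp; last by rewrite scale0r addr0; exact: spsi.1.
  apply: (@tvs_cvgD R P _ (nbhs (0 : R)) _ (fun=> p)); first exact: cvg_cst.
  by apply: (@tvs_cvgZ R P _ (nbhs (0 : R)) _ id (fun=> q)); [exact: cvg_id|exact: cvg_cst].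
have H1 := @rep_derive u (psi p) (fun s : R => psi (p + s *: q)) 0 (dlog psi (p, q)) su cl.
rewrite scale0r addr0 in H1.
have -> : dquot (fun p' => pi (psi p') u : realify H) p q =
    dquot (fun s : R^o => pi (psi (p + s *: q)) u : realify H) 0 1.
  by apply/funext => t; rewrite -(dqE (realify H) (fun p' => pi (psi p') u)).
apply: H1 => //.
have -> : dquot (fun s : R^o => cfun c1 ((psi p)^-1 * psi (p + s *: q))%g) 0 1 =
    dquot (fun p' => cfun c1 ((psi p)^-1 * psi p')%g) p q.
  by apply/funext => t; rewrite -(dqE E (fun p' => cfun c1 ((psi p)^-1 * psi p')%g)).
exact: (dlog_derive hE hP oO spsi Op).
Qed.

Lemma dpi_real_lin (a : R) (x y : E) (u : H) : smooth_vector pi u ->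
  dpi_real e pi (a *: x + y) u = a%:C *: dpi_real e pi x u + dpi_real e pi y u.
Proof.
move=> su; rewrite !dpi_realE //.
have s1 := smooth_vector_chart1 su 1%N.
have [_ oic _ _ _] := @atlas_chart R E G _ (@chart1_atlas R E G).
have i1 : (cfun c1 @` cdom c1) (cfun c1 1%g) by exists 1%g => //; exact: chart1_dom.
by rewrite (ddiffD hH _ _ oic s1 i1) ddiffZ //; case: s1 => _ d _; exact: d.
Qed.

Lemma dpi_real_linr (x : E) (u v : H) (c : R[i]) : smooth_vector pi u -> smooth_vector pi v ->
  dpi_real e pi x (u + c *: v) = dpi_real e pi x u + c *: dpi_real e pi x v.
Proof.
move=> su sv; rewrite -[LHS]rep_1.
have huv := dpi_realP (g := 1%g) (x := x) (smooth_vectorD c su sv).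
apply: (cvg_unique hH huv).
rewrite -[dpi_real e pi x u]rep_1 -[dpi_real e pi x v]rep_1.
pose D (w : H) (t : R) : H :=
  dquot (fun t : R^o => pi (1 * e (t *: x))%g w : realify H) 0 1 t.
have hu : (D u : R -> realify H) @ (0 : R)^' --> (pi 1%g (dpi_real e pi x u) : realify H).
  exact: dpi_realP.
have hv : D v @ (0 : R)^' --> pi 1%g (dpi_real e pi x v) by exact: dpi_realP.
have hcv : ((fun t => c *: D v t) : R -> realify H) @ (0 : R)^' -->
    (c *: pi 1%g (dpi_real e pi x v) : realify H).
  by apply: (@cvgZ R[i] H _ ((0 : R)^') _ (fun=> c)) => //; exact: cvg_cst.
apply: cvg_trans; last exact: (tvs_cvgD hu hcv).
apply: near_eq_cvg; near=> t.
rewrite /D /dquot.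
have rs (r : R) (w : realify H) : r *: w = (r%:C *: (w : H) : H) by [].
rewrite !rs !rep_D !rep_Z !scalerBr !scalerDr !opprD !scalerA [c * _]mulrC.
by rewrite addrACA.
Unshelve. all: by end_near. Qed.

Lemma dpi_lin (a : R) (y z : complexification E) (u : H) : smooth_vector pi u ->
  dpi e pi (a%:C *: y + z) u = a%:C *: dpi e pi y u + dpi e pi z u.
Proof.
move=> su; rewrite /dpi /= !scale0r subr0 addr0 !dpi_real_lin // !scalerDr.
by rewrite addrACA !scalerA [a%:C * _]mulrC.
Qed.

Lemma dpi_linr (z : complexification E) (u v : H) (c : R[i]) :
  smooth_vector pi u -> smooth_vector pi v ->
  dpi e pi z (u + c *: v) = dpi e pi z u + c *: dpi e pi z v.
Proof.
move=> su sv; rewrite /dpi !dpi_real_linr // !scalerDr.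
by rewrite addrACA !scalerA ['i * _]mulrC.
Qed.

(** With s as an additional parameter, pi(psi) dpi(x) w(p) is the partial derivative at s = 0 of the
    smooth map pi(psi exp(s x)) w(p), used at order k + 1. *)
Lemma smooth_family_dpi_real (P : tvsType R) (hP : hausdorff_space P) (w : P -> H) :
  smooth_family w -> smooth_family (fun xp : E * P => dpi_real e pi xp.1 (w xp.2)).
Proof.
move=> sw Q O psi rho hQ oO spsi srho k.
have hR : hausdorff_space R^o by exact: norm_hausdorff.
have hQR := hausdorff_prod hQ hR; have hEP := hausdorff_prod hE hP.
pose O' := [set qs : Q * R^o | O qs.1].
have oO' : open O' by exact: open_fstset.
have sr1 : smooth_on O' (fun qs => (rho qs.1).1).
  move=> j; apply: (Ck_comp hQ hE hQR (V := O) (f := fst) (g := fun q => (rho q).1)) => //.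
    exact: Ck_fst.
  apply: (Ck_comp_lin hEP hE hQ (f := rho) (L := fst)) => //.
  by move=> x; exact: cvg_fst.
have sr2 : smooth_on O' (fun qs => (rho qs.1).2).
  move=> j; apply: (Ck_comp hQ hP hQR (V := O) (f := fst) (g := fun q => (rho q).2)) => //.
    exact: Ck_fst.
  apply: (Ck_comp_lin hEP hP hQ (f := rho) (L := snd)) => //.
  by move=> x; exact: cvg_snd.
pose F2 (qs : Q * R^o) : realify H :=
  pi (psi qs.1 * e (qs.2 *: (rho qs.1).1))%g (w (rho qs.1).2).
have sF2 : smooth_on O' F2.
  apply: (sw (Q * R^o)%type O' (fun qs => psi qs.1 * e (qs.2 *: (rho qs.1).1))%g) => //.
  apply: smooth_into_mul => //.
    apply: (smooth_into_precomp hE hQ hQR (@atlas_chart R E G) oO oO' _ spsi (theta := fst)) => //.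
    by move=> j; exact: Ck_fst.
  apply: (smooth_into_exp hE hQR (theta := fun qs : Q * R^o => qs.2 *: (rho qs.1).1)) => // j.
  by apply: CkZ => //; exact: Ck_snd.
have [_ _ ddF] := sF2 k.+1.
apply: (Ck_eq (f := (fun zh => ddiff F2 zh.1 zh.2) \o
  (fun q : Q => ((q, (0 : R^o)), ((0 : Q), (1 : R^o)))))) => //.
  move=> q Oq /=; apply: (ddiff_eq hH).
  have sv := smooth_family_vector hP (rho q).2 sw.
  apply: cvg_trans (dpi_realP (g := psi q) (x := (rho q).1) sv).
  apply: near_eq_cvg; near=> t.
  by rewrite /dquot /F2 /= !scaler0 !addr0.
apply: (Ck_comp (hausdorff_prod hQR hQR) hH hQ (V := [set zh | O' zh.1])) ddF => //.
  exact: open_fstset.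
by apply: Ck_pair => //; [apply: Ck_pair => //; [exact: Ck_id|exact: Ck_cst]|exact: Ck_cst].
Unshelve. all: by end_near. Qed.

(** The differential calculus is real, so the parameter ranges over E * E, which has the topology of
    the complexification. *)
Lemma smooth_family_dpi (P : tvsType R) (hP : hausdorff_space P) (w : P -> H) :
  smooth_family w ->
  smooth_family (fun zp : (E * E) * P => dpi e pi (zp.1 : complexification E) (w zp.2)).
Proof.
move=> sw; have hEE := hausdorff_prod hE hE; have hEP := hausdorff_prod hE hP.
have hEEP := hausdorff_prod hEE hP.
have sd := smooth_family_dpi_real hP sw.
apply: smooth_family_lin.
- apply: (smooth_family_comp hEP hEEP (theta := fun zp => (zp.1.1, zp.2)) _ sd) => k.
  apply: Ck_pair => //; [exact: openT| |exact: Ck_snd].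
  apply: (Ck_comp_lin hEE hE hEEP (L := fst)) => //; [exact: openT| |exact: Ck_fst].
  by move=> x; exact: cvg_fst.
- apply: (smooth_family_comp hEP hEEP (theta := fun zp => (zp.1.2, zp.2)) _ sd) => k.
  apply: Ck_pair => //; [exact: openT| |exact: Ck_snd].
  apply: (Ck_comp_lin hEE hE hEEP (L := snd)) => //; [exact: openT| |exact: Ck_fst].
  by move=> x; exact: cvg_snd.
Qed.

Lemma smooth_vector_dpi z v : smooth_vector pi v -> smooth_vector pi (dpi e pi z v).
Proof.
move=> sv; have hEE := hausdorff_prod hE hE.
have := smooth_family_dpi hE (smooth_family_cst (P := E) sv).
by move=> /(smooth_family_vector (hausdorff_prod hEE hE) (z, 0)).
Qed.

Lemma smooth_vector_dpi_seq zs v : smooth_vector pi v -> smooth_vector pi (dpi_seq e pi zs v).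
Proof. by move=> sv; elim: zs => //= z zs; exact: smooth_vector_dpi. Qed.

Lemma dpi_seq_lin (zs : seq (complexification E)) (u v : H) (c : R[i]) :
  smooth_vector pi u -> smooth_vector pi v ->
  dpi_seq e pi zs (u + c *: v) = dpi_seq e pi zs u + c *: dpi_seq e pi zs v.
Proof.
move=> su sv; elim: zs => //= z zs ->.
by apply: dpi_linr; exact: smooth_vector_dpi_seq.
Qed.

Lemma dpi_seq_cat xs ys v : dpi_seq e pi (xs ++ ys) v = dpi_seq e pi xs (dpi_seq e pi ys v).
Proof. exact: foldr_cat. Qed.

Lemma dpi_seq_multilin v : smooth_vector pi v -> multilin (dpi_seq e pi ^~ v).
Proof.
move=> sv pre post a y z; rewrite !dpi_seq_cat /=.
have sp := smooth_vector_dpi_seq post sv.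
(* [dpi_seq_lin] has its scalar on the second summand, hence the swaps. *)
by rewrite dpi_lin // addrC dpi_seq_lin 1?addrC //; exact: smooth_vector_dpi.
Qed.

(** Induction over all families at once: the operator nearest to the vector is absorbed into the
    family (z, p) |-> dpi(z) w(p), taken at the base point (0, p0). For n = 0 the bound is
    continuity of the family. *)
Lemma dpi_seq_locally_bounded n (P : tvsType R) (hP : hausdorff_space P) (w : P -> H) (p0 : P) :
  smooth_family w -> exists (C : R) (W : set (complexification E)) (N : set P),
  [/\ nbhs (0 : complexification E) W, nbhs p0 N & forall zs p, size zs = n -> (forall z, z \in zs -> W z) ->
    N p -> `|dpi_seq e pi zs (w p)| <= C%:C].
Proof.
elim: n P hP w p0 => [|n IH] P hP w p0 sw.
  have cw := @smooth_family_continuous _ hP _ sw p0.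
  exists (complex.Re (`|w p0| + 1)), setT, [set p | `|w p| <= `|w p0| + 1]; split.
  - exact: filterT.
  - apply: filterS (@cvgr_dist_lt _ H _ (nbhs p0) _ w (w p0) cw 1 ltr01) => p /= h.
    rewrite -lerBlDl (le_trans (lerB_dist _ _)) //.
    by rewrite distrC ltW.
  - move=> zs p /size0nil -> _ /= h.
    by rewrite RRe_real // realD // ?realE ?ler01 // normr_ge0.
have hEE := hausdorff_prod hE hE; have hEEP := hausdorff_prod hEE hP.
have [C [W [N [nW nN CWN]]]] := IH _ hEEP _ ((0 : E * E), p0) (smooth_family_dpi hP sw).
case: nN => -[W' N'] /= [nW' nN'] WN'.
exists C, (W `&` W'), N'; split => //; first exact: filterI.
move=> zs p; case/lastP: zs => // zs z; rewrite size_rcons => -[sz] zW Np.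
have -> : dpi_seq e pi (rcons zs z) (w p) = dpi_seq e pi zs (dpi e pi z (w p)).
  by rewrite -cats1 dpi_seq_cat.
apply: (CWN zs (z, p)) => //.
  by move=> y yz; have [] := zW y; rewrite ?mem_rcons ?inE ?yz ?orbT.
by apply: WN'; split => //=; have [] := zW z; rewrite ?mem_rcons ?inE ?eqxx.
Qed.

Lemma rep_adjoint g v w : rdot ip (pi g v) w = rdot ip v (pi g^-1%g w).
Proof.
have wE : pi g (pi g^-1%g w) = w by rewrite -rep_M mulgV rep_1.
by case: hpi => /(_ g)[_ _ ig] _ _; rewrite -{1}wE /rdot ig.
Qed.

(** The derivative is a limit of quotients along s = 1/(n + 1); the adjoint moves exp(s x) to the
    test vector, so each quotient is measurable by hypothesis. *)
Lemma measurable_dpi_real (v : R -> H) (x : E) :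
  (forall t, smooth_vector pi (v t)) ->
  (forall w, measurable_fun setT (fun t => rdot ip (v t) w)) ->
  forall w, measurable_fun setT (fun t => rdot ip (dpi_real e pi x (v t)) w).
Proof.
move=> sv mv w.
apply: (@measurable_fun_cvg _ _ _ setT (fun n t => (@harmonic R n)^-1 *
  (rdot ip (v t) (pi (e (@harmonic R n *: x))^-1%g w) - rdot ip (v t) w))).
  move=> n; apply: measurable_funM; first exact: measurable_cst.
  by apply: measurable_funB; exact: mv.
move=> t _.
have h1 : (fun s => rdot ip (dquot (fun r : R^o => pi (1 * e (r *: x))%g (v t) : realify H)
    0 1 s) w) @ (0 : R)^' --> rdot ip (pi 1%g (dpi_real e pi x (v t))) w.
  by apply: (rdot_cvg hip); exact: dpi_realP.
rewrite rep_1 in h1.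
have := (cvgr_dnbhsP _ _ _).1 h1 (@harmonic R).
rewrite (_ : (fun n => rdot ip _ w) = (fun n => (@harmonic R n)^-1 *
  (rdot ip (v t) (pi (e (@harmonic R n *: x))^-1%g w) - rdot ip (v t) w))).
  apply; split; last exact: cvg_harmonic.
  by move=> n; rewrite /harmonic invr_eq0 pnatr_eq0.
apply/funext => n; rewrite /dquot scale0r exp_0 mulg1 rep_1 add0r mul1g.
rewrite [_ *: (1 : R^o)]mulr1 -rep_adjoint -rdotBl.
by rewrite -(rdotZl ip).
Qed.

Lemma measurable_dpi_seq (v : R -> H) zs :
  (forall t, smooth_vector pi (v t)) ->
  (forall w, measurable_fun setT (fun t => rdot ip (v t) w)) ->
  forall w, measurable_fun setT (fun t => rdot ip (dpi_seq e pi zs (v t)) w).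
Proof.
move=> sv mv; elim: zs => [|z zs IH] w; first exact: mv.
have sd t : smooth_vector pi (dpi_seq e pi zs (v t)) by exact: smooth_vector_dpi_seq.
rewrite (_ : (fun t => _) = (fun t => rdot ip (dpi_real e pi z.1 (dpi_seq e pi zs (v t))) w -
  rdot ip (dpi_real e pi z.2 (dpi_seq e pi zs (v t))) ('i%C *: w))).
  by apply: measurable_funB; apply: measurable_dpi_real.
by apply/funext => t; rewrite /= /dpi rdotDl rdotZC // -complexiE /= mul0r sub0r mul1r.
Qed.

Definition emb (x : E) : complexification E := (x, 0).

Lemma emb_cvg (T : Type) (F : set_system T) {FF : Filter F} (c : T -> E) (l : E) :
  c @ F --> l -> (fun t => emb (c t)) @ F --> emb l.
Proof. by move=> cl; apply: cvg_pair => //; exact: cvg_cst. Qed.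

Lemma dpi_emb x v : smooth_vector pi v -> dpi e pi (emb x) v = dpi_real e pi x v.
Proof.
move=> sv; rewrite /dpi /=.
have -> : dpi_real e pi 0 v = 0.
  have := dpi_real_lin (-1) 0 0 sv; rewrite scaler0 addr0 rmorphN1 scaleN1r.
  by rewrite addNr.
by rewrite scaler0 addr0.
Qed.

(** * Multilinear families whose orbit derivative prepends the logarithmic derivative *)

Section covariant_multilinear.

Fixpoint all_smooth (P : tvsType R) (O : set P) (ths : seq (P -> E)) : Prop :=
  if ths is th :: ths' then smooth_on O th /\ all_smooth O ths' else True.

Lemma all_smooth_cat (P : tvsType R) (O : set P) (s1 s2 : seq (P -> E)) :
  all_smooth O s1 -> all_smooth O s2 -> all_smooth O (s1 ++ s2).
Proof. by elim: s1 => //= th s1 IH [? ?] ?; split => //; exact: IH. Qed.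

Lemma all_smooth_fst (P : tvsType R) (hP : hausdorff_space P) (O : set P)
    (ths : seq (P -> E)) : open O -> all_smooth O ths ->
  all_smooth [set pq : P * P | O pq.1] [seq th \o fst | th <- ths].
Proof.
move=> oO; elim: ths => //= th ths IH [sth sths]; split; last exact: IH.
move=> k; apply: (Ck_comp hP hE (hausdorff_prod hP hP) (V := O) (f := fst)) => //.
- exact: open_fstset.
- exact: Ck_fst.
Qed.

Definition embs (P : tvsType R) (ths : seq (P -> E)) (p : P) : seq (complexification E) :=
  [seq emb (th p) | th <- ths].

Lemma embs_fst (P : tvsType R) (ths : seq (P -> E)) (pq : P * P) :
  embs [seq th \o fst | th <- ths] pq = embs ths pq.1.
Proof. by rewrite /embs -map_comp. Qed.

Context (J : seq (complexification E) -> H) (bJ : forall n, bmultilin n J).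
Context (dJ : forall (P : tvsType R), hausdorff_space P ->
  forall (O : set P) (psi : P -> G) p q zs, open O -> smooth_into atlasG O psi -> O p ->
  dquot (fun p' => pi (psi p') (J zs) : realify H) p q t @[t --> 0^'] -->
    (pi (psi p) (J (emb (dlog psi (p, q)) :: zs)) : realify H)).

Lemma rep_multilin_continuous (P : tvsType R) (hP : hausdorff_space P) (O : set P)
    (psi : P -> G) (ths : seq (P -> E)) p : smooth_into atlasG O psi -> all_smooth O ths -> O p ->
  {for p, continuous (fun p => pi (psi p) (J (embs ths p)) : realify H)}.
Proof.
move=> spsi sths Op.
have cz : cvg_seq (nbhs p) [seq (fun p => emb (th p)) | th <- ths] (embs ths p).
  elim: ths sths => //= th ths IH [sth sths]; split; last exact: IH.
  by apply: emb_cvg; exact: (sth 0%N).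
have sz : size [seq (fun p => emb (th p)) | th <- ths] = size ths by rewrite size_map.
have cc := @bmultilin_cvg _ _ _ _ _ P (nbhs p) (nbhs_filter p) _ _
  (bJ (size ths)) sz cz.
have cc' : (fun p => J (embs ths p)) @ p --> J (embs ths p).
  have <- : (fun p : P => J [seq c p | c <- [seq (fun p => emb (th p)) | th <- ths]]) =
      (fun p => J (embs ths p)).
    by apply/funext => p'; rewrite -map_comp.
  exact: cc.
exact: (rep_cvg (spsi.1 p Op) cc').
Qed.

(** Product rule: pi(psi(p + t q)) acts on the quotient of [J], which converges by joint continuity,
    and the quotient of pi(psi) on the fixed vector J(theta(p)) is given by [dJ]. *)
Lemma rep_multilin_derive (P : tvsType R) (hP : hausdorff_space P) (O : set P)
    (psi : P -> G) (ths : seq (P -> E)) p q : open O -> smooth_into atlasG O psi ->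
  all_smooth O ths -> O p ->
  dquot (fun p => pi (psi p) (J (embs ths p)) : realify H) p q t @[t --> 0^'] -->
    (pi (psi p) (J (emb (dlog psi (p, q)) :: embs ths p)) +
     pi (psi p) (dmul J (embs ths p) (embs [seq (fun p => ddiff th p q) | th <- ths] p))
       : realify H).
Proof.
move=> oO spsi sths Op; rewrite addrC.
have cl : (fun s : R => p + s *: q) @ (0 : R)^' --> p by exact: tvs_line.
have cpsi : (fun s : R => psi (p + s *: q)) @ (0 : R)^' --> psi p.
  exact: (cvg_comp _ _ cl (spsi.1 p Op)).
pose cs := [seq (fun t : R => emb (th (p + t *: q))) | th <- ths].
have scs : size cs = size ths by rewrite size_map.
have csE t : [seq c t | c <- cs] = embs ths (p + t *: q) by rewrite -map_comp.
have h1 : cvg_seq ((0 : R)^') cs (embs ths p).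
  rewrite /cs; elim: ths sths {scs csE} @cs => //= th ths IH [sth sths]; split; last exact: IH.
  by apply: emb_cvg; exact: (cvg_comp _ _ cl (sth 0%N p Op)).
have h2 : cvg_seq ((0 : R)^') [seq (fun t : R => (t^-1)%:C *: (cx.1 t - cx.2)) |
    cx <- zip cs (embs ths p)] (embs [seq (fun p => ddiff th p q) | th <- ths] p).
  rewrite /cs; elim: ths sths {scs csE h1} @cs => //= th ths IH [sth sths]; split; last exact: IH.
  have [_ /(_ p q Op) /ddiff_cvg dth _] := sth 1%N.
  apply: cvg_trans; last exact: (emb_cvg dth).
  apply: near_eq_cvg; near=> t.
  by rewrite /dquot /emb; congr pair; rewrite /= !subrr ?scaler0 ?subr0 ?scale0r ?addr0.
have D1 := bmultilin_derive (bJ (size ths)) scs h1 h2.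
have D2 : (fun t => pi (psi (p + t *: q)) ((t^-1)%:C *:
    (J [seq c t | c <- cs] - J (embs ths p)))) @ (0 : R)^' -->
    pi (psi p) (dmul J (embs ths p) (embs [seq (fun p => ddiff th p q) | th <- ths] p)).
  exact: (rep_cvg cpsi D1).
have D3 := @dJ P hP O psi p q (embs ths p) oO spsi Op.
apply: cvg_trans; last exact: (@tvs_cvgD R (realify H) R ((0 : R)^') _ _ _ _ _ D2 D3).
apply: near_eq_cvg; near=> t.
rewrite csE rep_Z rep_B /dquot.
have rs (r : R) (w : realify H) : r *: w = (r%:C *: (w : H) : H) by [].
rewrite !rs -scalerDr; congr (_ *: _).
by rewrite addrA subrK.
Unshelve. all: by end_near. Qed.

(* The derivative is a sum of terms of the same shape over P * P, whence the
   induction on the order of differentiability. *)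
Lemma smooth_rep_multilin k (P : tvsType R) (hP : hausdorff_space P) (O : set P)
    (psi : P -> G) (ths : seq (P -> E)) : open O -> smooth_into atlasG O psi ->
  all_smooth O ths -> Ck k O (fun p => pi (psi p) (J (embs ths p)) : realify H).
Proof.
elim: k P hP O psi ths => [|k IH] P hP O psi ths oO spsi sths.
  by move=> p Op; exact: (rep_multilin_continuous hP spsi).
split.
- by move=> p Op; exact: (rep_multilin_continuous hP spsi).
- by move=> p q Op; eexists; exact: (@rep_multilin_derive P hP O psi ths p q oO spsi sths Op).
have hPP := hausdorff_prod hP hP.
set O1 := [set pq : P * P | O pq.1]; have oO1 : open O1 by exact: open_fstset.
have spsi1 : smooth_into atlasG O1 (psi \o fst).
  apply: (smooth_into_precomp hE hP hPP (@atlas_chart R E G) oO oO1 _ spsi) => //.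
  by move=> j; exact: Ck_fst.
apply: (Ck_eq (f := fun pq : P * P =>
  (pi (psi pq.1) (J (emb (dlog psi pq) :: embs ths pq.1)) : realify H) +
  (pi (psi pq.1) (dmul J (embs ths pq.1)
    (embs [seq (fun pq => ddiff th pq.1 pq.2) | th <- ths] pq)) : realify H))) => //.
  move=> [p q] Op /=; apply/esym/(ddiff_eq hH).
  have := @rep_multilin_derive P hP O psi ths p q oO spsi sths Op.
  by rewrite /embs -!map_comp.
apply: CkD => //.
  have sth1 : all_smooth O1 (dlog psi :: [seq th \o fst | th <- ths]).
    by split; [exact: smooth_dlog|exact: all_smooth_fst].
  apply: Ck_eq (IH _ hPP O1 (psi \o fst) _ oO1 spsi1 sth1) => // pq _.
  by rewrite [embs _ _]/= -embs_fst.
(* The Leibniz sum is split by induction on the list, [pre] collecting the entries already passed.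
   In each summand one entry is replaced by its differential, a smooth map on P * P, so the outer
   induction hypothesis applies. *)
have key pre post : all_smooth O pre -> all_smooth O post ->
  Ck k O1 (fun pq : P * P => pi (psi pq.1) (dmul (fun zs => J (embs pre pq.1 ++ zs))
    (embs post pq.1) (embs [seq (fun pq => ddiff th pq.1 pq.2) | th <- post] pq)) : realify H).
  elim: post pre => [|th post IHp] pre spre /=.
    move=> _; rewrite (_ : (fun pq => _) = fun=> (0 : realify H)); first exact: Ck_cst.
    by apply/funext => pq; rewrite rep_0.
  move=> [sth spost].
  have h2 := IHp (rcons pre th) _ spost.
  rewrite (_ : (fun pq => _) = fun pq =>
    (pi (psi pq.1) (J (embs ([seq th \o fst | th <- pre] ++ (fun pq => ddiff th pq.1 pq.2) ::
       [seq th \o fst | th <- post]) pq)) : realify H) +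
    (pi (psi pq.1) (dmul (fun zs => J (embs (rcons pre th) pq.1 ++ zs))
    (embs post pq.1) (embs [seq (fun pq => ddiff th pq.1 pq.2) | th <- post] pq)) : realify H)).
    apply: CkD => //.
      apply: (IH _ hPP O1 (psi \o fst)) => //.
      apply: all_smooth_cat; first exact: all_smooth_fst.
      split; last exact: all_smooth_fst.
      by move=> j; have [_ _] := sth j.+1.
    by apply: h2; rewrite -cats1; apply: all_smooth_cat.
  apply/funext => pq; rewrite rep_D; congr (_ + _).
    by rewrite /embs map_cat /= -!/(embs _ _) !embs_fst.
  congr (pi _ _); congr (dmul _ _ _).
  by apply/funext => zs; rewrite /embs map_rcons cat_rcons.
by have := key [::] ths I sths.
Qed.

End covariant_multilinear.

(** * Averages of smooth vectors *)

Section averaging.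
Notation mu := (@lebesgue_measure R).
Context (f : R -> R[i]) (u : R -> H) (su : forall t, smooth_vector pi (u t)).
Context (mRef : measurable_fun setT (fun t => complex.Re (f t))).
Context (mImf : measurable_fun setT (fun t => complex.Im (f t))).
Context (mu_u : forall w, measurable_fun setT (fun t => rdot ip (u t) w)).
Context (bnd : forall n, exists (k : R -> R) (q : complexification E -> R),
  [/\ cont_seminorm q, mu.-integrable setT (EFin \o k), forall t, 0 <= k t &
    forall zs t, size zs = n ->
      rnorm (f t *: dpi_seq e pi zs (u t)) <= k t * \prod_(z <- zs) q z]).

Definition avg (zs : seq (complexification E)) : H :=
  weak_integral ip (fun t => f t *: dpi_seq e pi zs (u t)).

Lemma measurable_integrand zs w :
  measurable_fun setT (fun t => rdot ip (f t *: dpi_seq e pi zs (u t)) w).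
Proof.
under eq_fun do rewrite rdotZC //.
by apply: measurable_funB; apply: measurable_funM => //; exact: measurable_dpi_seq.
Qed.

(** [weak_integral] is 0 when no integral exists; the domination [bnd] rules this out. *)
Lemma avgP zs : is_weak_integral ip (fun t => f t *: dpi_seq e pi zs (u t)) (avg zs).
Proof.
have [k [q [sq ik k0 kq]]] := bnd (size zs).
have [|v hv _] := @weak_integral_ub _ _ ip hip _ (fun t => (\prod_(z <- zs) q z) * k t)
  (measurable_integrand zs) (integrableZl measurableT (\prod_(z <- zs) q z) ik) _.
  by move=> t; rewrite mulrC; exact: kq.
by rewrite /avg (weak_integralE hip hv).
Qed.

Lemma avg_integrable zs w :
  mu.-integrable setT (fun t => (rdot ip (f t *: dpi_seq e pi zs (u t)) w)%:E).
Proof. by have /weak_integralP/(_ w)[] := avgP zs. Qed.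

Lemma rdot_avg zs w :
  rdot ip (avg zs) w = \int[mu]_(t in setT) rdot ip (f t *: dpi_seq e pi zs (u t)) w.
Proof. by have /weak_integralP/(_ w)[] := avgP zs. Qed.

Lemma avg_bound n : exists2 q, cont_seminorm q &
  exists2 C : R, 0 <= C & forall zs, size zs = n -> rnorm (avg zs) <= C * \prod_(z <- zs) q z.
Proof.
have [k [q [sq ik k0 kq]]] := bnd n; exists q => //.
exists (\int[mu]_(t in setT) k t); first by apply: Rintegral_ge0.
move=> zs szs.
have [|v hv h] := @weak_integral_ub _ _ ip hip _ (fun t => (\prod_(z <- zs) q z) * k t)
  (measurable_integrand zs) (integrableZl measurableT (\prod_(z <- zs) q z) ik) _.
  by move=> t; rewrite mulrC; exact: kq.
by rewrite /avg (weak_integralE hip hv) mulrC -RintegralZl.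
Qed.

Lemma avg_multilin : multilin avg.
Proof.
move=> pre post a y z; apply: (rdot_inj hip) => w.
rewrite rdotDl rdotZl !rdot_avg -RintegralZl //; last exact: avg_integrable.
rewrite -RintegralD //; last exact: avg_integrable.
  apply: eq_Rintegral => t _; rewrite dpi_seq_multilin // scalerDr rdotDl; congr (_ + _).
  by rewrite scalerA mulrC -scalerA rdotZl.
by have := integrableZl measurableT a (avg_integrable (pre ++ y :: post) w).
Qed.

Lemma avg_bmultilin n : bmultilin n avg.
Proof. by split; [exact: avg_multilin|exact: avg_bound]. Qed.

#[local] Opaque avg.

(* Only scalar integrands are differentiated under the integral sign; norm
   measurability in t of the vector-valued integrand is not available. *)
Lemma rep_avg_weak_derivative (P : tvsType R) (hP : hausdorff_space P) (O : set P)
    (psi : P -> G) p q zs (d b0 : R) (k : R -> R) (qq : complexification E -> R) : open O -> smooth_into atlasG O psi ->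
  (forall s : R, `|s| < d -> O (p + s *: q)) ->
  [/\ cont_seminorm qq, mu.-integrable setT (EFin \o k), forall t, 0 <= k t &
    forall xs t, size xs = (size zs).+1 ->
      rnorm (f t *: dpi_seq e pi xs (u t)) <= k t * \prod_(z <- xs) qq z] ->
  (forall s : R, `|s| < d -> qq (emb (dlog psi (p + s *: q, q))) <= b0) -> 0 <= b0 ->
  forall (s : R) w, `|s| < d ->
  h^-1 *: (rdot ip (pi (psi (p + (s + h) *: q)) (avg zs)) w -
           rdot ip (pi (psi (p + s *: q)) (avg zs)) w) @[h --> (0 : R)^'] -->
  rdot ip (pi (psi (p + s *: q)) (avg (emb (dlog psi (p + s *: q, q)) :: zs))) w.
Proof.
move=> oO spsi Od [sq ik k0 kq] hb b00 s w sd.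
pose F zs t := f t *: dpi_seq e pi zs (u t).
pose kk (s : R) := dlog psi (p + s *: q, q).
pose h (s t : R) : R := rdot ip (pi (psi (p + s *: q)) (F zs t)) w.
have itvP (r : R) : r \in `]-d, d[ -> `|r| < d by rewrite in_itv /= ltr_norml.
(* The adjoint moves pi(psi) to the test vector, which leaves one of the integrals defining
   [avg]. *)
have hI r : \int[mu]_(t in setT) h r t = rdot ip (pi (psi (p + r *: q)) (avg zs)) w.
  rewrite rep_adjoint rdot_avg; apply: eq_Rintegral => t _.
  by rewrite /h rep_adjoint.
have dh r t : `|r| < d ->
    (a^-1 *: (h (r + a) t - h r t)) @[a --> (0 : R)^'] -->
      rdot ip (pi (psi (p + r *: q)) (F (emb (kk r) :: zs) t)) w.
  move=> rd.
  have sv := smooth_vector_dpi_seq zs (su t).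
  have D := rep_derive_line (q := q) hP oO spsi (Od r rd) sv.
  pose dq a : H := dquot (fun p' => pi (psi p') (dpi_seq e pi zs (u t)) : realify H) (p + r *: q) q a.
  have D2 : (fun a => f t *: dq a) @ (0 : R)^' -->
      f t *: pi (psi (p + r *: q)) (dpi_real e pi (kk r) (dpi_seq e pi zs (u t))).
    by apply: (@cvgZ R[i] H _ ((0 : R)^') _ (fun=> f t)); [exact: cvg_cst|exact: D].
  rewrite /F /= dpi_emb // rep_Z.
  have D3 : (fun a => rdot ip (f t *: dq a) w) @ (0 : R)^' --> rdot ip (f t *:
      pi (psi (p + r *: q)) (dpi_real e pi (kk r) (dpi_seq e pi zs (u t)))) w.
    exact: rdot_cvg.
  apply: cvg_trans; last exact: D3.
  apply: near_eq_cvg; near=> a.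
  rewrite -[RHS]/(a^-1 * (h (r + a) t - h r t)) /h /F !rep_Z -rdotBl -scalerBr -(rdotZl ip).
  by rewrite /dq /dquot -addrA -scalerDl scalerA mulrC -scalerA.
have qb1 : exists G0 : R -> R, [/\ forall t, 0 <= G0 t, mu.-integrable setT (EFin \o G0) &
    forall r t, `|r| < d ->
      `|rdot ip (pi (psi (p + r *: q)) (F (emb (kk r) :: zs) t)) w| <= G0 t].
  have [_ q0 _ _] := sq.
  (* From Cauchy-Schwarz and isometry of pi; [b0] replaces the seminorm of the moving logarithmic
     derivative, which makes the bound uniform in r. *)
  pose C0 := b0 * \prod_(z <- zs) qq z * rnorm w.
  have C00 : 0 <= C0 by rewrite !mulr_ge0 ?prodr_ge0 ?rnorm_ge0.
  exists (fun t => C0 * k t); split.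
  - by move=> t; rewrite mulr_ge0.
  - exact: (integrableZl measurableT C0 ik).
  - move=> r t rd; apply: le_trans (rdot_le hip _ _) _.
    have -> : rnorm (pi (psi (p + r *: q)) (F (emb (kk r) :: zs) t)) = rnorm (F (emb (kk r) :: zs) t).
      by rewrite /rnorm rep_isom.
    apply: le_trans (_ : k t * (b0 * \prod_(z <- zs) qq z) * rnorm w <= _); last first.
      by rewrite /C0 mulrC [C0 * k t]mulrC; rewrite mulrC -mulrA.
    apply: ler_wpM2r; first exact: rnorm_ge0.
    apply: le_trans (kq (emb (kk r) :: zs) t erefl) _.
    rewrite big_cons; apply: ler_wpM2l => //; apply: ler_wpM2r; first by rewrite prodr_ge0.
    exact: hb.
have [G0 [G00 iG hG]] := qb1.
have sI : [set` `](- d), d[%R] s by rewrite /= in_itv /= -ltr_norml.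
have der (r t : R) : `|r| < d -> is_derive r 1 (h ^~ t)
    (rdot ip (pi (psi (p + r *: q)) (F (emb (kk r) :: zs) t)) w).
  move=> rd; have dl := dh r t rd.
  have dl' : (a^-1 *: ((h^~ t \o shift r) (a *: 1) - h r t)) @[a --> (0 : R)^'] -->
      rdot ip (pi (psi (p + r *: q)) (F (emb (kk r) :: zs) t)) w.
    apply: cvg_trans dl; apply: near_eq_cvg; near=> a.
    by rewrite /= [a *: (1 : R^o)]mulr1 [a + r]addrC.
  by apply: DeriveDef; [apply/cvg_ex; eexists; exact: dl'|apply/cvg_lim => //; exact: dl'].
have intf (r : R) : [set` `](- d), d[%R] r -> mu.-integrable setT (EFin \o h r).
  move=> _; rewrite /h (_ : EFin \o _ = fun t => (rdot ip (f t *: dpi_seq e pi zs (u t))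
    (pi (psi (p + r *: q))^-1%g w))%:E); first exact: avg_integrable.
  by apply/funext => t /=; rewrite rep_adjoint.
have derf (r t : R) : [set` `](- d), d[%R] r -> setT t -> derivable (h ^~ t : R^o -> R^o) r 1.
  by move=> /itvP rd _; exact: (@ex_derive _ _ _ _ _ _ _ (der r t rd)).
have dE (r t : R) : `|r| < d -> partial1of2 h r t =
    rdot ip (pi (psi (p + r *: q)) (F (emb (kk r) :: zs) t)) w.
  by move=> rd; rewrite partial1of2E (@derive_val _ _ _ _ _ _ _ (der r t rd)).
have gub (r t : R) : [set` `](- d), d[%R] r -> setT t -> `|partial1of2 h r t| <= G0 t.
  by move=> /itvP rd _; rewrite dE //; exact: hG.
have := @cvg_differentiation_under_integral R _ _ mu h setT measurableT s (- d) d sI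
  intf derf G0 G00 iG gub.
have -> : \int[mu]_(t in setT) partial1of2 h s t =
    rdot ip (pi (psi (p + s *: q)) (avg (emb (kk s) :: zs))) w.
  rewrite rep_adjoint rdot_avg; apply: eq_Rintegral => t _.
  by rewrite dE // rep_adjoint.
apply: cvg_trans; apply: near_eq_cvg; near=> a.
by rewrite !hI [a + s]addrC.
Unshelve. all: by end_near. Qed.

Lemma avg_derive (P : tvsType R) (hP : hausdorff_space P) (O : set P) (psi : P -> G)
    p q zs : open O -> smooth_into atlasG O psi -> O p ->
  dquot (fun p' => pi (psi p') (avg zs) : realify H) p q t @[t --> 0^'] -->
    (pi (psi p) (avg (emb (dlog psi (p, q)) :: zs)) : realify H).
Proof.
move=> oO spsi Op.
have cl : (fun s : R => p + s *: q) @ (0 : R) --> p.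
  rewrite -[X in _ --> X]addr0 -[X in _ + X](scale0r q).
  apply: (@tvs_cvgD R P _ (nbhs (0 : R)) _ (fun=> p)); first exact: cvg_cst.
  by apply: (@tvs_cvgZ R P _ (nbhs (0 : R)) _ id (fun=> q)); [exact: cvg_id|exact: cvg_cst].
have cpsi : (fun s : R => psi (p + s *: q)) @ (0 : R) --> psi p.
  exact: (cvg_comp _ _ cl (spsi.1 p Op)).
have ck : (fun s : R => emb (dlog psi (p + s *: q, q))) @ (0 : R) --> emb (dlog psi (p, q)).
  apply: emb_cvg.
  have := smooth_dlog hE hP oO spsi 0%N (p, q) Op.
  by apply: cvg_comp; apply: cvg_pair => //; exact: cvg_cst.
have [k [qq hk]] := bnd (size zs).+1; have [sq _ _ _] := hk.
have [_ q0 _ _] := sq.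
(* A bound strictly above the value at s = 0 persists near 0 by continuity of the logarithmic
   derivative; this and [nO] fix the radius [d]. *)
pose b0 := qq (emb (dlog psi (p, q))) + 1.
have b00 : 0 <= b0 by rewrite /b0; have := q0 (emb (dlog psi (p, q))); lra.
have nq : \forall s \near (0 : R), qq (emb (dlog psi (p + s *: q, q))) < b0.
  have cs : (fun s : R => qq (emb (dlog psi (p + s *: q, q)))) @ (0 : R) -->
      qq (emb (dlog psi (p, q))) by exact: (cont_seminorm_cvg sq ck).
  apply: filterS (@cvgr_dist_lt _ R^o _ (nbhs (0 : R)) _ _ _ cs 1 ltr01) => s /=.
  by rewrite ltr_norml /b0 => /andP[]; lra.
have nO : \forall s \near (0 : R), O (p + s *: q) by exact: cl (open_nbhs_nbhs (conj oO Op)).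
have := filterI nq nO; rewrite -nbhs_ballE => -[d /= d0 dqO].
have hd s : `|s| < d -> qq (emb (dlog psi (p + s *: q, q))) < b0 /\ O (p + s *: q).
  by move=> sd; apply: dqO; rewrite -ball_normE /= sub0r normrN.
pose B s := pi (psi (p + s *: q)) (avg (emb (dlog psi (p + s *: q, q)) :: zs)).
have B0 : B 0 = pi (psi p) (avg (emb (dlog psi (p, q)) :: zs)).
  by rewrite /B scale0r addr0.
have cA : (fun s : R => avg (emb (dlog psi (p + s *: q, q)) :: zs)) @ (0 : R) -->
    avg (emb (dlog psi (p, q)) :: zs).
  have cz : cvg_seq (nbhs (0 : R)) ((fun s => emb (dlog psi (p + s *: q, q))) ::
      [seq (fun=> z) | z <- zs]) (emb (dlog psi (p, q)) :: zs).
    by split; [exact: ck|elim: zs {hk B B0} => //= z zs IH; split => //; exact: cvg_cst].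
  have sz : size ((fun s : R => emb (dlog psi (p + s *: q, q))) ::
      [seq (fun=> z) | z <- zs]) = (size zs).+1 by rewrite /= size_map.
  have idE (s : R) : [seq c s | c <- [seq (fun=> z) | z <- zs]] = zs.
    by rewrite -map_comp map_id.
  have cc := @bmultilin_cvg _ _ _ _ _ R (nbhs (0 : R)) (nbhs_filter (0 : R)) _ _
    (avg_bmultilin (size zs).+1) sz cz.
  have <- : (fun t : R => avg [seq c t | c <- (fun s : R => emb (dlog psi (p + s *: q, q))) ::
      [seq (fun=> z) | z <- zs]]) = (fun s => avg (emb (dlog psi (p + s *: q, q)) :: zs)).
    by apply/funext => s; rewrite /= idE.
  exact: cc.
have cB : B @ (0 : R) --> B 0 by rewrite B0; exact: (rep_cvg cpsi cA).
have := weak_derivative_strong hip d0 _ cB.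
rewrite B0 => /(_ (fun s => pi (psi (p + s *: q)) (avg zs))) H1.
have -> : dquot (fun p' => pi (psi p') (avg zs) : realify H) p q =
    dquot (fun s : R^o => pi (psi (p + s *: q)) (avg zs) : realify H) 0 1.
  by apply/funext => t; rewrite /dquot scale0r addr0 add0r [t *: (1 : R^o)]mulr1.
apply: H1 => s w sd.
have Od (r : R) : `|r| < d -> O (p + r *: q) by move=> /hd[].
have qb (r : R) : `|r| < d -> qq (emb (dlog psi (p + r *: q, q))) <= b0.
  by move=> /hd[/ltW].
exact: (rep_avg_weak_derivative hP oO spsi Od hk qb b00 sd).
Qed.

Lemma dpi_avg z zs : dpi e pi z (avg zs) = avg (z :: zs).
Proof.
have hR : hausdorff_space R^o by exact: norm_hausdorff.
have real x : dpi_real e pi x (avg zs) = avg (emb x :: zs).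
  have st : smooth_on setT (fun t : R^o => t *: x).
    by move=> k; apply: CkZ => //; [exact: openT|exact: Ck_id|exact: Ck_cst].
  have sm := smooth_into_exp hE hR he openT st.
  rewrite /dpi_real; apply: (@ddiff_eq R R^o (realify H) hH).
  have D := @avg_derive R^o hR setT _ 0 1 zs openT sm I.
  rewrite /= scale0r exp_0 rep_1 in D; apply: cvg_trans D _.
  (* The curve s |-> exp(s x) has velocity x at 0 in [chart1], hence logarithmic derivative x
     there. *)
  rewrite (_ : dlog _ _ = x) //; rewrite /dlog /= scale0r exp_0; apply: (ddiff_eq hE).
  case: he => _ _ /(_ x); apply: cvg_trans; apply: near_eq_cvg; near=> t.
  by rewrite /dquot /= invg1 !mul1g.
(* [avg_multilin] covers real scalars, so the factor i of the second component is moved to the test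
   vector and the sum is formed under the integral. *)
rewrite /dpi !real.
have rpi v w : rdot ip ('i *: v) w = - rdot ip v ('i *: w).
  by rewrite rdotZC // -complexiE /= mul0r sub0r mul1r.
apply: (rdot_inj hip) => w.
rewrite rdotDl rpi.
apply: etrans (congr2 (fun a b => a - b) (rdot_avg (emb z.1 :: zs) w)
  (rdot_avg (emb z.2 :: zs) ('i *: w))) _.
apply: etrans _ (esym (rdot_avg (z :: zs) w)).
rewrite -(RintegralB measurableT (avg_integrable (emb z.1 :: zs) w)
  (avg_integrable (emb z.2 :: zs) ('i *: w))).
apply: eq_Rintegral => t _ /=.
have sv := smooth_vector_dpi_seq zs (su t).
rewrite !dpi_emb // [in RHS]/dpi scalerDr rdotDl; congr (_ + _).
by rewrite scalerA mulrC -scalerA rpi.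
Unshelve. all: by end_near. Qed.

Lemma dpi_seq_avg zs : dpi_seq e pi zs (avg [::]) = avg zs.
Proof. by elim: zs => //= z zs ->; exact: dpi_avg. Qed.

(** The empty list in [smooth_rep_multilin], along inverse charts; longer lists appear only in the
    derivatives. *)
Lemma smooth_vector_avg : smooth_vector pi (avg [::]).
Proof.
split; first by case: hpi => _ _; exact.
move=> c _ Ac ->; rewrite /= preimage_setT setIT => k.
have [oc oic _ _ _] := @atlas_chart R E G _ Ac.
exact: (smooth_rep_multilin avg_bmultilin avg_derive k hE (ths := [::]) oic (smooth_into_cinv Ac)).
Qed.

End averaging.

(** * The one-parameter group U *)

Section covariance.
Context (gamma : R -> G -> G) (hgamma_aut : forall t, lie_aut (gamma t)).
Context (hgamma_add : forall s t g, gamma (s + t) g = gamma s (gamma t g)).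
Context (U : R -> H -> H).
Context (hU : cont_unitary_rep ip (fun s t : R => s + t) U).
Context (hpiU : cont_unitary_rep ip (sdmul gamma) (fun a v => pi a.1 (U a.2 v))).

Lemma U_0 v : U 0 v = v.
Proof. by case: hU => hu hm _; apply: unitary_idem => // w; rewrite -hm addr0. Qed.

Lemma U_isom t v : `|U t v| = `|v|.
Proof. by case: hU => hu _ _; exact: unitary_isom. Qed.

Lemma U_lin t : linear (U t).
Proof. by case: hU => /(_ t) []. Qed.

Lemma U_D t u v : U t (u + v) = U t u + U t v.
Proof. by have := U_lin t 1 u v; rewrite !scale1r. Qed.

Lemma U_Z t c v : U t (c *: v) = c *: U t v.
Proof.
have := U_lin t c v 0.
have -> : U t 0 = 0 by apply: (@addrI _ (U t 0)); rewrite -U_D !addr0.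
by rewrite !addr0.
Qed.

Lemma U_realify t : linear (U t : realify H -> realify H) /\
  continuous (U t : realify H -> realify H).
Proof.
split; first by move=> r u v; exact: U_lin.
move=> v; apply: cvg_realify_norm => eps eps0.
have eps0C : 0 < eps%:C by rewrite ltcR.
apply: filterS (@cvgr_dist_lt _ H _ (nbhs (v : H)) _ id v cvg_id _ eps0C) => w h.
by rewrite -scaleN1r -U_Z -U_D scaleN1r U_isom.
Qed.

Lemma gamma_0 g : gamma 0 g = g.
Proof.
have [_ _ [psi [gK _ _]]] := hgamma_aut 0.
by rewrite -[LHS]gK -hgamma_add addr0 gK.
Qed.

Lemma gamma_1 t : gamma t 1%g = 1%g.
Proof.
have [gM _ _] := hgamma_aut t.
by apply: (@mulgI G (gamma t 1%g)); rewrite -gM !mulg1.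
Qed.

(** Read off from (1, t)(gamma_{-t} g, 0) = (g, t) in the semidirect product. *)
Lemma rep_U t g v : pi g (U t v) = U t (pi (gamma (- t) g) v).
Proof.
case: hpiU => _ /(_ (1%g, t) (gamma (- t) g, 0) v) /= + _.
by rewrite mul1g -hgamma_add subrr gamma_0 addr0 U_0 rep_1.
Qed.

(** By [rep_U] the orbit map of U_t u is that of u, preceded by the smooth automorphism gamma_{-t}
    and followed by the continuous linear U_t. *)
Lemma smooth_vector_U t u : smooth_vector pi u -> smooth_vector pi (U t u).
Proof.
move=> su; split; first by case: hpi => _ _; exact.
move=> c _ Ac ->; rewrite /= preimage_setT setIT => k.
have [oc oic _ _ _] := @atlas_chart R E G _ Ac.
have [lU cU] := U_realify t.
rewrite [X in Ck _ _ X](_ : _ = fun y => U t (pi (gamma (- t) (cinv c y)) u) : realify H); last first.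
  by apply/funext => y /=; rewrite rep_U.
apply: (Ck_comp_lin hH hH hE (f := fun y => pi (gamma (- t) (cinv c y)) u : realify H)
  (L := U t)) => //.
have [_ sg _] := hgamma_aut (- t).
apply: (@smooth_family_cst E u su E _ (gamma (- t) \o cinv c) (fun=> 0)) => //.
  apply: (smooth_into_comp hE hE hE (@atlas_chart R E G) (@atlas_cover R E G)
    (@atlas_chart R E G) oic sg); exact: smooth_into_cinv.
by move=> j; exact: Ck_cst.
Qed.

(* The chain rule at 1 suffices: that gamma (- t) (e (s x)) is the one-parameter
   group generated by lieL (gamma (- t)) x is never needed. *)
Lemma dpi_real_U t x u : smooth_vector pi u ->
  dpi_real e pi x (U t u) = U t (dpi_real e pi (lieL (gamma (- t)) x) u).
Proof.
move=> su; rewrite [in RHS]dpi_realE //; case: (he) => [[ce _] _ ve].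
have [gM sg _] := hgamma_aut (- t); have [_ cU] := U_realify t.
have Ac1 := @chart1_atlas R E G; have hc1 := @atlas_chart R E G _ Ac1.
have [oc oic ck _ _] := hc1; have c11 := @chart1_dom R E G.
have ce0 : {for (0 : R), continuous (fun s : R => e (s *: x))}.
  apply: continuous_comp; last exact: ce.
  by apply: (@tvs_cvgZ R E _ (nbhs (0 : R)) _ id (fun=> x)); [exact: cvg_id|exact: cvg_cst].
have e0 : e ((0 : R) *: x) = 1%g by rewrite scale0r exp_0.
have ogc : open (gamma (- t) @^-1` cdom c1).
  by apply: open_comp => // y _; exact: sg.1.
have H1 : dquot (fun s : R^o => pi (gamma (- t) (e (s *: x))) u : realify H) 0 1 t'
    @[t' --> 0^'] --> ddiff (fun y => pi (cinv c1 y) u : realify H) (cfun c1 1%g)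
      (lieL (gamma (- t)) x).
  apply: rep_derive_chart1 => //.
  - by apply: continuous_comp => //; exact: sg.1.
  - by rewrite e0 gamma_1.
  have := dquot_comp (x := 0) (h := 1) (f := fun s : R^o => cfun c1 (e (s *: x)))
    (open_chart_image hc1 ogc) (sg.2 _ _ Ac1 Ac1 1%N) _ (ve x).
  rewrite e0 => H1; have {}H1 := H1 _.
  have : (cfun c1 @` (cdom c1 `&` gamma (- t) @^-1` cdom c1)) (cfun c1 1%g).
    by exists 1%g => //; split => //=; rewrite gamma_1.
  move=> /H1; apply: cvg_trans; apply: near_eq_cvg.
  have nf : \forall s \near (0 : R)^', cdom c1 (e ((0 + s *: (1 : R^o)) *: x)).
    have := @tvs_line R R^o 0 1 ((fun s : R => e (s *: x)) @^-1` cdom c1).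
    by apply; apply: ce0; rewrite e0; exact: open_nbhs_nbhs.
  near=> s; rewrite /dquot /= ck; last by near: s.
  by rewrite ck // e0.
rewrite /dpi_real; apply: (@ddiff_eq R R^o (realify H) hH).
apply: cvg_trans; last apply: (@cvg_comp _ _ _ _ (U t : realify H -> realify H) _ _ _ H1).
  apply: near_eq_cvg; near=> s.
  rewrite /dquot /=.
  have rs (r : R) (w : realify H) : r *: w = (r%:C *: (w : H) : H) by [].
  by rewrite !rs U_Z U_D -[- pi _ _]scaleN1r U_Z scaleN1r -!rep_U.
exact: cU.
Unshelve. all: by end_near. Qed.

Lemma dpi_seq_U t zs u : smooth_vector pi u ->
  dpi_seq e pi zs (U t u) = U t (dpi_seq e pi [seq lieLC (gamma (- t)) z | z <- zs] u).
Proof.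
move=> su; elim: zs => //= z zs ->.
have sv := smooth_vector_dpi_seq [seq lieLC (gamma (- t)) z | z <- zs] su.
by rewrite /dpi !dpi_real_U // -U_Z -U_D.
Qed.

Lemma smooth_average (f : R -> R[i]) (v : H) : smooth_vector pi v ->
  measurable_fun setT (fun t => complex.Re (f t)) ->
  measurable_fun setT (fun t => complex.Im (f t)) ->
  (forall n p, cont_seminorm p -> exists (k : R -> R) (q : complexification E -> R),
    [/\ cont_seminorm q, (@lebesgue_measure R).-integrable setT (EFin \o k),
      forall t, 0 <= k t & forall zs t, size zs = n ->
        complex.Re `|f t| * \prod_(z <- zs) p (lieLC (gamma (- t)) z) <=
        k t * \prod_(z <- zs) q z]) ->
  smooth_vector pi (U_int ip U f v) /\
  forall zs, is_weak_integral ip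
    (fun t => f t *: U t (dpi_seq e pi [seq lieLC (gamma (- t)) z | z <- zs] v))
    (dpi_seq e pi zs (U_int ip U f v)).
Proof.
move=> sv mRe mIm dom.
have su t : smooth_vector pi (U t v) by exact: smooth_vector_U.
have mU w : measurable_fun setT (fun t => rdot ip (U t v) w).
  apply: continuous_measurable_fun => t; apply: (rdot_cvg hip).
  by case: hU => _ _; apply.
have bnd n : exists (k : R -> R) (q : complexification E -> R),
    [/\ cont_seminorm q, (@lebesgue_measure R).-integrable setT (EFin \o k),
      forall t, 0 <= k t & forall zs t, size zs = n ->
        rnorm (f t *: dpi_seq e pi zs (U t v)) <= k t * \prod_(z <- zs) q z].
  (* A constant family over the auxiliary parameter space E specializes local boundedness to the
     single vector v. *)
  have [C [W [N [nW nN CWN]]]] :=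
    dpi_seq_locally_bounded n hE (0 : E) (smooth_family_cst (P := E) sv).
  have CW zs : size zs = n -> (forall z, z \in zs -> W z) ->
      `|dpi_seq e pi zs v| <= C%:C.
    by move=> szs zW; apply: (CWN zs (0 : E)) => //; exact: nbhs_singleton.
  have [p sp hp] := multilin_bound (dpi_seq_multilin sv) nW CW.
  have [k [q [sq ik k0 kq]]] := dom n p sp.
  exists (fun t => `|C| * k t), q; split => //.
  - exact: (integrableZl measurableT `|C| ik).
  - by move=> t; rewrite mulr_ge0.
  (* Commuting with U_t replaces each z by alpha_{-t} z, and the isometry U_t then disappears from
     the norm. *)
  move=> zs t szs; rewrite dpi_seq_U // rnormZ.
  have -> : rnorm (U t (dpi_seq e pi [seq lieLC (gamma (- t)) z | z <- zs] v)) =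
      rnorm (dpi_seq e pi [seq lieLC (gamma (- t)) z | z <- zs] v) by rewrite /rnorm U_isom.
  have := hp [seq lieLC (gamma (- t)) z | z <- zs]; rewrite size_map rnorm_le big_map.
  move=> /(_ szs) h; apply: le_trans (ler_wpM2l _ h) _.
    by rewrite -ler0c -normC_realE normr_ge0.
  rewrite mulrCA -mulrA; apply: ler_wpM2l => //; exact: kq.
(* On the empty list [avg] unfolds to [U_int]. *)
have UE : U_int ip U f v = avg f (fun t => U t v) [::] by [].
rewrite UE; split; first exact: smooth_vector_avg.
move=> zs; rewrite (dpi_seq_avg su mRe mIm mU bnd).
have := avgP su mRe mIm mU bnd zs.
rewrite (_ : (fun t => f t *: dpi_seq e pi zs (U t v)) = (fun t => f t *:
  U t (dpi_seq e pi [seq lieLC (gamma (- t)) z | z <- zs] v))) //.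
by apply/funext => t; rewrite dpi_seq_U.
Qed.

End covariance.

End representation.

Theorem theorem2p3 (R : realType)
  (E : tvsType R) (hE : hausdorff_space E) (G : lieGroupType E)
  (e : E -> G) (he : smooth_exp_map e)
  (gamma : R -> G -> G)
  (hgamma_aut : forall t, lie_aut (gamma t))
  (hgamma_add : forall s t g, gamma (s + t) g = gamma s (gamma t g))
  (hgamma_cont : continuous (fun p : R * G => gamma p.1 p.2))
  (H : completeNormedModType R[i]) (ip : {dot H for Num.conj})
  (hip : forall v, `|v| ^+ 2 = ip v v)
  (pi : G -> H -> H)
  (hpi : cont_unitary_rep ip (fun g h : G => (g * h)%g) pi)
  (U : R -> H -> H)
  (hU : cont_unitary_rep ip (fun s t : R => s + t) U)
  (hpiU : cont_unitary_rep ip (sdmul gamma) (fun a v => pi a.1 (U a.2 v)))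
  (f : R -> R[i]) :
  let alpha := fun t => lieLC (gamma t) in
  (equicontinuous_group alpha /\ c_integrable f) \/
  (poly_bounded alpha /\ schwartz f) ->
  (forall v, smooth_vector pi v -> smooth_vector pi (U_int ip U f v)) /\
  (forall (n : nat) (y : n.-tuple (complexification E)) (v : H),
    (0 < n)%N -> smooth_vector pi v ->
    is_weak_integral ip
      (fun t => f t *: U t (dpi_seq e pi [seq alpha (- t) z | z <- y] v))
      (dpi_seq e pi y (U_int ip U f v))).
Proof.
move=> alpha hf.
have [mRe mIm] : measurable_fun setT (fun t => complex.Re (f t)) /\
    measurable_fun setT (fun t => complex.Im (f t)).
  by case: hf => -[_]; [exact: c_integrable_measurable|exact: schwartz_measurable].
have main v : smooth_vector pi v -> smooth_vector pi (U_int ip U f v) /\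
  forall zs, is_weak_integral ip
    (fun t => f t *: U t (dpi_seq e pi [seq alpha (- t) z | z <- zs] v))
    (dpi_seq e pi zs (U_int ip U f v)).
  move=> sv; apply: (smooth_average hE he hip hpi hgamma_aut hgamma_add hU hpiU sv mRe mIm).
  case: hf => -[ha hf] n p sp.
    exact: (equicontinuous_domination ha hf n sp).
  exact: (poly_bounded_domination ha hf n sp).
split=> [v /main[]//|n y v _ /main[_]]; exact.
Qed.
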